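(* Let $d\ge1$, $\beta>d/2$, $M\ge1$, $a:=d/(2\beta)$, $b:=\log M$, let $\rho$ be a $\sigma$-finite positive measure on $\mathbb{R}^d$, and let $\mathcal{G}$ be a class of measurable functions on $\mathbb{R}^d$ that is separable with respect to pointwise convergence on $\mathrm{spt}(\rho)$, satisfies $\|g\|_{\infty,\rho}\le b$ for all $g\in\mathcal{G}$, and $$\sup_\gamma\log N(\epsilon,\mathcal{G},\|\cdot\|_{2,\gamma})\le\hat c_{d,\beta}(b\epsilon^{-1})^{d/\beta}\quad\forall\epsilon>0$$ for some $\hat c_{d,\beta}\ge0$, the supremum being over finitely supported probability measures $\gamma$ with $\mathrm{spt}(\gamma)\subseteq\mathrm{spt}(\rho)$. There is a universal constant $C\ge1$ such that, with $c_{d,\beta}:=C\max\{1,\sqrt{\hat c_{d,\beta}}/(1-a)\}$, for all $\delta\ge0$, $n\in\mathbb{N}$, $z\ge0$ and all $(\mu,\nu)\in\bar{\mathcal{P}}_{M,\rho}(\mathcal{G},\delta)$, with $X_1,\dots,X_n$ i.i.d. $\sim\mu$, $Y_1,\dots,Y_n$ i.i.d. $\sim\nu$ and empirical measures $\hat\mu_n,\hat\nu_n$: (i) $\mathbb{P}\Big(\big|\hat{\mathsf{D}}_{\mathsf{KL}}^{\mathcal{G}}(\hat\mu_n,\hat\nu_n)-\mathsf{D}_{\mathsf{KL}}(\mu\|\nu)\big|\ge(M+1)\delta+c_{d,\beta}M(1+(\log M)^a)(n^{-1/2}+z)\Big)\le 2e^{-(nz^2\wedge nz)}$; (ii) for every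 $\alpha\in(0,1)\cup(1,\infty)$, $\mathbb{P}\Big(\big|\hat{\mathsf{D}}_\alpha^{\mathcal{G}}(\hat\mu_n,\hat\nu_n)-\mathsf{D}_\alpha(\mu\|\nu)\big|\ge(M^{2\alpha}+M^{2|\alpha-1|})\delta+c_{d,\beta}v_{M,\alpha,a}(n^{-1/2}+z)\Big)\le 2e^{-(nz^2\wedge nz)}$, where $v_{M,\alpha,a}:=\frac{\alpha M^{2|\alpha-1|}}{|\alpha-1|}\big(1+(|\alpha-1|\log M)^{a/2}\big)+M^{2\alpha}\big(1+(\alpha\log M)^a\big)$.
   Context: Estimators: $\hat{\mathsf{D}}_{\mathsf{KL}}^{\mathcal{G}}(\hat\mu_n,\hat\nu_n):=\sup_{g\in\mathcal{G}}\mathbb{E}_{\hat\mu_n}[g]-\mathbb{E}_{\hat\nu_n}[e^g]+1$ and $\hat{\mathsf{D}}_\alpha^{\mathcal{G}}(\hat\mu_n,\hat\nu_n):=\sup_{g\in\mathcal{G}}\frac{\alpha}{\alpha-1}\log\mathbb{E}_{\hat\mu_n}[e^{(\alpha-1)g}]-\log\mathbb{E}_{\hat\nu_n}[e^{\alpha g}]$. $N(\epsilon,\mathcal{G},\|\cdot\|_{2,\gamma})$ is the $\epsilon$-covering number in $L^2(\gamma)$. $\mathsf{D}_{\mathsf{KL}}$ and $\mathsf{D}_\alpha$ are the KL and Rényi divergences. $\bar{\mathcal{P}}_{M,\rho}(\mathcal{G},\delta)$ is the set of pairs of Borel probability measures $(\mu,\nu)$ on $\mathbb{R}^d$ with $\mu\ll\nu$,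 $\nu\ll\mu$, $\nu\ll\rho$, $\|p_\mu/p_\nu\|_{\infty,\rho}\vee\|p_\nu/p_\mu\|_{\infty,\rho}\le M$ (with $p_\mu=d\mu/d\rho$), and such that some $g\in\mathcal{G}$ satisfies $\|\log\frac{d\mu}{d\nu}-g\|_{\infty,\rho}\le\delta$. *)

(* Defs.v *)
From HB Require Import structures.
From mathcomp Require Import all_boot all_order all_algebra.
From mathcomp Require Import all_classical all_reals all_analysis ess_sup_inf.
Set Implicit Arguments. Unset Strict Implicit. Unset Printing Implicit Defensive.
Import Order.TTheory GRing.Theory Num.Theory numFieldNormedType.Exports.
Local Open Scope classical_set_scope.
Local Open Scope ring_scope.

(* R^d is modelled as d.-tuple R, with the product (= Borel) sigma-algebra
   provided by MathComp-Analysis (measurable_structure.v). *)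

Section defs.
Variable R : realType.

Definition spt (d : nat) (rho : {measure set (d.-tuple R) -> \bar R}) :
    set (d.-tuple R) :=
  [set x | forall e : R, 0 < e ->
     (0 < rho [set y | forall i : 'I_d, (`|tnth y i - tnth x i| < e)%R])%E].

Definition is_density dT (T : measurableType dT)
    (m mu : {measure set T -> \bar R}) (f : T -> R) : Prop :=
  measurable_fun setT f /\ (forall x, 0 <= f x) /\
  forall A, measurable A -> mu A = (\int[m]_(x in A) (f x)%:E)%E.

Definition pointwise_separable (T : Type) (S : set T) (G : set (T -> R)) :=
  exists G0 : set (T -> R), G0 `<=` G /\ countable G0 /\
    forall g, G g -> exists u : nat -> T -> R, (forall k, G0 (u k)) /\
      forall x, S x -> (fun k => u k x) @ \oo --> g x.

(* A finitely supported probability measure gamma = \sum_i w i * delta_(xs i)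
   is represented by its weights w and atoms xs; its L^2(gamma) norm: *)
Definition L2fin (T : Type) (m : nat) (w : 'I_m -> R) (xs : 'I_m -> T)
    (f : T -> R) : R :=
  Num.sqrt (\sum_(i < m) w i * f (xs i) ^+ 2).

(* epsilon-covering number N(eps, G, ||.||_{2,gamma}) (centres arbitrary
   functions, closed balls); +oo if there is no finite cover. *)
Definition covering_number (T : Type) (m : nat) (w : 'I_m -> R)
    (xs : 'I_m -> T) (eps : R) (G : set (T -> R)) : \bar R :=
  ereal_inf [set (N%:R)%:E | N in [set N : nat | exists h : 'I_N -> T -> R,
     forall g, G g -> exists j : 'I_N, L2fin w xs (g \- h j) <= eps]].

Definition mutually_independent dO (O : measurableType dO) dT
    (T : measurableType dT) (P : probability O R) (I : finType)
    (Z : I -> O -> T) : Prop :=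
  (forall i, measurable_fun setT (Z i)) /\
  forall A : I -> set T, (forall i, measurable (A i)) ->
    P (\bigcap_(i in [set: I]) (Z i @^-1` A i)) =
    (\prod_(i : I) P (Z i @^-1` A i))%E.

Definition outer_prob dO (O : measurableType dO) (P : probability O R)
    (E : set O) : \bar R :=
  ereal_inf [set P A | A in [set A | measurable A /\ E `<=` A]].

Definition emp_mean (O T : Type) (n : nat) (X : 'I_n -> O -> T)
    (h : T -> R) (omega : O) : R :=
  n%:R^-1 * \sum_(i < n) h (X i omega).

Definition DKL_hat (O T : Type) (G : set (T -> R)) (n : nat)
    (X Y : 'I_n -> O -> T) (omega : O) : \bar R :=
  ereal_sup [set (emp_mean X g omega - emp_mean Y (fun x => expR (g x)) omega
                  + 1)%:E | g in G].

Definition Dalpha_hat (O T : Type) (alpha : R) (G : set (T -> R)) (n : nat)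
    (X Y : 'I_n -> O -> T) (omega : O) : \bar R :=
  ereal_sup [set (alpha / (alpha - 1) *
                    ln (emp_mean X (fun x => expR ((alpha - 1) * g x)) omega)
                  - ln (emp_mean Y (fun x => expR (alpha * g x)) omega))%:E
            | g in G].

(* KL divergence D_KL(mu||nu) = \int log(dmu/dnu) dmu, where f = dmu/dnu *)
Definition DKL dT (T : measurableType dT) (mu : {measure set T -> \bar R})
    (f : T -> R) : \bar R :=
  (\int[mu]_x (ln (f x))%:E)%E.

(* Renyi divergence D_alpha(mu||nu) = 1/(alpha-1) log \int (dmu/dnu)^alpha dnu,
   where f = dmu/dnu *)
Definition Dalpha dT (T : measurableType dT) (alpha : R)
    (nu : {measure set T -> \bar R}) (f : T -> R) : \bar R :=
  ((alpha - 1)^-1 * ln (fine (\int[nu]_x (f x `^ alpha)%:E)%E))%:E.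

End defs.

(* Main.v *)
Require Import Defs.
From HB Require Import structures.
From mathcomp Require Import all_boot all_order all_algebra.
From mathcomp Require Import all_classical all_reals all_analysis ess_sup_inf measurable_realfun.
From mathcomp Require Import ring lra.

(* Off a null set, log(dmu/dnu) and all members of a countable dense part of G
   are bounded by log M and one member g* is delta-close to log(dmu/dnu);
   composing with a retraction onto the good set makes these bounds hold
   everywhere. By the variational formulas (Young, Hoelder) the population
   objective never exceeds the divergence D, and at g* it is D up to the bias
   term. Hence the estimator exceeds D only through a supremum of an empirical
   process, controlled in mean by symmetrization and chaining (uniform over
   samples, since the entropy bound covers all finitely supported measures) and
   in probability by McDiarmid's inequality; it falls below D - bias only
   through the deviation at the single function g*.

   For the Renyi objective with alpha >= 3/4 the logarithms are linearised
   crudely. For alpha < 3/4 this would cost (|alpha - 1| log M)^a instead of its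
   square root. There the values of the log ratio of the two empirical means are
   cut into slices of width 1, and on each slice a pointwise Young inequality
   reduces the excess over D to the process indexed by
   (dmu/dnu)^(alpha-1) psi(g - log(dmu/dnu) - j), which is Lipschitz in g with
   an envelope of small second moment. *)
Set Implicit Arguments. Unset Strict Implicit. Unset Printing Implicit Defensive.
Import Order.TTheory GRing.Theory Num.Theory numFieldNormedType.Exports.
Local Open Scope classical_set_scope.
Local Open Scope ring_scope.

(** * Means of bounded functions *)

Section bounded_measurable.
Context (R : realType) d (T : measurableType d).
Implicit Types (f g : T -> R) (p : probability T R).

(** Three points shape the argument. A supremum over an uncountable class need not be measurable, so
    every estimate is for a finite subclass, with constants that do not see its size; continuity of
    the measure along increasing unions and separability do the rest. The two samples are pooled
    into one tuple of [n + n] independent coordinates with two laws, so that one symmetrization and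
    one bounded-difference inequality serve both empirical means. Finally, chaining sees a class
    only through an envelope and a number L, its Lipschitz constant in g times b over the envelope,
    and costs a factor growing like L^a. The exponential of (alpha - 1) g has L = |alpha - 1| b, and
    for alpha near 0 no other term of the bound can absorb the excess over the square root; the
    functions built from [psi] have L = 1. The price is polynomial in b, from the number of slices
    and from the envelope. It is affordable because (dmu/dnu)^(alpha-1) has second moment at most
    exp(|2 alpha - 1| b) under mu, smaller than its squared maximal size exp(2 (1 - alpha) b) as
    long as alpha < 3/4. *)

Definition bmeas f := measurable_fun setT f /\ exists c : R, forall x, `|f x| <= c.

Lemma bmeas_cst (c : R) : bmeas (fun=> c).
Proof. by split; [exact: measurable_cst | exists `|c|]. Qed.

Lemma bmeasD f g : bmeas f -> bmeas g -> bmeas (fun x => f x + g x).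
Proof.
move=> [mf [c cf]] [mg [c' cg]]; split; first exact: measurable_funD.
by exists (c + c') => x; apply: (le_trans (ler_normD _ _)); exact: lerD.
Qed.

Lemma bmeasM f g : bmeas f -> bmeas g -> bmeas (fun x => f x * g x).
Proof.
move=> [mf [c cf]] [mg [c' cg]]; split; first exact: measurable_funM.
by exists (c * c') => x; rewrite normrM; apply: ler_pM.
Qed.

Lemma bmeasZ (c : R) f : bmeas f -> bmeas (fun x => c * f x).
Proof. by apply: bmeasM; exact: bmeas_cst. Qed.

Lemma bmeasN f : bmeas f -> bmeas (fun x => - f x).
Proof.
by move=> /(bmeasZ (-1)); under [X in bmeas X]funext do rewrite mulN1r.
Qed.

Lemma bmeasB f g : bmeas f -> bmeas g -> bmeas (fun x => f x - g x).
Proof. by move=> bf bg; apply: bmeasD => //; exact: bmeasN. Qed.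

Lemma bmeas_norm f : bmeas f -> bmeas (fun x => `|f x|).
Proof.
move=> [mf [c cf]]; split; first exact: measurableT_comp.
by exists c => x; rewrite normr_id.
Qed.

Lemma bmeas_max f g : bmeas f -> bmeas g -> bmeas (fun x => Num.max (f x) (g x)).
Proof.
move=> [mf [c cf]] [mg [c' cg]]; split; first exact: measurable_maxr.
exists (Num.max c c') => x; rewrite le_max.
by case: (leP (f x) (g x)) => _; rewrite ?cf ?cg ?orbT.
Qed.

Lemma bmeas_sum (I : Type) (s : seq I) (P : pred I) (F : I -> T -> R) :
  (forall i, P i -> bmeas (F i)) -> bmeas (fun x => \sum_(i <- s | P i) F i x).
Proof.
move=> bF; elim: s => [|i s IH].
  by under [X in bmeas X]funext do rewrite big_nil; exact: bmeas_cst.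
under [X in bmeas X]funext do rewrite big_cons.
by case: (boolP (P i)) => // Pi; exact: bmeasD (bF _ Pi) IH.
Qed.

Lemma bmeas_bigmax (I : Type) (s : seq I) (P : pred I) (x0 : T -> R)
    (F : I -> T -> R) : bmeas x0 -> (forall i, bmeas (F i)) ->
  bmeas (fun x => \big[Num.max/x0 x]_(i <- s | P i) F i x).
Proof.
move=> b0 bF; elim: s => [|i s IH].
  by under [X in bmeas X]funext do rewrite big_nil.
under [X in bmeas X]funext do rewrite big_cons.
by case: (P i) => //; exact: bmeas_max (bF _) IH.
Qed.

Lemma bmeas_expR f : bmeas f -> bmeas (fun x => expR (f x)).
Proof.
move=> [mf [c cf]]; split; first exact: measurableT_comp.
exists (expR c) => x; rewrite ger0_norm ?expR_ge0// ler_expR.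
exact: le_trans (ler_norm _) (cf _).
Qed.

Lemma bmeas_ln f (l : R) : 0 < l -> (forall x, l <= f x) -> bmeas f ->
  bmeas (fun x => ln (f x)).
Proof.
move=> l0 lf [mf [c cf]]; split; first exact: measurableT_comp.
have f0 x : 0 < f x by exact: lt_le_trans l0 (lf x).
exists (Num.max `|ln l| `|ln c|) => x.
have fc : f x <= c by exact: le_trans (ler_norm _) (cf _).
have c0 : 0 < c by exact: lt_le_trans (f0 x) fc.
have h1 : ln l <= ln (f x) by rewrite ler_ln ?posrE.
have h2 : ln (f x) <= ln c by rewrite ler_ln ?posrE.
rewrite le_max; case: (leP 0 (ln (f x))) => h.
  by rewrite (ger0_norm h) (le_trans h2 (ler_norm _)) orbT.
rewrite (ltr0_norm h); apply/orP; left.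
by rewrite -normrN; apply: le_trans (ler_norm _); rewrite lerN2.
Qed.

Lemma prob_setT p : p setT = 1%E.
Proof. exact: probability_setT. Qed.

Lemma bmeas_integrable p f : bmeas f -> p.-integrable setT (EFin \o f).
Proof.
move=> [mf [c cf]]; apply: measurable_bounded_integrable => //.
  by apply: le_lt_trans (ltry 1); rewrite -(prob_setT p).
exists c; split; first exact: num_real.
by move=> M cM x _ /=; exact: le_trans (cf x) (ltW cM).
Qed.

Lemma bmeas_integralE p f : bmeas f ->
  (\int[p]_x (f x)%:E)%E = (\int[p]_x f x)%:E.
Proof.
move=> /(bmeas_integrable p) bf.
by rewrite /Rintegral fineK//; exact: integrable_fin_num bf.
Qed.

Lemma meanD p f g : bmeas f -> bmeas g ->
  \int[p]_x (f x + g x) = \int[p]_x f x + \int[p]_x g x.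
Proof. by move=> bf bg; rewrite RintegralD//; exact: bmeas_integrable. Qed.

Lemma meanB p f g : bmeas f -> bmeas g ->
  \int[p]_x (f x - g x) = \int[p]_x f x - \int[p]_x g x.
Proof. by move=> bf bg; rewrite RintegralB//; exact: bmeas_integrable. Qed.

Lemma meanZ p (c : R) f : bmeas f -> \int[p]_x (c * f x) = c * \int[p]_x f x.
Proof. by move=> bf; rewrite RintegralZl//; exact: bmeas_integrable. Qed.

Lemma meanN p f : bmeas f -> \int[p]_x (- f x) = - \int[p]_x f x.
Proof.
move=> bf; rewrite -mulN1r -meanZ//; apply: eq_Rintegral => x _.
by rewrite mulN1r.
Qed.

Lemma mean_cst p (c : R) : \int[p]_x c = c.
Proof.
by rewrite Rintegral_cst//; have /= -> := prob_setT p; rewrite mulr1.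
Qed.

Lemma le_mean p f g : bmeas f -> bmeas g -> (forall x, f x <= g x) ->
  \int[p]_x f x <= \int[p]_x g x.
Proof. by move=> bf bg fg; apply: le_Rintegral => //; exact: bmeas_integrable. Qed.

Lemma eq_mean p f g : f =1 g -> \int[p]_x f x = \int[p]_x g x.
Proof. by move=> fg; apply: eq_Rintegral => x _; exact: fg. Qed.

Lemma mean_sum p (I : Type) (s : seq I) (F : I -> T -> R) :
  (forall i, bmeas (F i)) ->
  \int[p]_x (\sum_(i <- s) F i x) = \sum_(i <- s) \int[p]_x F i x.
Proof.
move=> bF; elim: s => [|i s IH].
  by rewrite big_nil; under eq_mean do rewrite big_nil; exact: mean_cst.
under eq_mean do rewrite big_cons.
by rewrite meanD// ?IH ?big_cons//; exact: bmeas_sum.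
Qed.

Lemma mean_ge_cst p (c : R) f : bmeas f -> (forall x, c <= f x) ->
  c <= \int[p]_x f x.
Proof.
by move=> bf cf; rewrite -[leLHS](mean_cst p); apply: le_mean => //; exact: bmeas_cst.
Qed.

Lemma mean_le_cst p (c : R) f : bmeas f -> (forall x, f x <= c) ->
  \int[p]_x f x <= c.
Proof.
by move=> bf cf; rewrite -[leRHS](mean_cst p); apply: le_mean => //; exact: bmeas_cst.
Qed.

Lemma le_norm_mean p f : bmeas f -> `|\int[p]_x f x| <= \int[p]_x `|f x|.
Proof. by move=> bf; apply: le_normr_Rintegral => //; exact: bmeas_integrable. Qed.

Lemma markov_mean p f (c : R) : bmeas f -> (forall x, 0 <= f x) -> 0 < c ->
  (p [set x | (c <= f x)%R] <= (\int[p]_x f x / c)%:E)%E.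
Proof.
move=> bf f0 c0.
have mS : measurable [set x | c <= f x].
  rewrite (_ : [set _ | _] = f @^-1` `[c, +oo[); last first.
    by apply/seteqP; split => x /=; rewrite in_itv/= andbT.
  by rewrite -[X in measurable X]setTI; apply: bf.1.
have fin : (p [set x | (c <= f x)%R] \is a fin_num)%E by exact: fin_num_measure.
rewrite -(fineK fin) lee_fin ler_pdivlMr//.
have bS : bmeas (fun x => c * \1_[set x | c <= f x] x).
  apply: bmeasZ; split; first exact: measurable_indic.
  by exists 1 => x; rewrite indicE; case: (_ \in _); rewrite ?normr1 ?normr0.
have -> : fine (p [set x | c <= f x]) * c =
    \int[p]_x (c * \1_[set x | c <= f x] x).
  rewrite meanZ; last first.
    split; first exact: measurable_indic.
    by exists 1 => x; rewrite indicE; case: (_ \in _); rewrite ?normr1 ?normr0.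
  by rewrite mulrC /Rintegral integral_indic// setIT.
apply: le_mean => // x; rewrite indicE.
by case: (boolP (x \in _)) => [/set_mem /=|_]; [rewrite mulr1 | rewrite mulr0].
Qed.

End bounded_measurable.

Lemma bmeas_comp (R : realType) d1 (T1 : measurableType d1) d2
    (T2 : measurableType d2) (h : T1 -> T2) (f : T2 -> R) :
  measurable_fun setT h -> bmeas f -> bmeas (fun x => f (h x)).
Proof.
move=> mh [mf [c cf]]; split; first exact: measurableT_comp mf mh.
by exists c.
Qed.

(** * Fubini for bounded functions *)

Section fubini_bounded.
Context (R : realType) d1 (T1 : measurableType d1) d2 (T2 : measurableType d2).
Variables (p1 : probability T1 R) (p2 : probability T2 R) (F : T1 * T2 -> R).
Hypothesis bF : bmeas F.

Let intF : ((p1 \x p2)%E).-integrable setT (fun xt => (F xt)%:E).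
Proof. exact: (bmeas_integrable ((p1 \x p2)%E : probability _ _)). Qed.

Lemma bmeas_slice1 x : bmeas (fun y => F (x, y)).
Proof. by apply: bmeas_comp bF; exact: pair1_measurable. Qed.

Lemma bmeas_slice2 y : bmeas (fun x => F (x, y)).
Proof. by apply: bmeas_comp bF; exact: pair2_measurable. Qed.

Lemma bmeas_mean1 : bmeas (fun x => \int[p2]_y F (x, y)).
Proof.
have [_ [c cF]] := bF; split; last first.
  exists c => x; apply: (le_trans (le_norm_mean _ (bmeas_slice1 x))).
  by apply: mean_le_cst => //; apply: bmeas_norm; exact: bmeas_slice1.
apply: measurableT_comp => //.
exact: (measurable_fubini_F intF).
Qed.

Lemma bmeas_mean2 : bmeas (fun y => \int[p1]_x F (x, y)).
Proof.
have [_ [c cF]] := bF; split; last first.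
  exists c => y; apply: (le_trans (le_norm_mean _ (bmeas_slice2 y))).
  by apply: mean_le_cst => //; apply: bmeas_norm; exact: bmeas_slice2.
apply: measurableT_comp => //.
exact: (measurable_fubini_G intF).
Qed.

Lemma mean_pair :
  \int[(p1 \x p2)%E : probability _ _]_xy F xy = \int[p1]_x \int[p2]_y F (x, y).
Proof.
apply: EFin_inj; rewrite -!bmeas_integralE//; last exact: bmeas_mean1.
have inner x : (\int[p2]_y F (x, y))%:E = (\int[p2]_y (F (x, y))%:E)%E.
  by rewrite bmeas_integralE//; exact: bmeas_slice1.
under [RHS]eq_integral do rewrite inner.
by rewrite -(integral12_prod_meas1 intF).
Qed.

Lemma mean_swap :
  \int[p1]_x \int[p2]_y F (x, y) = \int[p2]_y \int[p1]_x F (x, y).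
Proof.
apply: EFin_inj; rewrite -!bmeas_integralE//;
  [|exact: bmeas_mean2|exact: bmeas_mean1].
have inner x : (\int[p2]_y F (x, y))%:E = (\int[p2]_y (F (x, y))%:E)%E.
  by rewrite bmeas_integralE//; exact: bmeas_slice1.
have inner' y : (\int[p1]_x F (x, y))%:E = (\int[p1]_x (F (x, y))%:E)%E.
  by rewrite bmeas_integralE//; exact: bmeas_slice2.
under [LHS]eq_integral do rewrite inner.
under [RHS]eq_integral do rewrite inner'.
exact: (Fubini intF).
Qed.

End fubini_bounded.

(** * Finite products of non-identical probability measures *)

Section product_probability.
Context (R : realType) d (T : measurableType d).

Definition tcons n (xt : T * n.-tuple T) : n.+1.-tuple T := [tuple of xt.1 :: xt.2].

Lemma measurable_tcons n : measurable_fun setT (@tcons n).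
Proof. exact: measurable_cons. Qed.

HB.instance Definition _ n :=
  isMeasurableFun.Build _ _ _ _ (@tcons n) (@measurable_tcons n).

(** The factors may differ, since the pooled sample has two laws. Recursion on the head coordinate
    turns every induction on [n] into one use of Fubini with the family [p] shifted by one. *)
Fixpoint prodm (p : nat -> probability T R) n : probability (n.-tuple T) R :=
  match n with
  | 0 => dirac [tuple]
  | n'.+1 => distribution (p 0%N \x prodm (fun i => p i.+1) n')%E (@tcons n')
  end.

Implicit Types p : nat -> probability T R.

Lemma bmeas_tcons n (F : n.+1.-tuple T -> R) : bmeas F ->
  bmeas (fun xt => F (tcons xt)).
Proof. by apply: bmeas_comp; exact: measurable_tcons. Qed.

Lemma mean_prodmS p n (F : n.+1.-tuple T -> R) : bmeas F ->
  \int[prodm p n.+1]_t F t =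
  \int[p 0%N]_x \int[prodm (fun i => p i.+1) n]_t F (tcons (x, t)).
Proof.
move=> bF; rewrite -(mean_pair _ _ (bmeas_tcons bF)).
apply: EFin_inj; rewrite -!bmeas_integralE//; last exact: bmeas_tcons.
rewrite /= integral_pushforward//=.
- by move/measurable_EFinP : (bF.1).
- rewrite preimage_setT.
  apply: (bmeas_integrable ((p 0%N \x prodm (fun i => p i.+1) n)%E : probability _ _)).
  exact: bmeas_tcons.
Qed.

Lemma mean_prodm0 p (F : 0.-tuple T -> R) : \int[prodm p 0]_t F t = F [tuple].
Proof.
have -> : F = fun=> F [tuple] by apply: funext => t; rewrite tuple0.
by rewrite mean_cst.
Qed.

Lemma prodm_rect p n (A : 'I_n -> set T) : (forall i, measurable (A i)) ->
  prodm p n [set t | forall i, A i (tnth t i)] = (\prod_(i < n) p i (A i))%E.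
Proof.
elim: n p A => [|n IH] p A mA.
  rewrite big_ord0 /= diracE mem_set//.
  by case.
rewrite big_ord_recl /= /distribution /pushforward.
have -> : @tcons n @^-1` [set t | forall i, A i (tnth t i)] =
    A ord0 `*` [set t | forall i, A (lift ord0 i) (tnth t i)].
  apply/seteqP; split => [[x t] /= H|[x t] /= [H1 H2] i].
    split; first exact: (H ord0).
    by move=> i; have := H (lift ord0 i); rewrite tnthS.
  by case: (unliftP ord0 i) => [j|] ->//; rewrite tnthS.
rewrite product_measure1E//; last first.
  have -> : [set t : n.-tuple T | forall i, A (lift ord0 i) (tnth t i)] =
      \bigcap_(i in [set: 'I_n]) ((@tnth n T ^~ i) @^-1` A (lift ord0 i)).
    by apply/seteqP; split => [t H i _|t H i]; [exact: H | exact: H].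
  apply: fin_bigcap_measurable => // i _.
  by rewrite -[X in measurable X]setTI; apply: measurable_tnth.
congr (_ * _)%E.
exact: (IH (fun i => p i.+1) (fun i => A (lift ord0 i))).
Qed.

(** Rectangles are stable under intersection and generate the sigma-algebra of tuples. This is what
    identifies the law of the observed sample with [prodm]. *)
Lemma prodm_unique p n (m : {measure set (n.-tuple T) -> \bar R}) :
  (forall A : 'I_n -> set T, (forall i, measurable (A i)) ->
     m [set t | forall i, A i (tnth t i)] = (\prod_(i < n) p i (A i))%E) ->
  forall B, measurable B -> m B = prodm p n B.
Proof.
move=> mE B mB.
pose G := [set B | exists A : 'I_n -> set T, (forall i, measurable (A i)) /\
  B = [set t : n.-tuple T | forall i, A i (tnth t i)]].
apply: (measure_unique G (fun=> setT)) => //.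
- apply/seteqP; split.
  + apply: smallest_sub; first exact: smallest_sigma_algebra.
    move=> C; rewrite -bigcup_seq => -[i _ [D mD <-]].
    apply: sub_sigma_algebra.
    exists (fun j => if j == i then D else setT); split.
      by move=> j; case: ifP.
    rewrite setTI; apply/seteqP; split => t /=.
      by move=> H j; case: eqP => // ->.
    by move=> /(_ i); rewrite eqxx.
  + apply: smallest_sub; first exact: sigma_algebra_measurable.
    move=> _ [A [mA ->]].
    have -> : [set t : n.-tuple T | forall i, A i (tnth t i)] =
        \bigcap_(i in [set: 'I_n]) ((@tnth n T ^~ i) @^-1` A i).
      by apply/seteqP; split => [t H i _|t H i]; [exact: H | exact: H].
    apply: fin_bigcap_measurable => // i _.
    by rewrite -[X in measurable X]setTI; apply: measurable_tnth.
- move=> _ _ [A [mA ->]] [A' [mA' ->]]; exists (fun i => A i `&` A' i); split.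
    by move=> i; exact: measurableI.
  by apply/seteqP; split => [t [H H'] i|t H]; split=> // i; case: (H i).
- by move=> _; exists (fun=> setT); split=> //; apply/seteqP; split.
- by apply/seteqP; split => // t _; exists 0%N.
- by move=> _ [A [mA ->]]; rewrite mE//; apply/esym/prodm_rect.
- move=> _; rewrite [X in m X](_ : _ =
      [set t : n.-tuple T | forall i : 'I_n, setT (tnth t i)]); last first.
    by apply/seteqP; split.
  rewrite (mE (fun=> setT)); last by move=> i; exact: measurableT.
  by rewrite big1 ?ltry// => i _; exact: prob_setT.
Qed.

Lemma mean_prodm_coord p n (i : 'I_n) (f : T -> R) : bmeas f ->
  \int[prodm p n]_t f (tnth t i) = \int[p i]_x f x.
Proof.
elim: n p i => [|n IH] p i bf; first by case: i.
rewrite mean_prodmS; last by apply: bmeas_comp bf; exact: measurable_tnth.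
case: (unliftP ord0 i) => [j|] ->.
  have inner x : \int[prodm (fun i => p i.+1) n]_t
      f (tnth (tcons (x, t)) (lift ord0 j)) = \int[p j.+1]_x f x.
    rewrite -(IH (fun i => p i.+1) j)//.
    by apply: eq_mean => t; rewrite tnthS.
  by under eq_mean do rewrite inner; rewrite mean_cst.
by apply: eq_mean => x; exact: (mean_cst _ (f x)).
Qed.

End product_probability.

(** * Symmetrization and chaining *)

Section exponential_inequalities.
Context (R : realType).
Implicit Types x y t : R.

(** The point of tangency is left free because its choice carries the idea each time: the mean for
    Jensen, the logarithm of the density ratio for the Kullback-Leibler bound. *)
Lemma expR_tangent x y : expR y * (1 + (x - y)) <= expR x.
Proof.
rewrite -{2}(subrK y x) expRD mulrC ler_wpM2r ?expR_ge0//.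
exact: expR_ge1Dx.
Qed.

Lemma expR_convex t x y : 0 <= t <= 1 ->
  expR (t * x + (1 - t) * y) <= t * expR x + (1 - t) * expR y.
Proof.
move=> /andP[t0 t1]; set z := t * x + (1 - t) * y.
have h1 := expR_tangent x z; have h2 := expR_tangent y z.
have t1' : 0 <= 1 - t by rewrite subr_ge0.
have -> : expR z = t * (expR z * (1 + (x - z))) + (1 - t) * (expR z * (1 + (y - z))).
  by rewrite /z; ring.
by apply: lerD; exact: ler_wpM2l.
Qed.

(** The sharp exponent is x^2 / 2; the weaker one has an elementary proof. For x >= 1/2 already x <=
    2 x^2, and below 1/2 the bounds 1/(1-x) and 1/(1+x) on the two exponentials average to
    1/(1-x^2). *)
Lemma cosh_le_gauss x : (expR x + expR (- x)) / 2 <= expR (2 * x ^+ 2).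
Proof.
wlog x0 : x / 0 <= x.
  move=> H; case: (leP 0 x) => [|/ltW] hx; first exact: H.
  by have := H (- x); rewrite oppr_ge0 opprK sqrrN addrC; apply.
have [hx|hx] := leP (1 / 2) x.
  apply: (@le_trans _ _ (expR x)).
    have : expR (- x) <= expR x by rewrite ler_expR; lra.
    lra.
  rewrite ler_expR expr2; nra.
have h1 : expR x <= (1 - x)^-1.
  rewrite -[expR x]opprK -(invrK (expR x)) opprK lef_pV2 ?posrE ?invr_gt0 ?expR_gt0//; last lra.
  rewrite -expRN; exact: expR_ge1Dx.
have h2 : expR (- x) <= (1 + x)^-1.
  rewrite expRN lef_pV2 ?posrE ?expR_gt0//; last lra.
  exact: expR_ge1Dx.
have h3 : 1 + 2 * x ^+ 2 <= expR (2 * x ^+ 2) by exact: expR_ge1Dx.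
apply: le_trans h3.
apply: (@le_trans _ _ ((1 - x)^-1 / 2 + (1 + x)^-1 / 2)); first lra.
have -> : (1 - x)^-1 / 2 + (1 + x)^-1 / 2 = (1 - x ^+ 2)^-1.
  by field; apply/and3P; split; apply/eqP; nra.
rewrite -[leLHS]mul1r ler_pdivrMr; last by rewrite expr2; nra.
have : 0 <= x ^+ 2 <= 1 / 2 by rewrite expr2; apply/andP; split; nra.
by move=> /andP[]; set u := x ^+ 2; nra.
Qed.

End exponential_inequalities.

(** * Rademacher averages of finite maxima *)

Section rademacher.
Context (R : realType).

Definition maxabs (K : finType) (u : K -> R) : R := \big[Num.max/0]_k `|u k|.

Lemma maxabs_ge0 (K : finType) (u : K -> R) : 0 <= maxabs u.
Proof. by apply: bigmax_ge_id. Qed.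

Lemma le_maxabs (K : finType) (u : K -> R) k : `|u k| <= maxabs u.
Proof. exact: le_bigmax. Qed.

Lemma maxabs_le (K : finType) (u : K -> R) c :
  0 <= c -> (forall k, `|u k| <= c) -> maxabs u <= c.
Proof. by move=> c0 uc; apply: bigmax_le. Qed.

Lemma maxabsD (K : finType) (u v : K -> R) :
  maxabs (fun k => u k + v k) <= maxabs u + maxabs v.
Proof.
apply: maxabs_le => [|k]; first by rewrite addr_ge0// maxabs_ge0.
by apply: (le_trans (ler_normD _ _)); rewrite lerD// le_maxabs.
Qed.

Lemma bmeas_maxabs d (T : measurableType d) (K : finType) (F : K -> T -> R) :
  (forall k, bmeas (F k)) -> bmeas (fun x => maxabs (F ^~ x)).
Proof.
move=> bF; apply: (@bmeas_bigmax _ _ _ _ _ _ (fun=> 0)); first exact: bmeas_cst.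
by move=> k; exact: bmeas_norm.
Qed.

(** Expectation over [n] independent uniform signs, as iterated averaging, so that no probability
    space of signs is needed. Signs are read from a list with default 0 past its end, which is why
    comparisons are stated for entries of absolute value at most 1. *)
Fixpoint rad n (F : seq R -> R) : R :=
  if n is n'.+1 then
    (rad n' (fun e => F (1 :: e)) + rad n' (fun e => F (-1 :: e))) / 2
  else F [::].

Lemma le_rad n (F G : seq R -> R) :
  (forall e, (forall i, `|e`_i| <= 1) -> F e <= G e) -> rad n F <= rad n G.
Proof.
elim: n F G => [|n IH] F G FG /=.
  by apply: FG => i; rewrite nth_nil normr0.
have cons1 (s : R) e : `|s| <= 1 -> (forall i, `|e`_i| <= 1) ->
    forall i, `|(s :: e)`_i| <= 1.
  by move=> s1 He [|i] //=.
rewrite ler_pM2r ?invr_gt0//; apply: lerD; apply: IH => e He; apply: FG;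
  by apply: cons1 => //; rewrite ?normrN normr1.
Qed.

Lemma eq_rad n (F G : seq R -> R) : F =1 G -> rad n F = rad n G.
Proof.
by move=> FG; apply/eqP; rewrite eq_le; apply/andP; split; apply: le_rad => e _; rewrite FG.
Qed.

Lemma radD n (F G : seq R -> R) : rad n (fun e => F e + G e) = rad n F + rad n G.
Proof. by elim: n F G => [//|n IH] F G /=; rewrite !IH; ring. Qed.

Lemma radZ n c (F : seq R -> R) : rad n (fun e => c * F e) = c * rad n F.
Proof. by elim: n F => [//|n IH] F /=; rewrite !IH; ring. Qed.

Lemma rad_cst n c : rad n (fun=> c) = c.
Proof. by elim: n => [//|n IH] /=; rewrite IH; field. Qed.

Lemma rad_sum n (I : Type) (s : seq I) (P : pred I) (F : I -> seq R -> R) :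
  rad n (fun e => \sum_(i <- s | P i) F i e) = \sum_(i <- s | P i) rad n (F i).
Proof.
elim: s => [|i s IH].
  by rewrite big_nil -[RHS](rad_cst n); apply: eq_rad => e; rewrite big_nil.
rewrite big_cons -IH; case: (boolP (P i)) => Pi.
  by rewrite -radD; apply: eq_rad => e; rewrite big_cons Pi.
by apply: eq_rad => e; rewrite big_cons (negbTE Pi).
Qed.

(** Jensen: in the tangent inequality at the point [rad n F], the linear term averages to zero. *)
Lemma expR_rad n (F : seq R -> R) : expR (rad n F) <= rad n (fun e => expR (F e)).
Proof.
have h e : expR (rad n F) * (1 + (F e - rad n F)) <= expR (F e).
  exact: expR_tangent.
apply: (le_trans _ (@le_rad n _ _ (fun e _ => h e))).
rewrite radZ radD rad_cst (radD n F (fun=> - rad n F)) rad_cst.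
by rewrite subrr addr0 mulr1.
Qed.

Lemma rad_expR_linear n (v : 'I_n -> R) :
  rad n (fun e => expR (\sum_(i < n) e`_i * v i)) <= expR (2 * \sum_i v i ^+ 2).
Proof.
elim: n v => [|n IH] v; first by rewrite /= !big_ord0 mulr0.
have split s : rad n (fun e => expR (\sum_(i < n.+1) (s :: e)`_i * v i)) =
    expR (s * v ord0) * rad n (fun e => expR (\sum_(i < n) e`_i * v (lift ord0 i))).
  by rewrite -radZ; apply: eq_rad => e; rewrite big_ord_recl /= expRD.
rewrite [leLHS]/= (split 1) (split (-1)) mul1r mulN1r -mulrDl mulrAC.
rewrite big_ord_recl mulrDr expRD.
apply: ler_pM; last exact: IH.
- by rewrite divr_ge0// addr_ge0// expR_ge0.
- rewrite -(rad_cst n 0); apply: le_rad => e _; exact: expR_ge0.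
- exact: cosh_le_gauss.
Qed.

(** Massart's finite-class bound by exponential moments. Only the image of [phi] is counted, since a
    chaining link takes few values although it is indexed by the whole class. Each value contributes
    both signs; this factor 2 is at most e and becomes the [+ 1] next to [H]. *)
Lemma rad_finite_max n (K P : finType) (k0 : K) (phi : K -> P)
    (v : P -> 'I_n -> R) (S H l : R) : 0 < l ->
  (forall k, \sum_i v (phi k) i ^+ 2 <= S) ->
  #|[set phi k | k : K]|%:R <= expR H ->
  rad n (fun e => maxabs (fun k => \sum_(i < n) e`_i * v (phi k) i)) <=
    (H + 1) / l + 2 * l * S.
Proof.
move=> l0 vS cardP; set A := [set phi k | k : K].
set X := fun p (e : seq R) => \sum_(i < n) e`_i * v p i.
set Z := fun e => \sum_(p in A) (expR (l * X p e) + expR (- (l * X p e))).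
have XZ k e : expR (l * `|X (phi k) e|) <= Z e.
  rewrite /Z (bigD1 (phi k)) ?imset_f//=.
  have s0 : 0 <= \sum_(i in A | i != phi k) (expR (l * X i e) + expR (- (l * X i e))).
    by apply: sumr_ge0 => i _; rewrite addr_ge0// expR_ge0.
  have e1 := expR_ge0 (l * X (phi k) e); have e2 := expR_ge0 (- (l * X (phi k) e)).
  by case: (ger0P (X (phi k) e)) => _; rewrite ?mulrN; lra.
have Z0 e : 0 < Z e by apply: lt_le_trans (XZ k0 e); exact: expR_gt0.
have maxZ e : l * maxabs (fun k => X (phi k) e) <= ln (Z e).
  have lnZ k : l * `|X (phi k) e| <= ln (Z e).
    by rewrite -ler_expR lnK ?posrE.
  rewrite mulrC -ler_pdivlMr//; apply: maxabs_le => [|k].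
    apply: divr_ge0 (ltW l0); apply: le_trans (lnZ k0).
    by rewrite mulr_ge0// ltW.
  by rewrite ler_pdivlMr// mulrC.
have radZle : rad n Z <= expR (H + 1 + 2 * l ^+ 2 * S).
  rewrite rad_sum.
  apply: (@le_trans _ _ (\sum_(p in A) 2 * expR (2 * l ^+ 2 * S))).
    apply: ler_sum => p /imsetP[k _ ->]; rewrite radD.
    have gauss (s : R) : s ^+ 2 = 1 ->
        rad n (fun e => expR (s * (l * X (phi k) e))) <= expR (2 * l ^+ 2 * S).
      move=> s2; have := rad_expR_linear (fun i => s * l * v (phi k) i).
      have eX e : \sum_(i < n) e`_i * (s * l * v (phi k) i) = s * (l * X (phi k) e).
        by rewrite /X !mulr_sumr; apply: eq_bigr => i _; ring.
      under eq_rad do rewrite eX.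
      move/le_trans; apply; rewrite ler_expR.
      rewrite (eq_bigr (fun i => l ^+ 2 * v (phi k) i ^+ 2)); last first.
        by move=> i _; rewrite !exprMn s2 mul1r.
      by rewrite -mulr_sumr mulrA ler_wpM2l// mulr_ge0// sqr_ge0.
    have := gauss (-1) (sqrr_sign _ 1); under eq_rad do rewrite mulN1r.
    have := gauss 1 (expr1n _ _); under eq_rad do rewrite mul1r.
    lra.
  have e1 : (2 : R) <= expR 1 by apply: le_trans (expR_ge1Dx 1); lra.
  have -> : \sum_(p in A) 2 * expR (2 * l ^+ 2 * S) =
      #|A|%:R * 2 * expR (2 * l ^+ 2 * S).
    by rewrite sumr_const -mulr_natr; ring.
  rewrite expRD ler_wpM2r ?expR_ge0// expRD; exact: ler_pM.
have main : l * rad n (fun e => maxabs (fun k => X (phi k) e)) <=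
    H + 1 + 2 * l ^+ 2 * S.
  rewrite -ler_expR -radZ; apply: le_trans radZle.
  apply: le_trans (expR_rad _ _) _; apply: le_rad => e _.
  by rewrite -[leRHS]lnK ?posrE// ler_expR.
have -> : (H + 1) / l + 2 * l * S = (H + 1 + 2 * l ^+ 2 * S) / l.
  by field; rewrite gt_eqF.
by rewrite ler_pdivlMr// mulrC.
Qed.

Lemma rad_finite_max_sqrt n (K P : finType) (k0 : K) (phi : K -> P)
    (v : P -> 'I_n -> R) (s H : R) : 0 < s -> 0 <= H ->
  (forall k, \sum_i v (phi k) i ^+ 2 <= s ^+ 2) ->
  #|[set phi k | k : K]|%:R <= expR H ->
  rad n (fun e => maxabs (fun k => \sum_(i < n) e`_i * v (phi k) i)) <=
    3 * s * Num.sqrt (H + 1).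
Proof.
move=> s0 H0 vs cP; set q := Num.sqrt (H + 1).
have q0 : 0 < q by rewrite sqrtr_gt0; lra.
have qq : q ^+ 2 = H + 1 by rewrite sqr_sqrtr//; lra.
(* The choice l = q / s makes the two terms s q and 2 s q. *)
apply: le_trans (rad_finite_max k0 (divr_gt0 q0 s0) vs cP) _.
rewrite -qq le_eqVlt; apply/orP; left; apply/eqP.
by field; rewrite !gt_eqF.
Qed.

End rademacher.

(** * Hoeffding's lemma, McDiarmid's inequality and symmetrization *)

Section concentration.
Context (R : realType) d (T : measurableType d).
Implicit Types p : nat -> probability T R.

(** The centred function lies in [-c, c], where the exponential is below its chord; the linear part
    of the chord has mean zero and what remains is cosh (l c). *)
Lemma hoeffding_lemma (p : probability T R) (f : T -> R) (c l : R) :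
  bmeas f -> 0 < c -> 0 < l -> (forall x y, f x - f y <= c) ->
  \int[p]_x expR (l * (f x - \int[p]_y f y)) <= expR (2 * l ^+ 2 * c ^+ 2).
Proof.
move=> bf c0 l0 fc; set mu := \int[p]_y f y.
have up x : f x - mu <= c.
  rewrite lerBlDr -lerBlDl; apply: mean_ge_cst => // y.
  by rewrite lerBlDl -lerBlDr; exact: fc.
have lo x : - c <= f x - mu.
  rewrite lerBrDr -lerBrDl opprK addrC; apply: mean_le_cst => // y.
  by rewrite -lerBlDr; exact: fc.
have m0 : 0 < l * c by rewrite mulr_gt0.
(* A + B y is the chord of exp (l y) through the endpoints y = c and y = - c. *)
pose A := (expR (l * c) + expR (- (l * c))) / 2.
pose B := (expR (l * c) - expR (- (l * c))) / (2 * c).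
have conv x : expR (l * (f x - mu)) <= A + B * (f x - mu).
  pose t := (1 + (f x - mu) / c) / 2.
  have ht : 0 <= t <= 1.
    rewrite /t; have h1 : (f x - mu) / c <= 1 by rewrite ler_pdivrMr// mul1r.
    have h2 : - 1 <= (f x - mu) / c by rewrite ler_pdivlMr// mulN1r.
    by apply/andP; split; lra.
  have := expR_convex (l * c) (- (l * c)) ht.
  have -> : t * (l * c) + (1 - t) * - (l * c) = l * (f x - mu).
    by rewrite /t; field; rewrite gt_eqF.
  move/le_trans; apply; rewrite le_eqVlt; apply/orP; left; apply/eqP.
  by rewrite /t /A /B; field; rewrite gt_eqF.
have bfm : bmeas (fun x => f x - mu) by apply: bmeasB => //; exact: bmeas_cst.
apply: (@le_trans _ _ (\int[p]_x (A + B * (f x - mu)))).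
  apply: le_mean => //; first by apply: bmeas_expR; exact: bmeasZ.
  by apply: bmeasD; [exact: bmeas_cst | exact: bmeasZ].
have bcst := @bmeas_cst R d T.
rewrite meanD//; last exact: bmeasZ.
rewrite meanZ// meanB// !mean_cst.
rewrite subrr mulr0 addr0; apply: le_trans (cosh_le_gauss _) _.
by rewrite exprMn mulrA.
Qed.

(** The one-sided form loses nothing, as [t] and [t'] may be exchanged. Indexing [c] by [nat] makes
    removal of the first coordinate a shift. *)
Definition bounded_differences n (c : nat -> R) (F : n.-tuple T -> R) :=
  forall (i : 'I_n) t t', (forall j, j != i -> tnth t j = tnth t' j) ->
    F t - F t' <= c i.

(** The martingale argument without conditional expectations: [G] integrates out all coordinates but
    the first. The induction hypothesis controls F - G for a fixed first coordinate, and Hoeffding's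
    lemma controls G, whose oscillation is at most [c 0]. *)
Lemma mcdiarmid_mgf p n (F : n.-tuple T -> R) (c : nat -> R) (l : R) :
  bmeas F -> (forall i, 0 < c i) -> 0 < l -> bounded_differences c F ->
  \int[prodm p n]_t expR (l * (F t - \int[prodm p n]_u F u)) <=
    expR (2 * l ^+ 2 * \sum_(i < n) c i ^+ 2).
Proof.
elim: n p F c => [|n IH] p F c bF c0 l0 dF.
  by rewrite !mean_prodm0 subrr mulr0 big_ord0 mulr0.
set q := prodm (fun i => p i.+1) n.
have bcons := bmeas_tcons bF.
pose G x := \int[q]_u F (tcons (x, u)).
have bG : bmeas G by exact: (bmeas_mean1 (p 0%N) q bcons).
have EF : \int[prodm p n.+1]_u F u = \int[p 0%N]_x G x by rewrite mean_prodmS.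
rewrite EF; set m := \int[p 0%N]_x G x.
have bE : bmeas (fun t => expR (l * (F t - m))).
  by apply/bmeas_expR/bmeasZ/bmeasB => //; exact: bmeas_cst.
rewrite mean_prodmS// big_ord_recl mulrDr expRD.
have inner x : \int[q]_t expR (l * (F (tcons (x, t)) - m)) <=
    expR (l * (G x - m)) * expR (2 * l ^+ 2 * \sum_(i < n) c i.+1 ^+ 2).
  have bFx := bmeas_slice1 bcons x.
  have -> : \int[q]_t expR (l * (F (tcons (x, t)) - m)) =
      \int[q]_t (expR (l * (G x - m)) * expR (l * (F (tcons (x, t)) - G x))).
    by apply: eq_mean => t; rewrite -expRD; congr expR; ring.
  rewrite meanZ; last by apply/bmeas_expR/bmeasZ/bmeasB => //; exact: bmeas_cst.
  rewrite ler_wpM2l ?expR_ge0//.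
  apply: (IH (fun i => p i.+1) (fun t => F (tcons (x, t))) (fun i => c i.+1)) => //.
  move=> i t t' tt'; apply: (dF (lift ord0 i)) => j.
  case: (unliftP ord0 j) => [k|] -> // ki; rewrite !tnthS; apply: tt'.
  by apply: contraNneq ki => ->.
have bEm : bmeas (fun x => expR (l * (G x - m))).
  by apply/bmeas_expR/bmeasZ/bmeasB => //; exact: bmeas_cst.
apply: (@le_trans _ _ (\int[p 0%N]_x (expR (2 * l ^+ 2 * \sum_(i < n) c i.+1 ^+ 2)
    * expR (l * (G x - m))))).
  apply: le_mean; first exact: (bmeas_mean1 (p 0%N) q (bmeas_tcons bE)).
    exact: bmeasZ.
  by move=> x; rewrite mulrC; exact: inner.
rewrite meanZ// mulrC ler_wpM2r ?expR_ge0//.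
apply: hoeffding_lemma => // x y.
rewrite /G -(meanB _ (bmeas_slice1 bcons x) (bmeas_slice1 bcons y)).
apply: mean_le_cst => [|t].
  by apply: bmeasB; exact: (bmeas_slice1 bcons).
apply: (dF ord0) => j; case: (unliftP ord0 j) => [k|] -> //.
by rewrite !tnthS.
Qed.

Lemma mcdiarmid p n (F : n.-tuple T -> R) (c : nat -> R) (s S : R) :
  bmeas F -> (forall i, 0 < c i) -> bounded_differences c F ->
  \sum_(i < n) c i ^+ 2 <= S -> 0 < S -> 0 <= s ->
  (prodm p n [set t | (\int[prodm p n]_u F u + s <= F t)%R] <=
    (expR (- (s ^+ 2 / (8 * S))))%:E)%E.
Proof.
move=> bF c0 dF cS S0; rewrite le_eqVlt => /predU1P[<-|s0].
  rewrite expr0n/= mul0r oppr0 expR0; apply: probability_le1.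
  rewrite (_ : [set _ | _] = F @^-1` `[\int[prodm p n]_u F u + 0, +oo[); last first.
    by apply/seteqP; split => x /=; rewrite in_itv/= andbT.
  by rewrite -[X in measurable X]setTI; apply: bF.1.
(* This l minimises 2 l^2 S - l s, with minimum - s^2 / (8 S). *)
set m := \int[prodm p n]_u F u; pose l := s / (4 * S).
have l0 : 0 < l by rewrite divr_gt0// mulr_gt0.
have bE : bmeas (fun t => expR (l * (F t - m))).
  by apply/bmeas_expR/bmeasZ/bmeasB => //; exact: bmeas_cst.
have -> : [set t | m + s <= F t] = [set t | expR (l * s) <= expR (l * (F t - m))].
  by apply/seteqP; split => t /=; rewrite ler_expR ler_pM2l// lerBrDl.
apply: le_trans (markov_mean _ bE _ (expR_gt0 _)) _.
  by move=> t; exact: expR_ge0.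
rewrite lee_fin ler_pdivrMr ?expR_gt0// -expRD.
apply: le_trans (mcdiarmid_mgf p bF c0 l0 dF) _; rewrite ler_expR.
apply: (@le_trans _ _ (2 * l ^+ 2 * S)).
  by rewrite ler_wpM2l// mulr_ge0// sqr_ge0.
rewrite /l le_eqVlt; apply/orP; left; apply/eqP.
by field; rewrite gt_eqF.
Qed.

Lemma bmeas_rad d' (T' : measurableType d') n (F : seq R -> T' -> R) :
  (forall e, bmeas (F e)) -> bmeas (fun x => rad n (F ^~ x)).
Proof.
elim: n F => [|n IH] F bF /=; first exact: bF.
under [X in bmeas X]funext do rewrite mulrC.
by apply/bmeasZ/bmeasD; apply: (IH (fun e => F (_ :: e))).
Qed.

(** Decouples a coordinate from its independent copy: b + u - v is the midpoint of b + 2 u and b - 2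
    v, each of which involves only one of the two. The factor 2 of the symmetrized sum comes from
    here. *)
Lemma maxabs_midpoint (K : finType) (b u v : K -> R) :
  maxabs (fun k => b k + u k - v k) <=
    (maxabs (fun k => b k + 2 * u k) + maxabs (fun k => b k - 2 * v k)) / 2.
Proof.
apply: maxabs_le => [|k]; first by rewrite divr_ge0// addr_ge0// maxabs_ge0.
have h1 := le_maxabs (fun k => b k + 2 * u k) k.
have h2 := le_maxabs (fun k => b k - 2 * v k) k.
have -> : b k + u k - v k = ((b k + 2 * u k) + (b k - 2 * v k)) / 2 by field.
rewrite normrM [X in _ * X]ger0_norm ?invr_ge0//.
by rewrite ler_pM2r ?invr_gt0//; apply: le_trans (ler_normD _ _) _; exact: lerD.
Qed.

Lemma maxabs_mean (K : finType) (p : probability T R) (b : K -> R)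
    (f : K -> T -> R) : (forall k, bmeas (f k)) ->
  maxabs (fun k => b k - \int[p]_x f k x) <= \int[p]_x maxabs (fun k => b k - f k x).
Proof.
move=> bf; have bbf k : bmeas (fun x => b k - f k x).
  by apply: bmeasB => //; exact: bmeas_cst.
have bm : bmeas (fun x => maxabs (fun k => b k - f k x)) by exact: bmeas_maxabs.
apply: maxabs_le => [|k].
  by apply: mean_ge_cst => // x; exact: maxabs_ge0.
rewrite -{1}(mean_cst p (b k)) -meanB//; last exact: bmeas_cst.
apply: le_trans (le_norm_mean _ (bbf k)) _; apply: le_mean => //.
  exact: bmeas_norm.
by move=> x; exact: (le_maxabs (fun k => b k - f k x)).
Qed.

(** Signs are introduced one coordinate at a time, and the offset [a] carries the coordinates
    already treated; this generality is what the induction needs. For a single coordinate, Jensen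
    replaces the mean by an independent copy and [maxabs_midpoint] turns the difference into an
    average over a sign, so no exchangeability of pairs is invoked. *)
Lemma symmetrization (K : finType) p n (phi : K -> nat -> T -> R) (a : K -> R) :
  (forall k i, bmeas (phi k i)) ->
  \int[prodm p n]_t maxabs (fun k => a k +
      \sum_(i < n) (phi k i (tnth t i) - \int[p i]_x phi k i x)) <=
  \int[prodm p n]_t rad n (fun e => maxabs (fun k => a k +
      \sum_(i < n) e`_i * (2 * phi k i (tnth t i)))).
Proof.
elim: n p phi a => [|n IH] p phi a bphi.
  rewrite !mean_prodm0 /= le_eqVlt; apply/orP; left; apply/eqP.
  by congr maxabs; apply: funext => k; rewrite !big_ord0.
set q := prodm (fun i => p i.+1) n.
pose Sg k (t : n.-tuple T) :=
  \sum_(i < n) (phi k i.+1 (tnth t i) - \int[p i.+1]_x phi k i.+1 x).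
pose G (b : K -> R) := \int[q]_t maxabs (fun k => b k + Sg k t).
have bphit m (i : 'I_m) k j : bmeas (fun t : m.-tuple T => phi k j (tnth t i)).
  by apply: bmeas_comp (bphi k j); exact: measurable_tnth.
have bSg k : bmeas (Sg k).
  by apply: bmeas_sum => i _; apply: bmeasB => //; exact: bmeas_cst.
have bGi b : bmeas (fun t => maxabs (fun k => b k + Sg k t)).
  apply: (bmeas_maxabs (F := fun k t => b k + Sg k t)) => k.
  by apply: bmeasD => //; exact: bmeas_cst.
have bpair (b : T -> K -> R) : (forall k, bmeas (b ^~ k)) ->
    bmeas (fun xt : T * n.-tuple T => maxabs (fun k => b xt.1 k + Sg k xt.2)).
  move=> bb; apply: (bmeas_maxabs
    (F := fun k (xt : T * n.-tuple T) => b xt.1 k + Sg k xt.2)) => k.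
  apply: bmeasD; first exact: (bmeas_comp measurable_fst (bb k)).
  exact: (bmeas_comp measurable_snd (bSg k)).
have bG (b : T -> K -> R) : (forall k, bmeas (b ^~ k)) -> bmeas (fun x => G (b x)).
  by move=> bb; exact: (bmeas_mean1 (p 0%N) q (bpair b bb)).
(* The offset after the head coordinate has received its sign: s is 2 or -2, the sign times the
   factor of the midpoint identity. *)
pose bp s x k := a k + s * phi k 0%N x.
have bbp s k : bmeas (bp s ^~ k) by apply: bmeasD; [exact: bmeas_cst|exact: bmeasZ].
have bshift (c : K -> R) k : bmeas (fun x => c k - phi k 0%N x).
  by apply: bmeasB => //; exact: bmeas_cst.
have step x : G (fun k => a k + phi k 0%N x - \int[p 0%N]_y phi k 0%N y) <=
    (G (bp 2 x) + \int[p 0%N]_y G (bp (-2) y)) / 2.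
  apply: (@le_trans _ _
      (\int[p 0%N]_y G (fun k => a k + phi k 0%N x - phi k 0%N y))).
    rewrite /G (mean_swap (p 0%N) q (bpair _ (bshift _))).
    apply: le_mean => //; first exact: (bmeas_mean2 (p 0%N) q (bpair _ (bshift _))).
    move=> t; have := maxabs_mean (p 0%N)
      (fun k => a k + phi k 0%N x + Sg k t) (fun k => bphi k 0%N).
    congr (_ <= _); first by congr maxabs; apply: funext => k; ring.
    by apply: eq_mean => y; congr maxabs; apply: funext => k /=; ring.
  apply: (@le_trans _ _ (\int[p 0%N]_y (2^-1 * (G (bp 2 x) + G (bp (-2) y))))).
    apply: le_mean; first exact: (bG _ (bshift _)).
      by apply/bmeasZ/bmeasD; [exact: bmeas_cst | exact: bG].
    move=> y; rewrite /G -meanD// -meanZ; last exact: bmeasD.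
    apply: le_mean => //; first by apply/bmeasZ/bmeasD.
    move=> t; rewrite [leRHS]mulrC.
    have := maxabs_midpoint (fun k => a k + Sg k t)
      (fun k => phi k 0%N x) (fun k => phi k 0%N y).
    congr (_ <= (_ + _) / 2).
    - by congr maxabs; apply: funext => k; ring.
    - by congr maxabs; apply: funext => k; rewrite /bp; ring.
    - by congr maxabs; apply: funext => k; rewrite /bp; ring.
  rewrite meanZ; last by apply: bmeasD; [exact: bmeas_cst | exact: bG].
  by rewrite meanD ?mean_cst 1?mulrC//; [exact: bmeas_cst | exact: bG].
pose Hr s x := \int[q]_t rad n (fun e => maxabs (fun k => bp s x k +
      \sum_(i < n) e`_i * (2 * phi k i.+1 (tnth t i)))).
have ind s x : G (bp s x) <= Hr s x.
  exact: (IH (fun i => p i.+1) (fun k i => phi k i.+1) (bp s x)).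
have bHi s : bmeas (fun xt : T * n.-tuple T => rad n (fun e =>
    maxabs (fun k => bp s xt.1 k + \sum_(i < n) e`_i * (2 * phi k i.+1 (tnth xt.2 i))))).
  apply: (@bmeas_rad _ _ n (fun e (xt : T * n.-tuple T) => maxabs (fun k =>
    bp s xt.1 k + \sum_(i < n) e`_i * (2 * phi k i.+1 (tnth xt.2 i))))) => e.
  apply: (bmeas_maxabs (F := fun k (xt : T * n.-tuple T) =>
    bp s xt.1 k + \sum_(i < n) e`_i * (2 * phi k i.+1 (tnth xt.2 i)))) => k.
  apply: bmeasD; first exact: (bmeas_comp measurable_fst (bbp s k)).
  apply: bmeas_sum => i _; apply/bmeasZ/bmeasZ.
  exact: (bmeas_comp measurable_snd (bphit n i k i.+1)).
have bH s : bmeas (Hr s) by exact: (bmeas_mean1 (p 0%N) q (bHi s)).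
have bL : bmeas (fun t : n.+1.-tuple T => maxabs (fun k => a k +
    \sum_(i < n.+1) (phi k i (tnth t i) - \int[p i]_x phi k i x))).
  apply: (bmeas_maxabs (F := fun k t => a k +
    \sum_(i < n.+1) (phi k i (tnth t i) - \int[p i]_x phi k i x))) => k.
  apply: bmeasD; first exact: bmeas_cst.
  by apply: bmeas_sum => i _; apply: bmeasB => //; exact: bmeas_cst.
have bR : bmeas (fun t : n.+1.-tuple T => rad n.+1 (fun e => maxabs (fun k => a k +
      \sum_(i < n.+1) e`_i * (2 * phi k i (tnth t i))))).
  apply: (@bmeas_rad _ _ n.+1 (fun e (t : n.+1.-tuple T) => maxabs (fun k => a k +
      \sum_(i < n.+1) e`_i * (2 * phi k i (tnth t i))))) => e.
  apply: (bmeas_maxabs (F := fun k (t : n.+1.-tuple T) => a k +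
      \sum_(i < n.+1) e`_i * (2 * phi k i (tnth t i)))) => k.
  apply: bmeasD; first exact: bmeas_cst.
  by apply: bmeas_sum => i _; apply/bmeasZ/bmeasZ.
rewrite (mean_prodmS _ bL) (mean_prodmS _ bR) -/q.
apply: (@le_trans _ _ (\int[p 0%N]_x
    (2^-1 * (G (bp 2 x) + \int[p 0%N]_y G (bp (-2) y))))).
  apply: le_mean; first exact: (bmeas_mean1 (p 0%N) q (bmeas_tcons bL)).
    by apply/bmeasZ/bmeasD; [exact: bG | exact: bmeas_cst].
  move=> x; rewrite mulrC; apply: le_trans (step x).
  rewrite le_eqVlt; apply/orP; left; apply/eqP; apply: eq_mean => t.
  congr maxabs; apply: funext => k; rewrite big_ord_recl /Sg !addrA.
  by congr (_ + _); apply: eq_bigr => i _; rewrite tnthS.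
have eR x : \int[q]_t rad n.+1 (fun e => maxabs (fun k => a k +
      \sum_(i < n.+1) e`_i * (2 * phi k i (tnth (tcons (x, t)) i)))) =
    2^-1 * (Hr 2 x + Hr (-2) x).
  rewrite /Hr -meanD; [|exact: (bmeas_slice1 (bHi _))|exact: (bmeas_slice1 (bHi _))].
  rewrite -meanZ; last by apply: bmeasD; exact: (bmeas_slice1 (bHi _)).
  apply: eq_mean => t /=; rewrite [RHS]mulrC; congr ((_ + _) / 2); apply: eq_rad => e;
    congr maxabs; apply: funext => k; rewrite big_ord_recl /bp /= addrA;
    (congr (_ + _); [ring | apply: eq_bigr => i _; by rewrite tnthS]).
under [leRHS]eq_mean do rewrite eR.
rewrite !meanZ; [|exact: bmeasD|by apply: bmeasD; [exact: bG|exact: bmeas_cst]].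
rewrite ler_pM2l ?invr_gt0// !meanD ?mean_cst//; [|exact: bG|exact: bmeas_cst].
by apply: lerD; apply: le_mean => //; exact: bG.
Qed.

End concentration.

(** * Chaining and the entropy series *)

Section chaining.
Context (R : realType).

Lemma sqr_sumD n (u v : 'I_n -> R) :
  \sum_i (u i + v i) ^+ 2 <= 2 * \sum_i u i ^+ 2 + 2 * \sum_i v i ^+ 2.
Proof.
rewrite !mulr_sumr -big_split/=; apply: ler_sum => i _.
have := sqr_ge0 (u i - v i); rewrite sqrrB sqrrD; lra.
Qed.

(** A trivial bound for the residual after the last link of the chain; its factor [n] is beaten by a
    radius of order 2^-n. *)
Lemma rad_maxabs_le n (K : finType) (u : K -> 'I_n -> R) (c : R) : 0 <= c ->
  (forall k, \sum_i u k i ^+ 2 <= c ^+ 2) ->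
  rad n (fun e => maxabs (fun k => \sum_(i < n) e`_i * u k i)) <= n%:R * c.
Proof.
move=> c0 uc; rewrite -[leRHS](rad_cst n); apply: le_rad => e He.
apply: maxabs_le => [|k]; first by rewrite mulr_ge0.
apply: le_trans (ler_norm_sum _ _ _) _.
have -> : n%:R * c = \sum_(i < n) c by rewrite sumr_const card_ord mulr_natl.
apply: ler_sum => i _; rewrite normrM.
apply: (@le_trans _ _ `|u k i|); first by rewrite ler_piMl.
rewrite -(@ler_pXn2r _ 2) ?nnegrE// real_normK ?num_real//.
apply: le_trans (uc k); rewrite (bigD1 i)//= lerDl.
by apply: sumr_ge0 => j _; exact: sqr_ge0.
Qed.

(** The chain has as many levels as there are coordinates, so that no infinite series or limit
    occurs. A link is determined by a pair of consecutive centres, whence the sum of two consecutive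
    entropies under the root. *)
Lemma chaining n (K : finType) (k0 : K) (t : K -> 'I_n -> R)
    (pi : nat -> K -> K) (D : R) (h : nat -> R) :
  0 < D -> (forall k, \sum_i t k i ^+ 2 <= D ^+ 2) ->
  (forall j, 0 <= h j) ->
  (forall j k, \sum_i (t k i - t (pi j k) i) ^+ 2 <= (D * 2^-1 ^+ j) ^+ 2) ->
  (forall j, #|[set pi j k | k : K]|%:R <= expR (h j)) ->
  rad n (fun e => maxabs (fun k => \sum_(i < n) e`_i * t k i)) <=
    D + \sum_(j < n) 12 * D * 2^-1 ^+ j.+1 * Num.sqrt (h j + h j.+1 + 1).
Proof.
move=> D0 tD h0 tpi cpi.
pose u j k i : R := if j is 0 then 0 else t (pi j k) i.
(* [w] is [u] before projection; it lets an increment factor through the pair of centres, so that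
   the number of increments is bounded by the numbers of centres. Level 0 is the zero vector, so the
   chain starts for free. *)
pose w j k i : R := if j is 0 then 0 else t k i.
have uw j k i : u j k i = w j (pi j k) i by case: j.
have tu j k : \sum_i (t k i - u j k i) ^+ 2 <= (D * 2^-1 ^+ j) ^+ 2.
  case: j => [|j]; last exact: tpi.
  rewrite expr0 mulr1; under eq_bigr do rewrite subr0; exact: tD.
have main J : rad n (fun e => maxabs (fun k => \sum_(i < n) e`_i * t k i)) <=
    rad n (fun e => maxabs (fun k => \sum_(i < n) e`_i * (t k i - u J k i))) +
    \sum_(j < J) 12 * D * 2^-1 ^+ j.+1 * Num.sqrt (h j + h j.+1 + 1).
  elim: J => [|J IH].
    rewrite big_ord0 addr0; apply: le_rad => e _; rewrite le_eqVlt; apply/orP.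
    left; apply/eqP; congr maxabs; apply: funext => k.
    by apply: eq_bigr => i _; rewrite subr0.
  apply: le_trans IH _; rewrite big_ord_recr /= [X in _ <= _ + X]addrC addrA lerD2r.
  pose phi k := (pi J.+1 k, pi J k).
  pose v (q : K * K) i : R := t q.1 i - w J q.2 i.
  have vE k i : v (phi k) i = u J.+1 k i - u J k i by rewrite /v uw.
  have s0 : 0 < 4 * D * 2^-1 ^+ J.+1 by rewrite !mulr_gt0// exprn_gt0// invr_gt0.
  apply: (@le_trans _ _ (rad n (fun e =>
      maxabs (fun k => \sum_(i < n) e`_i * (t k i - u J.+1 k i)) +
      maxabs (fun k => \sum_(i < n) e`_i * v (phi k) i)))).
    apply: le_rad => e _; apply: le_trans (maxabsD _ _).
    rewrite le_eqVlt; apply/orP; left; apply/eqP; congr maxabs; apply: funext => k.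
    rewrite -big_split/=; apply: eq_bigr => i _.
    by rewrite -mulrDr vE addrA subrK.
  rewrite radD lerD2l.
  (* The increment has squared norm at most (2 + 1/2) (D 2^-J)^2, hence norm below 4 D 2^-(J+1); the
     3 is the constant of the finite maximum. *)
  have -> : 12 * D * 2^-1 ^+ J.+1 = 3 * (4 * D * 2^-1 ^+ J.+1) by ring.
  apply: (rad_finite_max_sqrt k0) => //; first by rewrite addr_ge0.
  - move=> k.
    have -> : \sum_i v (phi k) i ^+ 2 =
        \sum_i ((t k i - u J k i) + (- (t k i - u J.+1 k i))) ^+ 2.
      by apply: eq_bigr => i _; rewrite vE; ring.
    apply: le_trans (sqr_sumD _ _) _.
    under [X in _ + _ * X]eq_bigr do rewrite sqrrN.
    have := tu J k; have := tu J.+1 k; rewrite (exprS 2^-1 J) !exprMn.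
    set E := (2^-1 ^+ J) ^+ 2; set X := \sum_i _; set Y := \sum_i _.
    have : 0 <= D ^+ 2 * E by rewrite mulr_ge0// sqr_ge0.
    have -> : 4 ^+ 2 * D ^+ 2 * (2^-1 ^+ 2 * E) = 4 * (D ^+ 2 * E) :> R by field.
    have -> : D ^+ 2 * (2^-1 ^+ 2 * E) = (D ^+ 2 * E) / 4 by field.
    lra.
  - apply: (@le_trans _ _ (#|[set pi J.+1 k | k : K]|%:R * #|[set pi J k | k : K]|%:R)).
      rewrite -natrM ler_nat -cardsX; apply: subset_leq_card.
      by apply/fintype.subsetP => _ /imsetP[k _ ->]; rewrite inE /= !imset_f.
    by rewrite addrC expRD; apply: ler_pM.
(* The residual n D 2^-n is at most D because n < 2^n. *)
apply: le_trans (main n) _; rewrite lerD2r.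
have c0 : 0 <= D * 2^-1 ^+ n by rewrite mulr_ge0 ?exprn_ge0 ?ltW.
apply: le_trans (rad_maxabs_le c0 _) _; first by move=> k; exact: tu.
rewrite mulrCA -[leRHS]mulr1 ler_wpM2l ?(ltW D0)// exprVn.
by rewrite ler_pdivrMr ?exprn_gt0// mul1r -natrX ler_nat ltnW// ltn_expl.
Qed.

(** Convexity of 2^(-y) between 0 and 1. It keeps the ratio 2^(a-1) of the entropy series away from
    1 by (1 - a) / 2, which is the origin of the factor 1 / (1 - a). *)
Lemma powR2N_le (y : R) : 0 <= y <= 1 -> 2 `^ (- y) <= 1 - y / 2.
Proof.
move=> y01; have := expR_convex (- ln 2) 0 y01.
rewrite expR0 mulr0 addr0 expRN lnK ?posrE//.
rewrite /powR ifF; last by apply/negbTE; rewrite pnatr_eq0.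
rewrite mulNr -mulrN; lra.
Qed.

Lemma geometric_sum_le n (r : R) : 0 <= r < 1 ->
  \sum_(j < n) r ^+ j.+1 <= (1 - r)^-1.
Proof.
move=> /andP[r0 r1]; have r1' : 0 < 1 - r by lra.
rewrite -[leRHS]mul1r ler_pdivlMr//.
have : \sum_(j < n) r ^+ j.+1 = r * \sum_(j < n) r ^+ j.
  by rewrite mulr_sumr; apply: eq_bigr => j _; rewrite exprS.
move=> ->; rewrite -mulrA [X in r * X]mulrC.
have -> : (1 - r) * (\sum_(j < n) r ^+ j) = 1 - r ^+ n.
  elim: n => [|n IH]; first by rewrite big_ord0 mulr0 expr0 subrr.
  rewrite big_ord_recr/= mulrDr IH exprS; ring.
have : 0 <= r ^+ n by rewrite exprn_ge0.
nra.
Qed.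

(* The centres of a cover are replaced by elements of the class, which doubles
   the radii. *)
Definition entropy_bound (T : Type) (K : finType) (g : K -> T -> R) (chat b a : R) :=
  forall m (w : 'I_m -> R) (xs : 'I_m -> T),
  (forall i, 0 <= w i) -> \sum_i w i = 1 -> forall eps, 0 < eps ->
  exists pi : K -> K,
    (forall k, L2fin w xs (g k \- g (pi k)) <= 2 * eps) /\
    #|[set pi k | k : K]|%:R <= expR (chat * (b / eps) `^ (2 * a) + 1).

(** The weights q^2, normalised, form a probability on the sample points, and the Lipschitz
    hypothesis bounds Euclidean distances of the [t k] by the root of the sum of q^2 times L2
    distances of the [g k]; covers of the class thus give the chain. By the last hypothesis, b over
    the radius at level j is at most 2 L 2^j, so the root of the entropy grows like (L 2^j)^a while
    the links shrink like 2^-j, and a < 1 makes the series converge. *)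
Lemma dudley (T : Type) (K : finType) (k0 : K) (g : K -> T -> R) (chat b a : R)
    n (xs : 'I_n -> T) (t : K -> 'I_n -> R) (q : 'I_n -> R) (D L : R) :
  entropy_bound g chat b a -> 0 <= chat -> 0 <= b -> 0 < a < 1 ->
  0 < D -> 0 <= L -> (forall i, 0 < q i) ->
  (forall k l i, `|t k i - t l i| <= q i * `|g k (xs i) - g l (xs i)|) ->
  (forall k, \sum_i t k i ^+ 2 <= D ^+ 2) ->
  (\sum_i q i ^+ 2) * b ^+ 2 <= D ^+ 2 * L ^+ 2 ->
  rad n (fun e => maxabs (fun k => \sum_(i < n) e`_i * t k i)) <=
    100 * D * (1 + Num.sqrt chat * L `^ a / (1 - a)).
Proof.
move=> ent chat0 b0 /andP[a0 a1] D0 L0 q0 tq tD QL.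
have a1' : 0 < 1 - a by lra.
have a1'' := ltW a1'; have a0' := ltW a0; have D0' := ltW D0.
have rhs0 : 0 <= Num.sqrt chat * L `^ a / (1 - a).
  by rewrite divr_ge0// mulr_ge0 ?sqrtr_ge0 ?powR_ge0.
(* An empty sample would leave nothing to normalise the weights by. *)
case: n => [|n] in xs t q q0 tq tD QL *.
  apply: (@le_trans _ _ 0); last by rewrite !mulr_ge0//; lra.
  by rewrite /=; apply: maxabs_le => // k; rewrite big_ord0 normr0.
have q0' i := ltW (q0 i).
set Q := \sum_i q i ^+ 2 in QL.
have Q0 : 0 < Q.
  rewrite /Q big_ord_recl; apply: ltr_pwDl; first by rewrite exprn_gt0.
  by apply: sumr_ge0 => i _; exact: sqr_ge0.
pose s := Num.sqrt Q.
have s0 : 0 < s by rewrite sqrtr_gt0.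
have s0' := ltW s0; have Q0' := ltW Q0.
have sE : s ^+ 2 = Q by rewrite sqr_sqrtr// ltW.
pose w i := q i ^+ 2 / Q.
have w0 i : 0 <= w i by rewrite divr_ge0 ?sqr_ge0.
have w1 : \sum_i w i = 1 by rewrite -mulr_suml mulfV// gt_eqF.
pose r (j : nat) : R := 2^-1 ^+ j.
have r0 j : 0 < r j by rewrite exprn_gt0 ?invr_gt0.
have r0' j := ltW (r0 j).
(* Division by [s] converts a Euclidean radius for t into an L2 radius for g; the final half offsets
   the doubled radius in [entropy_bound]. *)
pose eps j := D * r j / s / 2.
have eps0 j : 0 < eps j by rewrite !divr_gt0// mulr_gt0.
have eps0' j := ltW (eps0 j).
have /choice[pi piP] j := ent _ w xs w0 w1 _ (eps0 j).
pose h j := chat * (2 * L * 2 ^+ j) `^ (2 * a) + 1.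
have bs : b * s <= D * L.
  rewrite -(@ler_pXn2r _ 2) ?nnegrE ?mulr_ge0//.
  by rewrite !exprMn sE mulrC.
have beps j : b / eps j <= 2 * L * 2 ^+ j.
  rewrite ler_pdivrMr// /eps.
  have -> : 2 * L * 2 ^+ j * (D * r j / s / 2) = D * L / s * (2 ^+ j * r j) by field; rewrite gt_eqF.
  by rewrite /r -exprMn mulfV// expr1n mulr1 ler_pdivlMr.
apply: (@le_trans _ _ (D + \sum_(j < n.+1) 12 * D * r j.+1 *
    Num.sqrt (h j + h j.+1 + 1))).
  apply: (chaining k0 (pi := pi)) => //.
  - by move=> j; rewrite addr_ge0// mulr_ge0 ?powR_ge0.
  - move=> j k; have [+ _] := piP j => /(_ k).
    have -> : 2 * eps j = D * r j / s by rewrite /eps; field; rewrite gt_eqF.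
    rewrite /L2fin; set W := \sum_i _ => WD.
    have W0 : 0 <= W by apply: sumr_ge0 => i _; rewrite mulr_ge0 ?sqr_ge0.
    have W2 : W <= (D * r j) ^+ 2 / Q.
      rewrite -[W]sqr_sqrtr// -sE -expr_div_n.
      by rewrite ler_pXn2r ?nnegrE ?sqrtr_ge0// divr_ge0 ?mulr_ge0.
    apply: (@le_trans _ _ (Q * W)); last first.
      by rewrite mulrC -ler_pdivlMr.
    rewrite /W mulr_sumr; apply: ler_sum => i _.
    have -> : Q * (w i * (g k \- g (pi j k)) (xs i) ^+ 2) =
        (q i * `|g k (xs i) - g (pi j k) (xs i)|) ^+ 2.
      by rewrite exprMn real_normK ?num_real// /w /=; field; rewrite gt_eqF.
    rewrite -[leLHS]real_normK ?num_real// ler_pXn2r ?nnegrE ?mulr_ge0//.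
  - move=> j; have [_ /le_trans] := piP j; apply.
    rewrite ler_expR lerD2r ler_wpM2l// ge0_ler_powR ?nnegrE//.
    + by rewrite mulr_ge0.
    + by rewrite divr_ge0.
    + by rewrite !mulr_ge0// exprn_ge0.
pose p := 2 `^ a : R.
have p0 : 0 < p by rewrite powR_gt0.
have p0' := ltW p0.
have pj j : (2 ^+ j) `^ a = p ^+ j.
  by rewrite -powR_mulrn// -powRrM mulrC powRrM powR_mulrn.
have p2 : p <= 2 by rewrite -[leRHS]powRr1// ler_powR//; lra.
pose A := Num.sqrt chat * L `^ a.
have A0 : 0 <= A by rewrite mulr_ge0 ?sqrtr_ge0 ?powR_ge0.
(* Splitting the root into its constant and its power part leaves two geometric series, of ratios
   1/2 and 2^(a-1). *)
have term j : 12 * D * r j.+1 * Num.sqrt (h j + h j.+1 + 1) <=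
    24 * D * 2^-1 ^+ j.+1 + 48 * D * A * (2^-1 * p) ^+ j.+1.
  have sq : Num.sqrt (h j + h j.+1 + 1) <= 2 + 4 * A * p ^+ j.+1.
    have R0 : 0 <= 2 + 4 * A * p ^+ j.+1.
      by rewrite addr_ge0// mulr_ge0 ?exprn_ge0// mulr_ge0.
    rewrite -[leRHS]ger0_norm// -sqrtr_sqr ler_wsqrtr//.
    have hj : h j <= h j.+1.
      rewrite lerD2r ler_wpM2l// ge0_ler_powR ?nnegrE ?mulr_ge0 ?exprn_ge0//.
      by rewrite ler_wpM2l ?mulr_ge0// ler_weXn2l// ler1n.
    have hE : h j.+1 <= 4 * A ^+ 2 * p ^+ j.+1 ^+ 2 + 1.
      rewrite lerD2r mulrC [2 * a]mulrC powRrM [X in X <= _]mulrC.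
      rewrite (@powR_mulrn _ _ 2) ?powR_ge0//.
      rewrite !powRM ?mulr_ge0 ?exprn_ge0// pj -/p /A !exprMn sqr_sqrtr//.
      set X := (L `^ a) ^+ 2; set Y := (p ^+ j.+1) ^+ 2.
      have -> : chat * (p ^+ 2 * X * Y) = p ^+ 2 * (chat * X * Y) by ring.
      rewrite -[4 * _ * _]mulrA ler_wpM2r ?mulr_ge0 ?sqr_ge0 ?powR_ge0 ?exprn_ge0//.
      have : p * p <= 2 * 2 by apply: ler_pM => //; exact: ltW.
      by rewrite expr2; lra.
    set P := p ^+ j.+1 in hE *.
    have : 0 <= A * P by rewrite mulr_ge0// exprn_ge0.
    have -> : (2 + 4 * A * P) ^+ 2 = 4 + 16 * (A * P) + 16 * (A ^+ 2 * P ^+ 2) by ring.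
    have : 0 <= A ^+ 2 * P ^+ 2 by rewrite mulr_ge0 ?sqr_ge0.
    by rewrite -mulrA in hE; lra.
  have := ler_wpM2l _ sq; move=> /(_ (12 * D * r j.+1)).
  have -> : 12 * D * r j.+1 * (2 + 4 * A * p ^+ j.+1) =
      24 * D * 2^-1 ^+ j.+1 + 48 * D * A * (2^-1 * p) ^+ j.+1.
    by rewrite exprMn /r; ring.
  by apply; rewrite !mulr_ge0.
apply: (@le_trans _ _ (D + (24 * D * 2 + 48 * D * A * (2 / (1 - a))))).
  rewrite lerD2l; apply: (@le_trans _ _ (\sum_(j < n.+1)
      (24 * D * 2^-1 ^+ j.+1 + 48 * D * A * (2^-1 * p) ^+ j.+1))).
    by apply: ler_sum => j _; exact: term.
  rewrite big_split/= -!mulr_sumr; apply: lerD.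
    rewrite ler_wpM2l ?mulr_ge0//.
    apply: le_trans (geometric_sum_le _ _) _; first lra.
    by rewrite le_eqVlt; apply/orP; left; apply/eqP; field.
  have pa : 2^-1 * p <= 1 - (1 - a) / 2.
    have -> : 2^-1 * p = 2 `^ (- (1 - a)).
      by rewrite opprB powRB// ?powRr1//; [rewrite mulrC|apply/implyP].
    by apply: powR2N_le; lra.
  have pp : 0 <= 2^-1 * p by rewrite mulr_ge0.
  rewrite ler_wpM2l ?mulr_ge0 ?powR_ge0//.
  apply: le_trans (geometric_sum_le _ _) _; first by rewrite pp; lra.
  have -> : 2 / (1 - a) = ((1 - a) / 2)^-1 by field; rewrite gt_eqF.
  by rewrite lef_pV2 ?posrE; lra.
have -> : D + (24 * D * 2 + 48 * D * A * (2 / (1 - a))) =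
    D * (49 + 96 * (A / (1 - a))) by field; rewrite gt_eqF.
have -> : 100 * D * (1 + Num.sqrt chat * L `^ a / (1 - a)) =
    D * (100 + 100 * (A / (1 - a))) by rewrite /A; field; rewrite gt_eqF.
rewrite ler_pM2l//; rewrite -/A in rhs0; lra.
Qed.

End chaining.

(** * Mean of the supremum of an empirical process *)

Section empirical_process.
Context (R : realType) d (T : measurableType d).

(** Symmetrization, then [dudley] for each fixed sample, at a scale depending on the sample. The
    envelope enters only through its second moments, which the sliced Renyi process relies on. *)
Lemma empirical_deviation (K : finType) (k0 : K) (g : K -> T -> R)
    (chat b a : R) (p : nat -> probability T R) n (phi : K -> nat -> T -> R)
    (r q : nat -> T -> R) (V L : R) :
  entropy_bound g chat b a -> 0 <= chat -> 0 <= b -> 0 < a < 1 ->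
  0 < V -> 0 <= L -> (forall k i, bmeas (phi k i)) -> (forall i, bmeas (r i)) ->
  (forall i x, 0 < q i x) -> (forall k i x, `|phi k i x| <= r i x) ->
  (forall k l i x, `|phi k i x - phi l i x| <= q i x * `|g k x - g l x|) ->
  (forall i x, q i x * b <= r i x * L) ->
  \sum_(i < n) \int[p i]_x (r i x ^+ 2) <= V ^+ 2 ->
  \int[prodm p n]_t maxabs (fun k =>
      \sum_(i < n) (phi k i (tnth t i) - \int[p i]_x phi k i x)) <=
    300 * V * (1 + Num.sqrt chat * L `^ a / (1 - a)).
Proof.
move=> ent chat0 b0 a01 V0 L0 bphi br q0 phir phiq qL rV.
set A := 1 + _.
have A1 : 0 <= A.
  have /andP[_ a1] := a01.
  by rewrite addr_ge0// divr_ge0 ?mulr_ge0 ?powR_ge0 ?sqrtr_ge0// subr_ge0 ltW.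
have r0 i x : 0 <= r i x by exact: le_trans (phir k0 i x).
have bphit k j (i : 'I_n) : bmeas (fun t : n.-tuple T => phi k j (tnth t i)).
  by apply: bmeas_comp (bphi k j); exact: measurable_tnth.
have br2 i : bmeas (fun x => r i x ^+ 2).
  by under [X in bmeas X]funext do rewrite expr2; exact: bmeasM.
have br2t j (i : 'I_n) : bmeas (fun t : n.-tuple T => r j (tnth t i) ^+ 2).
  by apply: (bmeas_comp _ (br2 j)); exact: measurable_tnth.
pose S (t : n.-tuple T) := \sum_(i < n) r i (tnth t i) ^+ 2.
have bS : bmeas S by apply: bmeas_sum => i _; exact: br2t.
have S0 t : 0 <= S t by apply: sumr_ge0 => i _; exact: sqr_ge0.
have D2 t : 0 < S t + V ^+ 2 by rewrite ltr_wpDl// exprn_gt0.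
(* The 2 is that of the symmetrized summands; V^2 keeps the scale positive on samples where the
   envelope vanishes. *)
pose D t := 2 * Num.sqrt (S t + V ^+ 2).
have D0 t : 0 < D t by rewrite mulr_gt0// sqrtr_gt0.
have DE t : D t ^+ 2 = 4 * (S t + V ^+ 2).
  by rewrite exprMn sqr_sqrtr ?ltW//; ring.
have V2 : 0 <= V ^+ 2 by exact: sqr_ge0.
(* Linearising the root replaces Jensen: the right-hand side has mean at most 3 V, and 300 is 3
   times the constant of [dudley]. *)
have DV t : D t <= V^-1 * S t + 2 * V.
  have := sqr_ge0 (D t / 2 - V); rewrite sqrrB expr_div_n DE => h.
  have -> : V^-1 * S t + 2 * V = (S t + 2 * V ^+ 2) / V by field; rewrite gt_eqF.
  rewrite ler_pdivlMr//; move: h.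
  have -> : 4 * (S t + V ^+ 2) / 2 ^+ 2 = S t + V ^+ 2 by field.
  rewrite mulr2n; lra.
have bF (F : K -> n.-tuple T -> R) : (forall k, bmeas (F k)) ->
    bmeas (fun t => maxabs (F ^~ t)) by exact: bmeas_maxabs.
apply: (@le_trans _ _ (\int[prodm p n]_t maxabs (fun k => 0 +
    \sum_(i < n) (phi k i (tnth t i) - \int[p i]_x phi k i x)))).
  rewrite le_eqVlt; apply/orP; left; apply/eqP; apply: eq_mean => t.
  by congr maxabs; apply: funext => k; rewrite add0r.
apply: le_trans (symmetrization p n (fun=> 0) bphi) _.
apply: (@le_trans _ _ (\int[prodm p n]_t (100 * A * (V^-1 * S t + 2 * V)))).
  apply: le_mean.
  - apply: (@bmeas_rad _ _ _ n (fun e t => maxabs (fun k => 0 +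
      \sum_(i < n) e`_i * (2 * phi k i (tnth t i))))) => e.
    apply: bF => k; apply: bmeasD; first exact: bmeas_cst.
    by apply: bmeas_sum => i _; do 2 apply: bmeasZ.
  - by apply/bmeasZ/bmeasD; [exact: bmeasZ | exact: bmeas_cst].
  move=> t; apply: (@le_trans _ _ (100 * D t * A)); last first.
    by rewrite mulrAC ler_wpM2l// mulr_ge0.
  have := dudley k0 (xs := tnth t) (t := fun k (i : 'I_n) => 2 * phi k i (tnth t i))
    (q := fun i : 'I_n => 2 * q i (tnth t i)) (D := D t) (L := L) ent chat0 b0 a01
    (D0 t) L0.
  have -> : rad n (fun e => maxabs (fun k => 0 +
       \sum_(i < n) e`_i * (2 * phi k i (tnth t i)))) =
     rad n (fun e => maxabs (fun k => \sum_(i < n) e`_i * (2 * phi k i (tnth t i)))).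
    by apply: eq_rad => e; congr maxabs; apply: funext => k; rewrite add0r.
  apply.
  - by move=> i; rewrite mulr_gt0.
  - by move=> k l i; rewrite -mulrBr normrM ger0_norm// -mulrA ler_wpM2l.
  - move=> k; rewrite DE.
    have : \sum_(i < n) (2 * phi k i (tnth t i)) ^+ 2 <= 4 * S t.
      rewrite mulr_sumr; apply: ler_sum => i _; rewrite exprMn.
      rewrite -[2 ^+ 2]/(2 * 2) -natrM ler_wpM2l// -[leLHS]real_normK ?num_real//.
      by rewrite ler_pXn2r ?nnegrE.
    by move/le_trans; apply; rewrite ler_wpM2l// lerDl.
  - rewrite DE mulr_suml.
    apply: (@le_trans _ _ (4 * S t * L ^+ 2)); last first.
      by rewrite ler_wpM2r ?sqr_ge0// ler_wpM2l// lerDl.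
    rewrite mulr_sumr mulr_suml; apply: ler_sum => i _.
    have -> : (2 * q i (tnth t i)) ^+ 2 * b ^+ 2 = 4 * (q i (tnth t i) * b) ^+ 2 by ring.
    rewrite -mulrA -exprMn ler_wpM2l// ler_pXn2r ?nnegrE ?mulr_ge0// ltW//.
rewrite meanZ; last by apply: bmeasD; [exact: bmeasZ | exact: bmeas_cst].
rewrite meanD ?mean_cst; [|exact: bmeasZ|exact: bmeas_cst].
rewrite meanZ// mean_sum//.
have -> : 300 * V * A = 100 * A * (V + 2 * V) by ring.
rewrite ler_wpM2l ?mulr_ge0// lerD2r mulrC ler_pdivrMr// -expr2.
apply: le_trans rV; rewrite le_eqVlt; apply/orP; left; apply/eqP.
by apply: eq_bigr => i _; exact: (mean_prodm_coord p i (br2 i)).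
Qed.

End empirical_process.

(** * Two-sample deviations *)

Section two_samples.
Context (R : realType) d (T : measurableType d).

Lemma sum_ord_cst n (c : R) : \sum_(i < n) c = n%:R * c.
Proof. by rewrite sumr_const card_ord mulr_natl. Qed.

(** [iota] selects a block of the pooled sample. With [lshift] and [rshift] both empirical means
    become functions of one tuple, to which a single concentration inequality applies. *)
Definition emp N n (iota : 'I_n -> 'I_N) (h : T -> R) (t : N.-tuple T) : R :=
  n%:R^-1 * \sum_(i < n) h (tnth t (iota i)).

Lemma bmeas_emp N n (iota : 'I_n -> 'I_N) h : bmeas h -> bmeas (emp iota h).
Proof.
move=> bh; apply/bmeasZ/bmeas_sum => i _.
by apply: bmeas_comp bh; exact: measurable_tnth.
Qed.

Lemma mean_emp N n (iota : 'I_n -> 'I_N) h (p : nat -> probability T R) q :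
  (0 < n)%N -> bmeas h -> (forall i, p (iota i) = q) ->
  \int[prodm p N]_t emp iota h t = \int[q]_x h x.
Proof.
move=> n0 bh pq; have bt i : bmeas (fun t : N.-tuple T => h (tnth t (iota i))).
  by apply: bmeas_comp bh; exact: measurable_tnth.
rewrite meanZ; last by apply: bmeas_sum => i _; exact: bt.
rewrite mean_sum// (eq_bigr (fun=> \int[q]_x h x)); last first.
  by move=> i _; rewrite (mean_prodm_coord p (iota i) bh) pq.
rewrite sum_ord_cst mulrA mulVf ?mul1r//.
by rewrite pnatr_eq0 -lt0n.
Qed.

Lemma emp_cst_le N n (iota : 'I_n -> 'I_N) h c t : (0 < n)%N ->
  (forall x, h x <= c) -> emp iota h t <= c.
Proof.
move=> n0 hc; rewrite /emp ler_pdivrMl ?ltr0n//.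
apply: (@le_trans _ _ (\sum_(i < n) c)); first by apply: ler_sum => i _.
by rewrite sum_ord_cst.
Qed.

Lemma emp_cst_ge N n (iota : 'I_n -> 'I_N) h c t : (0 < n)%N ->
  (forall x, c <= h x) -> c <= emp iota h t.
Proof.
move=> n0 hc; rewrite /emp ler_pdivlMl ?ltr0n//.
apply: (@le_trans _ _ (\sum_(i < n) c)); last by apply: ler_sum => i _.
by rewrite sum_ord_cst.
Qed.

Lemma emp_diff N n (iota : 'I_n -> 'I_N) h c (i : 'I_N) (t t' : N.-tuple T) :
  injective iota -> 0 <= c -> (forall x y, `|h x - h y| <= c) ->
  (forall j, j != i -> tnth t j = tnth t' j) ->
  `|emp iota h t - emp iota h t'| <= c / n%:R.
Proof.
move=> inj c0 hc tt'; rewrite /emp -mulrBr normrM ger0_norm ?invr_ge0// mulrC.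
rewrite ler_wpM2r ?invr_ge0// -sumrB.
case: (pickP (fun j => iota j == i)) => [j /eqP ji|none].
  rewrite (bigD1 j)//= big1 ?addr0// => l lj; rewrite tt' ?subrr// -ji.
  by rewrite inj_eq.
by rewrite big1 ?normr0// => j _; rewrite tt' ?subrr// none.
Qed.

Section sample_law.
Variables (mu nu : probability T R) (n : nat).
Hypothesis n0 : (0 < n)%N.

Definition sample_law (i : nat) : probability T R := if (i < n)%N then mu else nu.

Local Notation P := (prodm sample_law (n + n)).
Local Notation eX := (emp (@lshift n n)).
Local Notation eY := (emp (@rshift n n)).

Lemma mean_eX h : bmeas h -> \int[P]_t eX h t = \int[mu]_x h x.
Proof.
by move=> bh; apply: mean_emp => // i; rewrite /sample_law /= ltn_ord.
Qed.

Lemma mean_eY h : bmeas h -> \int[P]_t eY h t = \int[nu]_x h x.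
Proof.
by move=> bh; apply: mean_emp => // i; rewrite /sample_law /= ltnNge leq_addr.
Qed.

(** Both samples form one process over 2 n independent coordinates, with integrand, envelope and
    Lipschitz weight chosen by block. The second moments add up to at most n v^2, and dividing the
    resulting sqrt(n) v by n leaves v / sqrt(n). *)
Lemma two_sample_deviation (K : finType) (k0 : K) (g : K -> T -> R)
    (chat b a : R) (phiX phiY : K -> T -> R) (rX rY qX qY : T -> R) (v L : R) :
  entropy_bound g chat b a -> 0 <= chat -> 0 <= b -> 0 < a < 1 ->
  0 < v -> 0 <= L ->
  (forall k, bmeas (phiX k)) -> (forall k, bmeas (phiY k)) -> bmeas rX -> bmeas rY ->
  (forall x, 0 < qX x) -> (forall x, 0 < qY x) ->
  (forall k x, `|phiX k x| <= rX x) -> (forall k x, `|phiY k x| <= rY x) ->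
  (forall k l x, `|phiX k x - phiX l x| <= qX x * `|g k x - g l x|) ->
  (forall k l x, `|phiY k x - phiY l x| <= qY x * `|g k x - g l x|) ->
  (forall x, qX x * b <= rX x * L) -> (forall x, qY x * b <= rY x * L) ->
  \int[mu]_x (rX x ^+ 2) + \int[nu]_x (rY x ^+ 2) <= v ^+ 2 ->
  \int[P]_t maxabs (fun k => (eX (phiX k) t - \int[mu]_x phiX k x) +
     (eY (phiY k) t - \int[nu]_x phiY k x)) <=
  300 * v * (1 + Num.sqrt chat * L `^ a / (1 - a)) / Num.sqrt n%:R.
Proof.
move=> ent chat0 b0 a01 v0 L0 bX bY brX brY qX0 qY0 pX pY lX lY qLX qLY rv.
pose phi k i := if (i < n)%N then phiX k else phiY k.
pose r i := if (i < n)%N then rX else rY.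
pose q i := if (i < n)%N then qX else qY.
have nR0 : 0 < n%:R :> R by rewrite ltr0n.
pose s := Num.sqrt n%:R : R.
have s0 : 0 < s by rewrite sqrtr_gt0.
have ss : s ^+ 2 = n%:R by rewrite sqr_sqrtr// ltW.
have lt_l (i : 'I_n) : (lshift n i < n)%N by rewrite /= ltn_ord.
have lt_r (i : 'I_n) : (rshift n i < n)%N = false by rewrite /= ltnNge leq_addr.
have := @empirical_deviation R d T K k0 g chat b a sample_law (n + n) phi r q (s * v) L
  ent chat0 b0 a01 (mulr_gt0 s0 v0) L0.
set I := \int[_]_t _; set J := \int[_]_t _; move=> H.
have {H} HI : I <= 300 * (s * v) * (1 + Num.sqrt chat * L `^ a / (1 - a)).
  apply: H.
  - by move=> k i; rewrite /phi; case: ifP.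
  - by move=> i; rewrite /r; case: ifP.
  - by move=> i x; rewrite /q; case: ifP.
  - by move=> k i x; rewrite /phi /r; case: ifP.
  - by move=> k l i x; rewrite /phi /q; case: ifP.
  - by move=> i x; rewrite /q /r; case: ifP.
  rewrite big_split_ord /= (eq_bigr (fun=> \int[mu]_x (rX x ^+ 2))); last first.
    by move=> i _; rewrite /sample_law /r lt_l.
  rewrite [X in _ + X](eq_bigr (fun=> \int[nu]_x (rY x ^+ 2))); last first.
    by move=> i _; rewrite /sample_law /r lt_r.
  rewrite !sum_ord_cst exprMn ss -mulrDr.
  by rewrite ler_wpM2l.
have -> : J = n%:R^-1 * I.
  rewrite -meanZ; last first.
    apply: (@bmeas_maxabs _ _ _ _ (fun k t => \sum_(i < n + n)
      (phi k i (tnth t i) - \int[sample_law i]_x phi k i x))) => k.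
    apply: bmeas_sum => i _; apply: bmeasB; last exact: bmeas_cst.
    apply: (@bmeas_comp _ _ _ _ _ _ (phi k i)); first exact: measurable_tnth.
    by rewrite /phi; case: ifP.
  apply: eq_mean => t.
  have nI : 0 <= n%:R^-1 :> R by rewrite invr_ge0 ltW.
  have lin k : (eX (phiX k) t - \int[mu]_x phiX k x) +
     (eY (phiY k) t - \int[nu]_x phiY k x) = n%:R^-1 * \sum_(i < n + n)
      (phi k i (tnth t i) - \int[sample_law i]_x phi k i x).
    rewrite big_split_ord/= (eq_bigr (fun i => phiX k (tnth t (lshift n i)) -
      \int[mu]_x phiX k x)); last first.
      by move=> i _; rewrite /sample_law /phi lt_l.
    rewrite [X in _ * (_ + X)](eq_bigr (fun i => phiY k (tnth t (rshift n i)) -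
      \int[nu]_x phiY k x)); last first.
      by move=> i _; rewrite /sample_law /phi lt_r.
    rewrite !sumrB !sum_ord_cst /emp.
    by field; rewrite gt_eqF.
  apply/eqP; rewrite eq_le; apply/andP; split.
    apply: maxabs_le => [|k]; first by rewrite mulr_ge0// maxabs_ge0.
    by rewrite lin normrM (ger0_norm nI) ler_wpM2l// le_maxabs.
  rewrite ler_pdivrMl//; apply: maxabs_le => [|k].
    by rewrite mulr_ge0 ?maxabs_ge0// ltW.
  rewrite -ler_pdivrMl// -{1}(ger0_norm nI) -normrM -lin.
  exact: (le_maxabs (fun k => (eX (phiX k) t - \int[mu]_x phiX k x) +
     (eY (phiY k) t - \int[nu]_x phiY k x))).
rewrite ler_pdivrMl//; apply: le_trans HI _.
move: (1 + _) => W; rewrite -/s -ss le_eqVlt; apply/orP; left; apply/eqP.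
by field; rewrite gt_eqF.
Qed.

Lemma entropy_bound_single (g : 'I_1 -> T -> R) (b a : R) : entropy_bound g 0 b a.
Proof.
move=> m w xs w0 w1 eps eps0; exists id; split=> [k|].
  rewrite /L2fin big1 ?sqrtr0 ?mulr_ge0 ?ltW// => i _.
  by rewrite /= subrr expr0n mulr0.
rewrite mul0r add0r; apply: (@le_trans _ _ 1).
  by rewrite -[leRHS]/(1%:R) ler_nat; apply: leq_trans (max_card _) _; rewrite card_ord.
by rewrite -[leLHS]expR0 ler_expR.
Qed.

(** The chaining bound for a class of one element gives the n^(-1/2) rate, which spares a separate
    variance computation. *)
Lemma single_deviation (phi psi : T -> R) (c c' : R) : 0 < c -> 0 < c' ->
  bmeas phi -> bmeas psi ->
  (forall x, `|phi x| <= c) -> (forall x, `|psi x| <= c') ->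
  \int[P]_t `|(eX phi t - \int[mu]_x phi x) + (eY psi t - \int[nu]_x psi x)| <=
  300 * (c + c') / Num.sqrt n%:R.
Proof.
move=> c0 c0' bphi bpsi phic psic.
(* Any exponent in (0, 1) would serve: with entropy constant 0 the term containing L^a vanishes. *)
have := @two_sample_deviation 'I_1 ord0 (fun _ _ => 0) 0 0 2^-1
  (fun=> phi) (fun=> psi) (fun=> c) (fun=> c') (fun=> 1) (fun=> 1) (c + c') 0
  (@entropy_bound_single _ _ _) (lexx 0) (lexx 0).
rewrite sqrtr0 !mul0r addr0 mulr1 => H.
apply: le_trans _ (H _ _ _ _ _ _ _ _ _ _ _ _ _ _ _ _) => //; last 1 first.
- clear H; rewrite !mean_cst; have := mulr_ge0 (ltW c0) (ltW c0'); nra.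
- apply: le_mean.
  + apply: bmeas_norm; apply: bmeasD; apply: bmeasB; try exact: bmeas_cst;
    exact: bmeas_emp.
  + apply: (@bmeas_maxabs _ _ _ _ (fun k t => (eX phi t - \int[mu]_x phi x) +
      (eY psi t - \int[nu]_x psi x))) => k.
    by apply: bmeasD; apply: bmeasB; try exact: bmeas_cst; exact: bmeas_emp.
  + move=> t; exact: (le_maxabs (fun _ : 'I_1 => (eX phi t - \int[mu]_x phi x) +
      (eY psi t - \int[nu]_x psi x)) ord0).
- by clear H; apply/andP; split; lra.
- exact: addr_gt0.
- exact: bmeas_cst.
- exact: bmeas_cst.
- by move=> k l x; rewrite subrr normr0 mulr_ge0.
- by move=> k l x; rewrite subrr normr0 mulr_ge0.
- by rewrite !mulr0.
- by rewrite !mulr0.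
Qed.

End sample_law.

Section maximum.
Variable (m : nat).
Implicit Types u : 'I_m.+1 -> R.

(** Starting the maximum from [u ord0] keeps it among the values of [u], which may all be
    negative. *)
Definition supk u := \big[Num.max/u ord0]_k u k.

Lemma le_supk u k : u k <= supk u.
Proof. exact: le_bigmax. Qed.

Lemma supk_le u c : (forall k, u k <= c) -> supk u <= c.
Proof. by move=> uc; apply: bigmax_le. Qed.

Lemma bmeas_supk d' (T' : measurableType d') (F : 'I_m.+1 -> T' -> R) :
  (forall k, bmeas (F k)) -> bmeas (fun t => supk (F ^~ t)).
Proof. by move=> bF; exact: bmeas_bigmax. Qed.

(** A maximum of functions with bounded differences c again has bounded differences c, so the tail
    does not depend on how many functions there are. *)
Lemma supk_upper_tail p N (F : 'I_m.+1 -> N.-tuple T -> R) (c D e s S : R) :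
  (forall k, bmeas (F k)) -> 0 < c ->
  (forall k, bounded_differences (fun=> c) (F k)) ->
  N%:R * c ^+ 2 <= S -> 0 < S -> 0 <= s ->
  \int[prodm p N]_t supk (F ^~ t) <= D + e ->
  (prodm p N [set t | (D + e + s <= supk (F ^~ t))%R] <=
    (expR (- (s ^+ 2 / (8 * S))))%:E)%E.
Proof.
move=> bF c0 dF NS S0 s0 ED.
have bS := bmeas_supk bF.
have msets x : measurable [set t | (x <= supk (F ^~ t))%R].
  rewrite (_ : [set _ | _] = (fun t => supk (F ^~ t)) @^-1` `[x, +oo[); last first.
    by apply/seteqP; split => t /=; rewrite in_itv/= andbT.
  by rewrite -[X in measurable X]setTI; apply: bS.1.
apply: (@le_trans _ _ (prodm p N [set t | (\int[prodm p N]_u supk (F ^~ u) + s <= supk (F ^~ t))%R])).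
  apply: le_measure; rewrite ?inE//.
  by move=> t /=; apply: le_trans; rewrite lerD2r.
apply: (mcdiarmid p bS (c := fun=> c)) => //; last first.
  by rewrite sum_ord_cst.
move=> i t t' tt'; rewrite lerBlDl; apply: supk_le => k.
apply: (@le_trans _ _ (F k t' + c)); last by rewrite lerD2r; exact: (le_supk (F ^~ t')).
by rewrite -lerBlDl; exact: dF tt'.
Qed.

End maximum.

Lemma lower_tail p N (F : N.-tuple T -> R) (c D e s S : R) :
  bmeas F -> 0 < c -> bounded_differences (fun=> c) F ->
  N%:R * c ^+ 2 <= S -> 0 < S -> 0 <= s ->
  D - e <= \int[prodm p N]_t F t ->
  (prodm p N [set t | (F t <= D - e - s)%R] <=
    (expR (- (s ^+ 2 / (8 * S))))%:E)%E.
Proof.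
move=> bF c0 dF NS S0 s0 ED.
have := @supk_upper_tail 0 p N (fun _ t => - F t) c (- D) e s S.
have supE t : supk (fun _ : 'I_1 => - F t) = - F t.
  by apply/eqP; rewrite eq_le supk_le//=; exact: (le_supk (fun _ : 'I_1 => - F t) ord0).
under eq_mean do rewrite supE.
under eq_set do rewrite supE.
have -> : [set t | F t <= D - e - s] = [set t | - D + e + s <= - F t].
  by apply/seteqP; split => t /= h; lra.
apply => //.
- by move=> k; exact: bmeasN.
- move=> k i t t' tt'; rewrite opprK addrC; apply: (dF i) => j ji.
  by rewrite tt'.
- by rewrite meanN//; lra.
Qed.

End two_samples.

(** * Kullback-Leibler divergence *)

Section exp_lipschitz.
Context (R : realType).
Implicit Types u v c : R.

Lemma expR_lipschitz u v c : u <= c -> v <= c ->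
  `|expR u - expR v| <= expR c * `|u - v|.
Proof.
wlog uv : u v / v <= u.
  move=> H; case: (leP v u) => [|/ltW] h; first exact: H.
  by move=> uc vc; rewrite distrC (distrC u); exact: H.
move=> uc vc; rewrite !ger0_norm ?subr_ge0 ?ler_expR//.
have h1 := expR_tangent v u.
have h2 : expR u * (u - v) <= expR c * (u - v).
  by rewrite ler_wpM2r ?subr_ge0// ler_expR.
apply: le_trans h2; lra.
Qed.

Lemma ln_lipschitz u v (l : R) : 0 < l -> l <= u -> l <= v ->
  `|ln u - ln v| <= l^-1 * `|u - v|.
Proof.
wlog uv : u v / v <= u.
  move=> H; case: (leP v u) => [|/ltW] h; first exact: H.
  by move=> l0 lu lv; rewrite distrC (distrC u); exact: H.
move=> l0 lu lv; have v0 : 0 < v by exact: lt_le_trans lv.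
have u0 : 0 < u by exact: lt_le_trans lu.
rewrite !ger0_norm ?subr_ge0// ?ler_ln//.
have : ln u - ln v <= u / v - 1.
  rewrite -ln_div//; have := expR_ge1Dx (ln (u / v)).
  by rewrite lnK ?posrE ?divr_gt0//; lra.
move/le_trans; apply; have -> : u / v - 1 = v^-1 * (u - v).
  by field; rewrite gt_eqF.
by rewrite ler_wpM2r ?subr_ge0// lef_pV2.
Qed.

(** Separates the entropy constant from the dependence on M and alpha, which gives c its maximum
    with 1. *)
Lemma entropy_factor (chat a X : R) : 0 <= chat -> a < 1 -> 0 <= X ->
  1 + Num.sqrt chat * X / (1 - a) <= Num.max 1 (Num.sqrt chat / (1 - a)) * (1 + X).
Proof.
move=> chat0 a1 X0; set B := Num.max _ _.
have B1 : 1 <= B by rewrite le_max lexx.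
have BA : Num.sqrt chat / (1 - a) <= B by rewrite le_max lexx orbT.
rewrite mulrDr mulr1 mulrAC; apply: lerD => //; exact: ler_wpM2r.
Qed.

End exp_lipschitz.

(** * Tails with explicit constants *)

Section tails.
Context (R : realType) d (T : measurableType d).
Variables (mu nu : probability T R) (n : nat).
Hypothesis n0 : (0 < n)%N.
Local Notation P := (prodm (sample_law mu nu n) (n + n)).

(** With 2 n coordinates of sensitivity 4 W / n the squares sum to 32 W^2 / n, and 8 times 32 is
    16^2; hence the threshold 16 on [C]. *)
Let tail_exponent (C V W z : R) : 0 < W -> W <= V -> 16 <= C -> 0 <= z ->
  expR (- ((C * V * z) ^+ 2 / (8 * (32 * W ^+ 2 / n%:R)))) <= expR (- (n%:R * z ^+ 2)).
Proof.
move=> W0 WV C16 z0; rewrite ler_expR lerN2.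
have nR0 : 0 < n%:R :> R by rewrite ltr0n.
have -> : (C * V * z) ^+ 2 / (8 * (32 * W ^+ 2 / n%:R)) =
    n%:R * z ^+ 2 * ((C / 16 * (V / W)) ^+ 2).
  by field; rewrite !gt_eqF.
rewrite -[leLHS]mulr1 ler_wpM2l ?mulr_ge0 ?sqr_ge0//.
apply: exprn_ege1; rewrite -[leLHS]mulr1; apply: ler_pM => //; first by lra.
by rewrite ler_pdivlMr// mul1r.
Qed.

(** The n^(-1/2) share of the threshold pays for the mean of the maximum, the z share is McDiarmid's
    deviation. The sensitivity W is kept apart from V, the scale of the mean, which may be
    larger. *)
Lemma upper_tail_bound m (F : 'I_m.+1 -> (n + n).-tuple T -> R) (D C V W z : R) :
  (forall k, bmeas (F k)) -> 0 < W -> W <= V -> 16 <= C -> 0 <= z ->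
  (forall k, bounded_differences (fun=> 4 * W / n%:R) (F k)) ->
  \int[P]_t supk (F ^~ t) <= D + C * V / Num.sqrt n%:R ->
  (P [set t | (D + C * V * ((Num.sqrt n%:R)^-1 + z) <= supk (F ^~ t))%R] <=
    (expR (- (n%:R * z ^+ 2)))%:E)%E.
Proof.
move=> bF W0 WV C16 z0 dF EF; have nR0 : 0 < n%:R :> R by rewrite ltr0n.
apply: (@le_trans _ _ (expR (- ((C * V * z) ^+ 2 / (8 * (32 * W ^+ 2 / n%:R)))))%:E); last first.
  by rewrite lee_fin; exact: tail_exponent.
rewrite mulrDr addrA; apply: (supk_upper_tail (c := 4 * W / n%:R)) => //.
- by rewrite divr_gt0// mulr_gt0.
- rewrite natrD le_eqVlt; apply/orP; left; apply/eqP; by field; rewrite gt_eqF.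
- by rewrite divr_gt0// mulr_gt0// exprn_gt0.
- by rewrite !mulr_ge0//; lra.
Qed.

Lemma lower_tail_bound (F : (n + n).-tuple T -> R) (D C V W z e : R) :
  bmeas F -> 0 < W -> W <= V -> 16 <= C -> 0 <= z ->
  bounded_differences (fun=> 4 * W / n%:R) F ->
  D - e - C * V / Num.sqrt n%:R <= \int[P]_t F t ->
  (P [set t | (F t <= D - e - C * V * ((Num.sqrt n%:R)^-1 + z))%R] <=
    (expR (- (n%:R * z ^+ 2)))%:E)%E.
Proof.
move=> bF W0 WV C16 z0 dF EF; have nR0 : 0 < n%:R :> R by rewrite ltr0n.
apply: (@le_trans _ _ (expR (- ((C * V * z) ^+ 2 / (8 * (32 * W ^+ 2 / n%:R)))))%:E); last first.
  by rewrite lee_fin; exact: tail_exponent.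
rewrite mulrDr opprD addrA; apply: (lower_tail _ (c := 4 * W / n%:R)) => //.
- by rewrite divr_gt0// mulr_gt0.
- rewrite natrD le_eqVlt; apply/orP; left; apply/eqP; by field; rewrite gt_eqF.
- by rewrite divr_gt0// mulr_gt0// exprn_gt0.
- by rewrite !mulr_ge0//; lra.
Qed.

End tails.

(** * Bounded density ratios and the Kullback-Leibler objective *)

Section divergence_setup.
Context (R : realType) d (T : measurableType d).

(** The normal form reached by composing with the retraction: the bounds hold at every point, and f
    being the density is kept only as a change of measure for bounded functions. *)
Record density_ratio (mu nu : probability T R) (f : T -> R) (M : R) : Prop := {
  ratio_ge1 : 1 <= M;
  ratio_bmeas : bmeas f;
  ratio_lower : forall x, M^-1 <= f x;
  ratio_upper : forall x, f x <= M;
  ratio_mean : forall h, bmeas h -> \int[mu]_x h x = \int[nu]_x (f x * h x) }.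

Variables (mu nu : probability T R) (f : T -> R) (M : R).
Hypothesis fM : density_ratio mu nu f M.
Let b := ln M.

Lemma ratio_M_gt0 : 0 < M.
Proof. exact: lt_le_trans (ratio_ge1 fM). Qed.

Lemma ratio_expRb : expR b = M.
Proof. by rewrite lnK// posrE ratio_M_gt0. Qed.

Lemma ratio_b_ge0 : 0 <= b.
Proof. by rewrite ln_ge0// (ratio_ge1 fM). Qed.

Lemma ratio_b_le : 1 + b <= M.
Proof. by rewrite -ratio_expRb expR_ge1Dx. Qed.

Lemma ratio_gt0 x : 0 < f x.
Proof. by apply: lt_le_trans (ratio_lower fM x); rewrite invr_gt0 ratio_M_gt0. Qed.

Lemma ratio_ln_bound x : `|ln (f x)| <= b.
Proof.
have M0 := ratio_M_gt0.
rewrite ler_norml -lnV ?posrE// !ler_ln ?posrE ?invr_gt0 ?ratio_gt0//.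
by rewrite (ratio_lower fM) (ratio_upper fM).
Qed.

Lemma bmeas_ln_ratio : bmeas (fun x => ln (f x)).
Proof.
apply: (bmeas_ln (l := M^-1)); last exact: ratio_bmeas fM.
  by rewrite invr_gt0 ratio_M_gt0.
exact: ratio_lower fM.
Qed.

Lemma mean_ratio : \int[nu]_x f x = 1.
Proof.
have := ratio_mean fM (bmeas_cst T 1); rewrite mean_cst => ->.
by apply: eq_mean => x; rewrite mulr1.
Qed.

Section kl.

(** The tangent of the exponential at ln f gives f (1 + g - ln f) <= exp g pointwise, which is then
    integrated against nu. *)
Lemma kl_variational (g : T -> R) : bmeas g ->
  \int[mu]_x g x - \int[nu]_x expR (g x) + 1 <= \int[mu]_x ln (f x).
Proof.
move=> bg; have bl := bmeas_ln_ratio; have bf := ratio_bmeas fM.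
have : \int[mu]_x (g x - ln (f x)) <= \int[nu]_x (expR (g x) - f x).
  rewrite (ratio_mean fM); last exact: bmeasB.
  apply: le_mean.
  - by apply: bmeasM => //; exact: bmeasB.
  - by apply: bmeasB => //; exact: bmeas_expR.
  move=> x; have := expR_tangent (g x) (ln (f x)).
  by rewrite lnK ?posrE ?ratio_gt0//; lra.
by rewrite !meanB// ?mean_ratio; [lra | exact: bmeas_expR].
Qed.

(** The mu-term costs delta; the nu-term costs M delta because the exponential is M-Lipschitz on
    [-b, b]. *)
Lemma kl_approximation (g : T -> R) (delta : R) : bmeas g ->
  (forall x, `|g x| <= b) -> (forall x, `|ln (f x) - g x| <= delta) ->
  \int[mu]_x ln (f x) - (M + 1) * delta <=
  \int[mu]_x g x - \int[nu]_x expR (g x) + 1.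
Proof.
move=> bg gb fg; have bl := bmeas_ln_ratio; have bf := ratio_bmeas fM.
have h1 : \int[mu]_x (ln (f x) - g x) <= delta.
  apply: mean_le_cst; first exact: bmeasB.
  by move=> x; apply: le_trans (ler_norm _) (fg x).
have h2 : \int[nu]_x (expR (g x) - f x) <= M * delta.
  apply: mean_le_cst; first by apply: bmeasB => //; exact: bmeas_expR.
  move=> x; apply: le_trans (ler_norm _) _.
  rewrite -{1}[f x]lnK ?posrE ?ratio_gt0//.
  apply: le_trans (expR_lipschitz (c := b) _ _) _.
  - exact: le_trans (ler_norm _) (gb x).
  - exact: le_trans (ler_norm _) (ratio_ln_bound x).
  by rewrite ratio_expRb distrC ler_wpM2l// ltW// ratio_M_gt0.
move: h1 h2; rewrite !meanB// ?mean_ratio; [lra | exact: bmeas_expR].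
Qed.

Variable n : nat.
Hypothesis n0 : (0 < n)%N.
Local Notation P := (prodm (sample_law mu nu n) (n + n)).
Local Notation eX := (emp (@lshift n n)).
Local Notation eY := (emp (@rshift n n)).

Definition kl_objective (g : T -> R) (t : (n + n).-tuple T) : R :=
  eX g t - eY (fun x => expR (g x)) t + 1.

Lemma bmeas_kl_objective g : bmeas g -> bmeas (kl_objective g).
Proof.
move=> bg; apply: bmeasD; last exact: bmeas_cst.
by apply: bmeasB; apply: bmeas_emp => //; exact: bmeas_expR.
Qed.

Let expR_gM (g : T -> R) x : `|g x| <= b -> expR (g x) <= M.
Proof.
by move=> gb; rewrite -ratio_expRb ler_expR; exact: le_trans (ler_norm _) gb.
Qed.

Let dobj g : (forall x, `|g x| <= b) ->
  bounded_differences (fun=> 4 * M / n%:R) (kl_objective g).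
Proof.
move=> gb i t t' tt'; have bM := ratio_b_le; have M0 := ratio_M_gt0.
have h1 : `|eX g t - eX g t'| <= 2 * M / n%:R.
  apply: (emp_diff (@lshift_inj _ _) _ _ tt'); first by rewrite mulr_ge0// ltW.
  by move=> x y; have := gb x; have := gb y; rewrite !ler_norml; lra.
have h2 : `|eY (fun x => expR (g x)) t - eY (fun x => expR (g x)) t'| <= 2 * M / n%:R.
  apply: (emp_diff (@rshift_inj _ _) _ _ tt'); first by rewrite mulr_ge0// ltW.
  move=> x y; have := expR_gM (gb x); have := expR_gM (gb y).
  have := expR_gt0 (g x); have := expR_gt0 (g y); rewrite ler_norml; lra.
have -> : 4 * M / n%:R = 2 * M / n%:R + 2 * M / n%:R by ring.
move: h1 h2; rewrite /kl_objective !ler_norml; lra.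
Qed.

Lemma kl_upper m (g : 'I_m.+1 -> T -> R) (chat a z : R) :
  (forall k, bmeas (g k)) -> (forall k x, `|g k x| <= b) ->
  entropy_bound g chat b a -> 0 <= chat -> 0 < a < 1 -> 0 <= z ->
  (P [set t | (\int[mu]_x ln (f x) +
       600 * (Num.max 1 (Num.sqrt chat / (1 - a)) * (M * (1 + b `^ a))) *
         ((Num.sqrt n%:R)^-1 + z) <= supk (fun k => kl_objective (g k) t))%R] <=
    (expR (- (n%:R * z ^+ 2)))%:E)%E.
Proof.
move=> bg gb ent chat0 a01 z0; set B := Num.max _ _.
have a1 : a < 1 by case/andP: a01.
have b0 := ratio_b_ge0; have bM := ratio_b_le; have M0 := ratio_M_gt0.
have B1 : 1 <= B by rewrite le_max lexx.
have X0 : 0 <= b `^ a by exact: powR_ge0.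
have nR0 : 0 < n%:R :> R by rewrite ltr0n.
have be k : bmeas (fun x => - expR (g k x)) by apply: bmeasN; exact: bmeas_expR.
apply: (upper_tail_bound n0 (F := fun k => kl_objective (g k)) (W := M)) => //.
- by move=> k; exact: bmeas_kl_objective.
- rewrite mulrCA ler_peMr//; first exact: ltW.
  by rewrite -[leLHS]mulr1; apply: ler_pM => //; lra.
- lra.
- by move=> k; exact: dobj.
(* The integrand on the second sample is - exp g, so that the sum of both deviations is that of the
   objective. Envelope M serves both samples, with Lipschitz constants 1 and M, hence L = b and v =
   2 M. *)
have := @two_sample_deviation R d T mu nu n n0 'I_m.+1 ord0 g chat b a g
  (fun k x => - expR (g k x)) (fun=> M) (fun=> M) (fun=> 1) (fun=> M) (2 * M) b
  ent chat0 b0 a01.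
set J := \int[P]_t _ => HJ.
have {HJ} HJ : J <= 300 * (2 * M) * (1 + Num.sqrt chat * b `^ a / (1 - a)) /
    Num.sqrt n%:R.
  apply: HJ => //; try exact: bmeas_cst.
  - by rewrite mulr_gt0.
  - by move=> k x; apply: le_trans (gb k x) _; lra.
  - by move=> k x; rewrite normrN ger0_norm ?expR_ge0// expR_gM.
  - by move=> k l x; rewrite mul1r.
  - move=> k l x; rewrite -opprD normrN -ratio_expRb; apply: expR_lipschitz.
      exact: le_trans (ler_norm _) (gb k x).
    exact: le_trans (ler_norm _) (gb l x).
  - by move=> x; rewrite mul1r ler_peMl// (ratio_ge1 fM).
  - by rewrite !mean_cst; nra.
apply: (@le_trans _ _ (\int[mu]_x ln (f x) + J)).
  rewrite -[X in X + J](mean_cst P) -meanD; last 2 first.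
  - exact: bmeas_cst.
  - apply: (@bmeas_maxabs _ _ _ _ (fun k t => eX (g k) t - \int[mu]_x g k x +
      (eY (fun x => - expR (g k x)) t - \int[nu]_x - expR (g k x)))) => k.
    by apply: bmeasD; apply: bmeasB; try exact: bmeas_cst; exact: bmeas_emp.
  apply: le_mean.
  - by apply: (bmeas_supk (F := fun k => kl_objective (g k))) => k; exact: bmeas_kl_objective.
  - apply: bmeasD; first exact: bmeas_cst.
    apply: (@bmeas_maxabs _ _ _ _ (fun k t => eX (g k) t - \int[mu]_x g k x +
      (eY (fun x => - expR (g k x)) t - \int[nu]_x - expR (g k x)))) => k.
    by apply: bmeasD; apply: bmeasB; try exact: bmeas_cst; exact: bmeas_emp.
  move=> t; apply: supk_le => k.
  have := le_maxabs (fun k => eX (g k) t - \int[mu]_x g k x +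
      (eY (fun x => - expR (g k x)) t - \int[nu]_x - expR (g k x))) k.
  set Z := maxabs _; move/(le_trans (ler_norm _)).
  have -> : eY (fun x => - expR (g k x)) t = - eY (fun x => expR (g k x)) t.
    by rewrite /emp sumrN mulrN.
  rewrite meanN; last exact: bmeas_expR.
  have := kl_variational (bg k); rewrite /kl_objective; lra.
rewrite lerD2l; apply: le_trans HJ _.
rewrite ler_wpM2r ?invr_ge0 ?sqrtr_ge0//.
have := entropy_factor chat0 a1 X0; rewrite -/B => h.
have -> : 600 * (B * (M * (1 + b `^ a))) = 300 * (2 * M) * (B * (1 + b `^ a)) by ring.
exact: (ler_wpM2l (mulr_ge0 (ler0n _ 300) (mulr_ge0 (ler0n _ 2) (ltW M0))) h).
Qed.

(** The objective is affine in the empirical means, hence unbiased for fixed g: the n^(-1/2) share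
    of the threshold is carried only to match the upper tail. *)
Lemma kl_lower (g : T -> R) (delta z B X : R) : bmeas g ->
  (forall x, `|g x| <= b) -> (forall x, `|ln (f x) - g x| <= delta) ->
  1 <= B -> 0 <= X -> 0 <= z ->
  (P [set t | (kl_objective g t <= \int[mu]_x ln (f x) - (M + 1) * delta -
       600 * (B * (M * (1 + X))) * ((Num.sqrt n%:R)^-1 + z))%R] <=
    (expR (- (n%:R * z ^+ 2)))%:E)%E.
Proof.
move=> bg gb fg B1 X0 z0; have M0 := ratio_M_gt0.
apply: (lower_tail_bound n0 (W := M)) => //.
- exact: bmeas_kl_objective.
- rewrite mulrCA ler_peMr//; first exact: ltW.
  by rewrite -[leLHS]mulr1; apply: ler_pM => //; lra.
- lra.
- exact: dobj.
rewrite meanD; [|by apply: bmeasB; apply: bmeas_emp => //; exact: bmeas_expR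
  |exact: bmeas_cst].
rewrite meanB; [|exact: bmeas_emp|by apply: bmeas_emp; exact: bmeas_expR].
rewrite mean_eX// mean_eY//; last exact: bmeas_expR.
rewrite mean_cst; have := kl_approximation bg gb fg.
suff : 0 <= 600 * (B * (M * (1 + X))) / Num.sqrt n%:R by lra.
have B0 : 0 <= B by exact: le_trans B1.
have X1 : 0 <= 1 + X by exact: addr_ge0.
have C0 : (0 : R) <= 600 by exact: ler0n.
by rewrite divr_ge0 ?sqrtr_ge0 ?(mulr_ge0 C0) ?(mulr_ge0 B0) ?(mulr_ge0 (ltW M0)).
Qed.

End kl.
End divergence_setup.

(** * Renyi divergence *)

Section norm_lemmas.
Context (R : realType).
Implicit Types x y z : R.

Lemma ler_norm_sub x y z : x <= z + y -> y <= z + x -> `|x - y| <= z.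
Proof. by rewrite ler_norml; lra. Qed.

Lemma ler_norm_sub2 x y z a c : `|x - y| <= z -> c <= z + a ->
  y - 2 * z <= x + a - c.
Proof. by rewrite ler_norml; lra. Qed.

(** With u = ln f and v = g, and with p and q the integrals of the two functions on the right,
    integration against nu makes the right-hand side equal to 1. *)
Lemma young_lt1 (al u v p q : R) : 0 < al -> al < 1 -> 0 < p -> 0 < q ->
  expR (- (al * ln p) - (1 - al) * ln q) * expR (al * u) <=
  al / p * (expR u * expR ((al - 1) * v)) + (1 - al) / q * expR (al * v).
Proof.
move=> al0 al1 p0 q0.
have := @expR_convex R al (u + (al - 1) * v - ln p) (al * v - ln q).
rewrite (ltW al0) (ltW al1) => /(_ isT); rewrite -expRD.
congr (_ <= _); first by congr expR; ring.
rewrite !expRD !expRN !lnK ?posrE//.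
by ring.
Qed.

(** For al > 1 the roles change: the integrand of the mu-mean is now interpolated between those of
    the Hellinger integral and of the nu-mean. *)
Lemma young_gt1 (al u v p q : R) : 1 < al -> 0 < p -> 0 < q ->
  expR (- (al^-1 * ln p) - (1 - al^-1) * ln q) * (expR u * expR ((al - 1) * v)) <=
  al^-1 / p * expR (al * u) + (1 - al^-1) / q * expR (al * v).
Proof.
move=> al1 p0 q0; have al0 : 0 < al by exact: lt_trans al1.
have al0' : al != 0 by rewrite gt_eqF.
have := @expR_convex R al^-1 (al * u - ln p) (al * v - ln q).
rewrite invr_ge0 (ltW al0) (invf_le1 al0) (ltW al1) => /(_ isT).
rewrite -!expRD; congr (_ <= _); first by congr expR; field.
rewrite !expRD !expRN !lnK ?posrE//.
by ring.
Qed.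

End norm_lemmas.

Section renyi.
Context (R : realType) d (T : measurableType d).
Variables (mu nu : probability T R) (f : T -> R) (M alpha : R) (n : nat).
Hypothesis fM : density_ratio mu nu f M.
Hypotheses (alpha_gt0 : 0 < alpha) (alpha_neq1 : alpha != 1) (n_gt0 : (0 < n)%N).
Local Notation b := (ln M).
Local Notation e := (`|alpha - 1|).
Local Notation P := (prodm (sample_law mu nu n) (n + n)).
Local Notation eX := (emp (@lshift n n)).
Local Notation eY := (emp (@rshift n n)).
Let kap := alpha / e.
Let K := expR (e * b).
Let K' := expR (alpha * b).

Definition renyi_h (g : T -> R) x := expR ((alpha - 1) * g x).
Definition renyi_w (g : T -> R) x := expR (alpha * g x).
Definition renyi_objective (g : T -> R) (t : (n + n).-tuple T) : R :=
  alpha / (alpha - 1) * ln (eX (renyi_h g) t) - ln (eY (renyi_w g) t).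
Definition hellinger := \int[nu]_x expR (alpha * ln (f x)).
Definition renyi_divergence := (alpha - 1)^-1 * ln hellinger.

Let e_gt0 : 0 < e. Proof. by rewrite normr_gt0 subr_eq0. Qed.
Let am1_neq0 : alpha - 1 != 0. Proof. by rewrite subr_eq0. Qed.
Let b_ge0 : 0 <= b := ratio_b_ge0 fM.
Let kap_gt0 : 0 < kap. Proof. exact: divr_gt0. Qed.
Let K_gt0 : 0 < K. Proof. exact: expR_gt0. Qed.
Let K'_gt0 : 0 < K'. Proof. exact: expR_gt0. Qed.

Lemma norm_renyi_factor : `|alpha / (alpha - 1)| = kap.
Proof. by rewrite normrM normfV gtr0_norm. Qed.

Let expR_scale_bounds (c : R) (g : T -> R) x : `|g x| <= b ->
  (expR (`|c| * b))^-1 <= expR (c * g x) <= expR (`|c| * b).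
Proof.
move=> gb; rewrite -expRN !ler_expR -ler_norml normrM.
by rewrite ler_wpM2l.
Qed.

Lemma renyi_h_bounds g x : `|g x| <= b -> K^-1 <= renyi_h g x <= K.
Proof. exact: expR_scale_bounds. Qed.

Lemma renyi_w_bounds g x : `|g x| <= b -> K'^-1 <= renyi_w g x <= K'.
Proof. by move/(expR_scale_bounds alpha); rewrite gtr0_norm. Qed.

Lemma bmeas_renyi_h g : bmeas g -> bmeas (renyi_h g).
Proof. by move=> bg; apply/bmeas_expR/bmeasZ. Qed.

Lemma bmeas_renyi_w g : bmeas g -> bmeas (renyi_w g).
Proof. by move=> bg; apply/bmeas_expR/bmeasZ. Qed.

Lemma emp_h_bounds g t : (forall x, `|g x| <= b) -> K^-1 <= eX (renyi_h g) t <= K.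
Proof.
move=> gb; rewrite (emp_cst_ge _ _ n_gt0) ?(emp_cst_le _ _ n_gt0)// => x;
  by have /andP[] := renyi_h_bounds (gb x).
Qed.

Lemma emp_w_bounds g t : (forall x, `|g x| <= b) -> K'^-1 <= eY (renyi_w g) t <= K'.
Proof.
move=> gb; rewrite (emp_cst_ge _ _ n_gt0) ?(emp_cst_le _ _ n_gt0)// => x;
  by have /andP[] := renyi_w_bounds (gb x).
Qed.

Lemma mean_h_bounds g : bmeas g -> (forall x, `|g x| <= b) ->
  K^-1 <= \int[mu]_x renyi_h g x <= K.
Proof.
move=> bg gb; have bh := bmeas_renyi_h bg; apply/andP; split.
  by apply: mean_ge_cst => // x; have /andP[] := renyi_h_bounds (gb x).
by apply: mean_le_cst => // x; have /andP[] := renyi_h_bounds (gb x).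
Qed.

Lemma mean_w_bounds g : bmeas g -> (forall x, `|g x| <= b) ->
  K'^-1 <= \int[nu]_x renyi_w g x <= K'.
Proof.
move=> bg gb; have bw := bmeas_renyi_w bg; apply/andP; split.
  by apply: mean_ge_cst => // x; have /andP[] := renyi_w_bounds (gb x).
by apply: mean_le_cst => // x; have /andP[] := renyi_w_bounds (gb x).
Qed.

Lemma bmeas_renyi_objective g : bmeas g -> (forall x, `|g x| <= b) ->
  bmeas (renyi_objective g).
Proof.
move=> bg gb; apply: bmeasB.
  apply: bmeasZ; apply: (bmeas_ln (l := K^-1)); rewrite ?invr_gt0//.
    by move=> t; have /andP[] := emp_h_bounds t gb.
  by apply/bmeas_emp/bmeas_renyi_h.
apply: (bmeas_ln (l := K'^-1)); rewrite ?invr_gt0//.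
  by move=> t; have /andP[] := emp_w_bounds t gb.
by apply/bmeas_emp/bmeas_renyi_w.
Qed.

Lemma renyi_log_lipschitz A A' B B' :
  K^-1 <= A -> K^-1 <= A' -> K'^-1 <= B -> K'^-1 <= B' ->
  `|(alpha / (alpha - 1) * ln A - ln B) - (alpha / (alpha - 1) * ln A' - ln B')| <=
  kap * K * `|A - A'| + K' * `|B - B'|.
Proof.
move=> KA KA' KB KB'.
have -> : (alpha / (alpha - 1) * ln A - ln B) - (alpha / (alpha - 1) * ln A' - ln B') =
  alpha / (alpha - 1) * (ln A - ln A') - (ln B - ln B') by ring.
apply: le_trans (ler_normB _ _) _; apply: lerD.
  rewrite normrM norm_renyi_factor -mulrA ler_wpM2l ?(ltW kap_gt0)//.
  by have := @ln_lipschitz R A A' K^-1; rewrite invrK; apply; rewrite ?invr_gt0.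
by have := @ln_lipschitz R B B' K'^-1; rewrite invrK; apply; rewrite ?invr_gt0.
Qed.

(** Lipschitz constant of each logarithm, kap K and K', times the size of the summands under it, K
    and K'. As K = M^|alpha - 1| and K' = M^alpha, these squares are the powers of M in the
    statement. *)
Definition renyi_weight := kap * K ^+ 2 + K' ^+ 2.
Let W := renyi_weight.

Lemma renyi_weight_gt0 : 0 < W.
Proof. exact: (addr_gt0 (mulr_gt0 kap_gt0 (exprn_gt0 2 K_gt0)) (exprn_gt0 2 K'_gt0)). Qed.

Lemma renyi_bounded_differences g : (forall x, `|g x| <= b) ->
  bounded_differences (fun=> 4 * W / n%:R) (renyi_objective g).
Proof.
move=> gb i t t' tt'.
have osc c (h : T -> R) : (forall x, 0 < h x <= c) -> forall x y, `|h x - h y| <= c.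
  move=> hc x y; have /andP[x0 xc] := hc x; have /andP[y0 yc] := hc y.
  by rewrite ler_norml; lra.
have h1 : `|eX (renyi_h g) t - eX (renyi_h g) t'| <= K / n%:R.
  apply: (emp_diff (@lshift_inj _ _) (ltW K_gt0) _ tt'); apply: osc => x.
  by rewrite expR_gt0; have /andP[] := renyi_h_bounds (gb x).
have h2 : `|eY (renyi_w g) t - eY (renyi_w g) t'| <= K' / n%:R.
  apply: (emp_diff (@rshift_inj _ _) (ltW K'_gt0) _ tt'); apply: osc => x.
  by rewrite expR_gt0; have /andP[] := renyi_w_bounds (gb x).
have /andP[A1 _] := emp_h_bounds t gb; have /andP[A2 _] := emp_h_bounds t' gb.
have /andP[B1 _] := emp_w_bounds t gb; have /andP[B2 _] := emp_w_bounds t' gb.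
apply: le_trans (ler_norm _) _.
apply: le_trans (renyi_log_lipschitz A1 A2 B1 B2) _.
apply: (@le_trans _ _ (kap * K * (K / n%:R) + K' * (K' / n%:R))).
  by apply: lerD; rewrite ler_wpM2l ?mulr_ge0// ltW.
have -> : kap * K * (K / n%:R) + K' * (K' / n%:R) = W / n%:R.
  by rewrite /W /renyi_weight; ring.
rewrite ler_wpM2r ?invr_ge0 ?ler0n//; have := renyi_weight_gt0; lra.
Qed.

Lemma hellinger_mu : hellinger = \int[mu]_x renyi_h (fun x => ln (f x)) x.
Proof.
rewrite (ratio_mean fM); last by apply: bmeas_renyi_h; exact: (bmeas_ln_ratio fM).
apply: eq_mean => x; rewrite -{2}[f x]lnK ?posrE ?(ratio_gt0 fM)//.
by rewrite /renyi_h -expRD; congr expR; ring.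
Qed.

Lemma hellinger_gt0 : 0 < hellinger.
Proof.
rewrite hellinger_mu; have /andP[+ _] := mean_h_bounds (bmeas_ln_ratio fM)
  (ratio_ln_bound fM).
by apply: lt_le_trans; rewrite invr_gt0.
Qed.

Let population (g : T -> R) :=
  alpha / (alpha - 1) * ln (\int[mu]_x renyi_h g x) - ln (\int[nu]_x renyi_w g x).

(* Hoelder's inequality, reversed for alpha < 1, as convexity of the
   exponential. *)
Lemma renyi_variational g : bmeas g -> (forall x, `|g x| <= b) ->
  population g <= renyi_divergence.
Proof.
move=> bg gb; have bl := bmeas_ln_ratio fM; have bf := ratio_bmeas fM.
have l0 := hellinger_gt0.
rewrite /population /renyi_divergence.
have bh := bmeas_renyi_h bg; have bw := bmeas_renyi_w bg.
have /andP[A0 _] := mean_h_bounds bg gb; have /andP[B0 _] := mean_w_bounds bg gb.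
set A := \int[mu]_x _ in A0 *; set B := \int[nu]_x _ in B0 *.
have {A0} A0 : 0 < A by apply: lt_le_trans A0; rewrite invr_gt0.
have {B0} B0 : 0 < B by apply: lt_le_trans B0; rewrite invr_gt0.
have AE : A = \int[nu]_x (f x * renyi_h g x) by rewrite /A (ratio_mean fM).
have bal : bmeas (fun x => expR (alpha * ln (f x))) by apply/bmeas_expR/bmeasZ.
have bfh : bmeas (fun x => f x * renyi_h g x) by exact: bmeasM.
have [a1|a1|a1] := ltgtP alpha 1; [| |by move: alpha_neq1; rewrite a1 eqxx].
- have conv x : expR (- (alpha * ln A) - (1 - alpha) * ln B) * expR (alpha * ln (f x)) <=
      alpha / A * (f x * renyi_h g x) + (1 - alpha) / B * renyi_w g x.
    have := young_lt1 (ln (f x)) (g x) alpha_gt0 a1 A0 B0.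
    by rewrite lnK ?posrE ?(ratio_gt0 fM).
  have : expR (- (alpha * ln A) - (1 - alpha) * ln B) * hellinger <= 1.
    rewrite -meanZ//; apply: le_trans (le_mean _ _ _ conv) _.
    - exact: bmeasZ.
    - by apply: bmeasD; exact: bmeasZ.
    rewrite meanD ?meanZ -?AE -/B//; try exact: bmeasZ.
    rewrite !divfK ?gt_eqF//; lra.
  rewrite -{1}[hellinger]lnK ?posrE// -expRD expR_le1 => H.
  have -> : alpha / (alpha - 1) * ln A - ln B =
    (alpha - 1)^-1 * (alpha * ln A + (1 - alpha) * ln B) by field.
  rewrite ler_nM2l ?invr_lt0 ?subr_lt0//.
  by move: H; move: (ln A) (ln B) (ln hellinger) => x y z; lra.
- have al0 : alpha != 0 by rewrite gt_eqF.
  have conv x : expR (- (alpha^-1 * ln hellinger) - (1 - alpha^-1) * ln B) *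
      (f x * renyi_h g x) <=
      alpha^-1 / hellinger * expR (alpha * ln (f x)) +
      (1 - alpha^-1) / B * renyi_w g x.
    have := young_gt1 (ln (f x)) (g x) a1 l0 B0.
    by rewrite lnK ?posrE ?(ratio_gt0 fM).
  have : expR (- (alpha^-1 * ln hellinger) - (1 - alpha^-1) * ln B) * A <= 1.
    rewrite AE -meanZ//; apply: le_trans (le_mean _ _ _ conv) _.
    - exact: bmeasZ.
    - by apply: bmeasD; exact: bmeasZ.
    rewrite meanD ?meanZ -/hellinger -/B//; try exact: bmeasZ.
    rewrite !divfK ?gt_eqF//; lra.
  rewrite -{1}[A]lnK ?posrE// -expRD expR_le1 => H.
  have a10 : 0 < alpha - 1 by rewrite subr_gt0.
  have -> : alpha / (alpha - 1) * ln A - ln B =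
    (alpha - 1)^-1 * (alpha * ln A - (alpha - 1) * ln B) by field.
  rewrite ler_pM2l ?invr_gt0//.
  have := ler_wpM2l (ltW alpha_gt0) H; rewrite mulr0.
  move: (ln A) (ln B) (ln hellinger) => x y z.
  have -> : alpha * (- (alpha^-1 * z) - (1 - alpha^-1) * y + x) =
    - z - (alpha - 1) * y + alpha * x by field.
  lra.
Qed.

(** The bias does not grow with alpha: replacing ln f by g moves ln A by at most |alpha - 1| delta,
    which the prefactor 1 / (alpha - 1) cancels, and comparing B with A costs one more delta, since
    exp(alpha g) <= exp(delta) f exp((alpha - 1) g). *)
Lemma renyi_approximation g delta : bmeas g -> (forall x, `|g x| <= b) ->
  (forall x, `|ln (f x) - g x| <= delta) ->
  renyi_divergence - 2 * delta <= population g.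
Proof.
move=> bg gb fg; have bl := bmeas_ln_ratio fM; have bf := ratio_bmeas fM.
have l0 := hellinger_gt0.
rewrite /population /renyi_divergence.
have bh := bmeas_renyi_h bg; have bw := bmeas_renyi_w bg.
have /andP[A0 _] := mean_h_bounds bg gb; have /andP[B0 _] := mean_w_bounds bg gb.
set A := \int[mu]_x _ in A0 *; set B := \int[nu]_x _ in B0 *.
have {A0} A0 : 0 < A by apply: lt_le_trans A0; rewrite invr_gt0.
have {B0} B0 : 0 < B by apply: lt_le_trans B0; rewrite invr_gt0.
have AE : A = \int[nu]_x (f x * renyi_h g x) by rewrite /A (ratio_mean fM).
have BA : ln B <= delta + ln A.
  have : B <= expR delta * A.
    rewrite AE -meanZ; last exact: bmeasM.
    apply: le_mean => //; first by apply: bmeasZ; exact: bmeasM.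
    move=> x; rewrite -{1}[f x]lnK ?posrE ?(ratio_gt0 fM)//.
    rewrite /renyi_w /renyi_h -!expRD ler_expR.
    by have := fg x; rewrite ler_norml; lra.
  move=> H; have E0 : 0 < expR delta by exact: expR_gt0.
  by rewrite -[X in X + _]expRK -lnM ?posrE// ler_ln ?posrE ?mulr_gt0.
have Ah : `|ln A - ln hellinger| <= e * delta.
  have hb := bmeas_renyi_h bl.
  have sd x : `|(alpha - 1) * (ln (f x) - g x)| <= e * delta.
    by rewrite normrM ler_wpM2l.
  have h1 : A <= expR (e * delta) * hellinger.
    rewrite hellinger_mu -meanZ//; apply: le_mean => //; first exact: bmeasZ.
    move=> x; rewrite /renyi_h -expRD ler_expR.
    by have := sd x; rewrite ler_norml; lra.
  have h2 : hellinger <= expR (e * delta) * A.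
    rewrite hellinger_mu -meanZ//; apply: le_mean => //; first exact: bmeasZ.
    move=> x; rewrite /renyi_h -expRD ler_expR.
    by have := sd x; rewrite ler_norml; lra.
  have E0 : 0 < expR (e * delta) by exact: expR_gt0.
  apply: ler_norm_sub.
    by rewrite -[X in X + _]expRK -lnM ?posrE// ler_ln ?posrE ?mulr_gt0.
  by rewrite -[X in X + _]expRK -lnM ?posrE// ler_ln ?posrE ?mulr_gt0.
have h : `|(alpha - 1)^-1 * ln A - (alpha - 1)^-1 * ln hellinger| <= delta.
  rewrite -mulrBr.
  rewrite normrM normfV -[leRHS](mulKf (lt0r_neq0 e_gt0)).
  by rewrite ler_wpM2l ?invr_ge0.
(* One copy of ln A is set aside to be compared with ln B. *)
have -> : alpha / (alpha - 1) * ln A = (alpha - 1)^-1 * ln A + ln A by field.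
exact: ler_norm_sub2 h BA.
Qed.

(* The second integrand of [single_deviation] and [two_sample_deviation] is 0
   when only one of the two samples is involved. *)
Lemma renyi_lower g delta z B X : bmeas g -> (forall x, `|g x| <= b) ->
  (forall x, `|ln (f x) - g x| <= delta) -> 600 <= B -> W <= X -> 0 <= z ->
  (P [set t | (renyi_objective g t <= renyi_divergence - 2 * delta -
       B * X * ((Num.sqrt n%:R)^-1 + z))%R] <=
    (expR (- (n%:R * z ^+ 2)))%:E)%E.
Proof.
move=> bg gb fg B1 WX z0; have W0 := renyi_weight_gt0.
apply: (lower_tail_bound n_gt0 (W := W)) => //.
- exact: bmeas_renyi_objective.
- lra.
- exact: renyi_bounded_differences.
have bh := bmeas_renyi_h bg; have bw := bmeas_renyi_w bg.
have bE : bmeas (renyi_objective g) by exact: bmeas_renyi_objective.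
have bX : bmeas (fun t => `|eX (renyi_h g) t - \int[mu]_x renyi_h g x|).
  by apply/bmeas_norm/bmeasB; [exact: bmeas_emp | exact: bmeas_cst].
have bY : bmeas (fun t => `|eY (renyi_w g) t - \int[nu]_x renyi_w g x|).
  by apply/bmeas_norm/bmeasB; [exact: bmeas_emp | exact: bmeas_cst].
have b0 := bmeas_cst T (0 : R).
have hK x : `|renyi_h g x| <= K.
  by rewrite ger0_norm ?expR_ge0//; have /andP[] := renyi_h_bounds (gb x).
have wK x : `|renyi_w g x| <= K'.
  by rewrite ger0_norm ?expR_ge0//; have /andP[] := renyi_w_bounds (gb x).
have emp0 (iota : 'I_n -> 'I_(n + n)) t : emp iota (fun _ : T => 0 : R) t = 0.
  by rewrite /emp big1 ?mulr0.
pose s : R := Num.sqrt n%:R.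
have hX : \int[P]_t `|eX (renyi_h g) t - \int[mu]_x renyi_h g x| <= 300 * (K + K) / s.
  rewrite (@eq_mean _ _ _ _ _ (fun t => `|(eX (renyi_h g) t - \int[mu]_x renyi_h g x) +
      (eY (fun _ : T => 0) t - \int[nu]_(x in setT) 0)|)); last first.
    by move=> t; rewrite emp0 mean_cst subrr addr0.
  by apply: single_deviation => // x; rewrite normr0 ltW.
have hY : \int[P]_t `|eY (renyi_w g) t - \int[nu]_x renyi_w g x| <= 300 * (K' + K') / s.
  rewrite (@eq_mean _ _ _ _ _ (fun t => `|(eX (fun _ : T => 0) t - \int[mu]_(x in setT) 0) +
      (eY (renyi_w g) t - \int[nu]_x renyi_w g x)|)); last first.
    by move=> t; rewrite emp0 mean_cst subrr add0r.
  by apply: single_deviation => // x; rewrite normr0 ltW.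
have : \int[P]_t (population g - (kap * K * `|eX (renyi_h g) t - \int[mu]_x renyi_h g x| +
     K' * `|eY (renyi_w g) t - \int[nu]_x renyi_w g x|)) <=
     \int[P]_t renyi_objective g t.
  apply: le_mean => //.
    by apply: bmeasB; [exact: bmeas_cst | apply: bmeasD; exact: bmeasZ].
  move=> t; have /andP[A1 _] := emp_h_bounds t gb; have /andP[B2 _] := emp_w_bounds t gb.
  have /andP[A1' _] := mean_h_bounds bg gb; have /andP[B2' _] := mean_w_bounds bg gb.
  have := renyi_log_lipschitz A1 A1' B2 B2'.
  rewrite -/(population g) -/(renyi_objective g t) ler_norml; lra.
apply: le_trans; rewrite meanB; last 2 first.
- exact: bmeas_cst.
- by apply: bmeasD; exact: bmeasZ.
rewrite mean_cst meanD; [|exact: bmeasZ|exact: bmeasZ]; rewrite !meanZ//.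
apply: lerB; first exact: renyi_approximation.
apply: (@le_trans _ _ (kap * K * (300 * (K + K) / s) + K' * (300 * (K' + K') / s))).
  by apply: lerD; apply: ler_wpM2l => //; rewrite ?mulr_ge0// ltW.
have -> : kap * K * (300 * (K + K) / s) + K' * (300 * (K' + K') / s) = 600 * W / s.
  by rewrite /W /renyi_weight; ring.
rewrite ler_wpM2r ?invr_ge0 ?sqrtr_ge0//.
exact: (ler_pM (ler0n _ 600) (ltW W0) B1 WX).
Qed.

End renyi.

(** * A Lipschitz minorant of the exponential *)

Section truncated_exponential.
Context (R : realType).
Implicit Types eta v u : R.

(* The exponential exp(- eta v), replaced for negative v with its tangent at 0:
   a minorant with Lipschitz constant of order eta. *)
Definition psi eta v : R :=
  expR (- (eta * Num.max v 0)) + eta * Num.max (- v) 0.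

Lemma psi_ge0 eta v : 0 <= eta -> 0 <= psi eta v.
Proof.
by move=> e0; rewrite addr_ge0 ?expR_ge0// mulr_ge0// le_max lexx orbT.
Qed.

Lemma psi_pos eta v : 0 <= v -> psi eta v = expR (- (eta * v)).
Proof.
move=> v0; rewrite /psi (max_idPl v0) (max_idPr _) ?mulr0 ?addr0//.
by rewrite oppr_le0.
Qed.

Lemma psi_neg eta v : v <= 0 -> psi eta v = 1 - eta * v.
Proof.
move=> v0; rewrite /psi (max_idPr v0) (max_idPl _) ?oppr_ge0//.
by rewrite mulr0 oppr0 expR0 mulrN.
Qed.

Lemma psi_le_expR eta v : psi eta v <= expR (- (eta * v)).
Proof.
case: (leP 0 v) => [/psi_pos ->//|/ltW/psi_neg ->].
by have := expR_ge1Dx (- (eta * v)).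
Qed.

(** Linear growth for negative v is what makes the envelope of the sliced process polynomial in b
    instead of exponential. *)
Lemma psi_le eta v : 0 <= eta -> psi eta v <= 1 + eta * `|v|.
Proof.
move=> e0; case: (leP 0 v) => v0.
  rewrite psi_pos// (ger0_norm v0); apply: (@le_trans _ _ 1).
    by rewrite expR_le1 oppr_le0 mulr_ge0.
  by rewrite lerDl mulr_ge0.
by rewrite psi_neg ?(ltW v0)// ltr0_norm// mulrN.
Qed.

Lemma psi_lipschitz eta u v : 0 <= eta ->
  `|psi eta u - psi eta v| <= 2 * eta * `|u - v|.
Proof.
move=> e0.
have maxlip (x y : R) : `|Num.max x 0 - Num.max y 0| <= `|x - y|.
  by case: (leP x 0) => hx; case: (leP y 0) => hy; rewrite !ler_norml;
    case: (leP 0 (x - y)) => h; rewrite ?(ger0_norm h) ?(ltr0_norm h); apply/andP; split; lra.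
have -> : psi eta u - psi eta v =
  (expR (- (eta * Num.max u 0)) - expR (- (eta * Num.max v 0))) +
  eta * (Num.max (- u) 0 - Num.max (- v) 0) by rewrite /psi; ring.
have max0 x : - (eta * Num.max x 0) <= 0 by rewrite oppr_le0 mulr_ge0// le_max lexx orbT.
apply: le_trans (ler_normD _ _) _.
have -> : 2 * eta * `|u - v| = eta * `|u - v| + eta * `|u - v| by ring.
apply: lerD.
  apply: le_trans (expR_lipschitz (max0 _) (max0 _)) _; rewrite expR0 mul1r.
  have -> : - (eta * Num.max u 0) - - (eta * Num.max v 0) =
    - (eta * (Num.max u 0 - Num.max v 0)) by ring.
  by rewrite normrN normrM (ger0_norm e0) ler_wpM2l.
rewrite normrM (ger0_norm e0) ler_wpM2l//; apply: le_trans (maxlip _ _) _.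
by rewrite -opprD normrN.
Qed.

(** With the true exponential in place of [psi] this is 1 + x <= exp x used twice, the linear terms
    cancelling because al / eta times eta is al. For v < 0 the tangent still suffices: (1 + eta
    tau)(1 - eta v) exceeds the linear bound by eta^2 tau (- v), which is nonnegative as tau >=
    0. *)
Let psi_young eta al v tau : 0 < eta -> 0 < al -> al + eta = 1 -> 0 <= tau <= 1 ->
  1 + al / eta <= al / eta * (expR (eta * tau) * psi eta v) + expR (al * (v - tau)).
Proof.
move=> e0 al0 ale /andP[t0 t1]; set k := al / eta.
have k0 : 0 <= k by rewrite divr_ge0// ltW.
have ke : k * eta = al by rewrite /k divfK// gt_eqF.
have h2 : 1 + al * (v - tau) <= expR (al * (v - tau)) by exact: expR_ge1Dx.
case: (leP 0 v) => v0.
  rewrite psi_pos// -expRD.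
  have h1 : 1 + eta * (tau - v) <= expR (eta * tau + - (eta * v)).
    by rewrite -mulrN -mulrDr; exact: expR_ge1Dx.
  have := ler_wpM2l k0 h1; rewrite mulrDr mulr1 mulrA ke; lra.
rewrite psi_neg ?(ltW v0)//.
have h1 : 1 + eta * tau <= expR (eta * tau) by exact: expR_ge1Dx.
have p0 : 0 <= 1 - eta * v by nra.
have := ler_wpM2l k0 (ler_wpM2r p0 h1).
have -> : k * ((1 + eta * tau) * (1 - eta * v)) =
  k + (k * eta) * (tau - v) + (k * eta) * eta * (tau * - v) by ring.
rewrite ke; have : 0 <= al * eta * (tau * - v).
  by rewrite mulr_ge0// ?mulr_ge0// ?oppr_ge0 ltW.
lra.
Qed.

(** [psi_young] at v = g - lf - j and tau = c - j. The function inside [psi] depends on the slice j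
    but not on c, so finitely many processes cover all values of the random c. *)
Lemma psi_local_inequality (eta al lf g c j : R) :
  0 < eta -> 0 < al -> al + eta = 1 -> j <= c -> c <= j + 1 ->
  (1 + al / eta) * expR (- (eta * c)) * expR (- (eta * lf)) <=
  al / eta * (expR (- (eta * j)) * (expR (- (eta * lf)) * psi eta (g - lf - j))) +
  expR (- c) * (expR (- lf) * expR (al * g)).
Proof.
move=> e0 al0 ale jc cj.
have tau : 0 <= c - j <= 1 by apply/andP; split; lra.
have := psi_young (g - lf - j) e0 al0 ale tau.
set E := expR (- (eta * c)) * expR (- (eta * lf)).
have E0 : 0 <= E by rewrite mulr_ge0// expR_ge0.
move/(ler_wpM2r E0); congr (_ <= _); first by rewrite mulrA.
have e1 : expR (- (eta * j)) = expR (- (eta * c)) * expR (eta * (c - j)).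
  by rewrite -expRD; congr expR; ring.
have e2 : expR (- c) * (expR (- lf) * expR (al * g)) =
    expR (al * (g - lf - j - (c - j))) * E.
  rewrite /E -!expRD; congr expR; have -> : eta = 1 - al by rewrite -ale; ring.
  by ring.
by rewrite e1 e2 mulrDl /E; ring.
Qed.

End truncated_exponential.

(** * Absorbing powers and polynomials of b *)

Section power_inequalities.
Context (R : realType).
Implicit Types s a b al : R.

Lemma powR_le1D s a : 0 <= s -> 0 < a < 1 -> s `^ a <= 1 + s.
Proof.
move=> s0 /andP[a0 a1]; case: (leP s 1) => s1.
  have : s `^ a <= 1 `^ a by rewrite ge0_ler_powR ?nnegrE// ltW.
  by rewrite powR1; lra.
have : s `^ a <= s `^ 1 by rewrite ler_powR// ltW.
by rewrite powRr1//; lra.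
Qed.

(* The excess of [s `^ a] over [s `^ (a / 2)] in the crude bound is absorbed by
   the second summand, except for small al. *)
Lemma crude_absorption (al a b : R) : 3 / 4 <= al -> al != 1 -> 0 < a < 1 -> 0 <= b ->
  al / `|al - 1| * expR (`|al - 1| * b) ^+ 2 * (1 + (`|al - 1| * b) `^ a) +
    expR (al * b) ^+ 2 * (1 + (al * b) `^ a) <=
  4 * (al / `|al - 1| * expR (`|al - 1| * b) ^+ 2 * (1 + (`|al - 1| * b) `^ (a / 2)) +
    expR (al * b) ^+ 2 * (1 + (al * b) `^ a)).
Proof.
move=> al34 al1 a01 b0; set k := al / _; set s := `|al - 1| * b.
set K2 := expR s ^+ 2; set K2' := expR (al * b) ^+ 2.
have e0 : 0 < `|al - 1| by rewrite normr_gt0 subr_eq0.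
have al0 : 0 < al by lra.
have k0 : 0 < k by rewrite divr_gt0.
have s0 : 0 <= s by rewrite mulr_ge0// ltW.
have K20 : 0 < K2 by rewrite exprn_gt0// expR_gt0.
have K20' : 0 < K2' by rewrite exprn_gt0// expR_gt0.
have p1 : 0 <= s `^ (a / 2) by exact: powR_ge0.
have p2 : 0 <= (al * b) `^ a by exact: powR_ge0.
have p3 : 0 <= s `^ a by exact: powR_ge0.
have kK : 0 <= k * K2 by rewrite mulr_ge0// ltW.
have kKp : 0 <= k * K2 * s `^ (a / 2) by rewrite mulr_ge0.
have Kp : 0 <= K2' * (al * b) `^ a by rewrite mulr_ge0// ltW.
suff : k * K2 * s `^ a <= k * K2 + 2 * (K2' * (1 + (al * b) `^ a)).
  by rewrite !mulrDr !mulr1; lra.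
(* For al >= 2 the second summand dominates factor by factor. For smaller al, s^a <= 1 + s, and the
   factor |al - 1| in s cancels the denominator of k, leaving al b. *)
have [al2|al2] := leP 2 al.
  have ae : `|al - 1| = al - 1 by rewrite ger0_norm//; lra.
  have k2 : k <= 2 by rewrite /k ae ler_pdivrMr; lra.
  have K22 : K2 <= K2'.
    rewrite ler_pXn2r ?nnegrE ?expR_ge0// ler_expR /s ae ler_wpM2r//; lra.
  have sa : s `^ a <= (al * b) `^ a.
    have /andP[a0 _] := a01.
    rewrite ge0_ler_powR ?nnegrE ?(ltW a0) ?(mulr_ge0 (ltW al0) b0)//.
    by rewrite /s ae ler_wpM2r//; lra.
  have : k * K2 * s `^ a <= 2 * K2' * (al * b) `^ a.
    exact: (ler_pM kK p3 (ler_pM (ltW k0) (ltW K20) k2 K22) sa).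
  by rewrite mulrDr mulr1; lra.
have sa := powR_le1D s0 a01.
apply: (@le_trans _ _ (k * K2 * (1 + s))); first by rewrite ler_wpM2l.
rewrite mulrDr mulr1 lerD2l.
have ks : k * s = al * b.
  by rewrite /k /s; field; rewrite gt_eqF.
have bE : b <= expR b by have := expR_ge1Dx b; lra.
have K2b : K2 * expR b <= K2'.
  rewrite /K2 /K2' -!expRM_natl -expRD ler_expR /s.
  (* For al < 1 this says exactly al >= 3/4: the origin of the threshold between the two regimes. *)
  have : 2 * `|al - 1| + 1 <= 2 * al.
    by case: (ger0P (al - 1)) => h; lra.
  by move/(ler_wpM2r b0); rewrite mulrDl mul1r !mulrA.
have : K2 * (al * b) <= 2 * (K2 * expR b).
  rewrite mulrCA; apply: ler_pM; rewrite ?mulr_ge0 ?(ltW al0) ?(ltW K20)//.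
    exact: ltW.
  by rewrite ler_wpM2l ?(ltW K20).
have -> : k * K2 * s = K2 * (al * b) by rewrite -ks; ring.
by rewrite mulrDr mulr1; lra.
Qed.

(** The left side is the price of slicing: a normalising factor, 1 + 2 b slices, the envelope 1 + 3
    b and the root of the second moment. Once the polynomial is traded for exp(b/2), the exponents
    stay below 2 (1 - al) b for al <= 1/2 and below 2 al b beyond, with equality at al = 1/2. The
    constant is 4 * 96 * 3, from e <= 4, the polynomial and k <= 3. *)
Lemma local_absorption (al b : R) : 0 < al -> al < 3 / 4 -> 0 <= b ->
  al / (1 - al) * expR (1 + 2 * al * (1 - al) * b) *
    ((1 + 2 * b) * (1 + 3 * b) * expR (`|2 * al - 1| * b / 2)) <=
  1152 * (al / (1 - al) * expR ((1 - al) * b) ^+ 2 + expR (al * b) ^+ 2).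
Proof.
move=> al0 al34 b0; set k := al / (1 - al).
have e0 : 0 < 1 - al by lra.
have k0 : 0 < k by rewrite divr_gt0.
have k3 : k <= 3 by rewrite /k ler_pdivrMr//; lra.
have e4 : expR 1 <= 4 :> R.
  have : expR (2^-1) <= 2 :> R.
    rewrite -[leLHS]invrK -expRN invf_ple ?posrE ?expR_gt0//.
    by apply: le_trans (expR_ge1Dx _); lra.
  move=> h; have -> : 1 = 2^-1 + 2^-1 :> R by lra.
  rewrite expRD; have : expR 2^-1 * expR 2^-1 <= 2 * 2 :> R.
    by apply: ler_pM => //; exact: expR_ge0.
  by lra.
(* As exp(b/2) >= (1 + b/4)^2, the constant must be at least 6 * 16 = 96 to match the coefficient of
   b^2. *)
have poly : (1 + 2 * b) * (1 + 3 * b) <= 96 * expR (b / 2).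
  have h : 1 + b / 4 <= expR (b / 4) by exact: expR_ge1Dx.
  have -> : b / 2 = b / 4 + b / 4 by field.
  have : (1 + b / 4) * (1 + b / 4) <= expR (b / 4) * expR (b / 4).
    by apply: ler_pM => //; lra.
  by rewrite expRD; nra.
have ex (x : R) : expR (x * b) ^+ 2 = expR (2 * x * b) by rewrite -expRM_natl mulrA.
rewrite !ex; set E := expR (`|2 * al - 1| * b / 2).
have E0 : 0 < E by exact: expR_gt0.
apply: (@le_trans _ _ (k * (4 * expR (2 * al * (1 - al) * b)) * (96 * expR (b / 2) * E))).
  apply: ler_pM.
  - by rewrite mulr_ge0 ?(ltW k0) ?expR_ge0.
  - by rewrite mulr_ge0 ?(ltW E0)//; nra.
  - rewrite ler_wpM2l ?(ltW k0)// expRD ler_wpM2r ?expR_ge0//.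
  - by rewrite ler_wpM2r ?(ltW E0).
have -> : k * (4 * expR (2 * al * (1 - al) * b)) * (96 * expR (b / 2) * E) =
    384 * (k * expR (2 * al * (1 - al) * b + b / 2 + `|2 * al - 1| * b / 2)).
  by rewrite /E !expRD; ring.
set Q := expR (_ + _ + _).
have KQ1 : 0 <= k * expR (2 * (1 - al) * b) by rewrite mulr_ge0 ?(ltW k0) ?expR_ge0.
have KQ2 := expR_ge0 (2 * al * b).
have [h|h] := leP al (1 / 2).
  have : Q <= expR (2 * (1 - al) * b).
    rewrite ler_expR ler0_norm; last lra.
    have -> : 2 * al * (1 - al) * b + b / 2 + - (2 * al - 1) * b / 2 =
      (1 + al - 2 * al ^+ 2) * b by field.
    by rewrite ler_wpM2r//; nra.
  by move/(ler_wpM2l (ltW k0)); lra.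
have : Q <= expR (2 * al * b).
  rewrite ler_expR gtr0_norm; last lra.
  have -> : 2 * al * (1 - al) * b + b / 2 + (2 * al - 1) * b / 2 =
    (3 * al - 2 * al ^+ 2) * b by field.
  by rewrite ler_wpM2r//; nra.
move=> HQ; have : k * Q <= 3 * expR (2 * al * b).
  by apply: ler_pM => //; [exact: ltW | exact: expR_ge0].
lra.
Qed.

Lemma sqr_double_le (x : R) : x ^+ 2 + x ^+ 2 <= (2 * x) ^+ 2.
Proof. by rewrite exprMn; have := sqr_ge0 x; lra. Qed.

Lemma constant_2400 : 2400 <= 10 ^+ 7 :> R.
Proof. by rewrite !exprS expr0; lra. Qed.

(** The sliced regime costs 1200 * 1152 for the first sample and 600 for the second; the crude
    regime costs 600 * 4 = 2400. A power of ten above both serves as the common constant. *)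
Lemma constant_1383000 : 1200 * 1152 + 600 <= 10 ^+ 7 :> R.
Proof. by rewrite !exprS expr0; lra. Qed.

End power_inequalities.

Lemma emp_le_scale (R : realType) d (T : measurableType d) N n
    (iota : 'I_n -> 'I_N) (h h' : T -> R) (c : R) t :
  (forall x, h x <= c * h' x) -> emp iota h t <= c * emp iota h' t.
Proof.
move=> hh; rewrite /emp mulrCA ler_wpM2l ?invr_ge0// mulr_sumr.
by apply: ler_sum => i _; exact: hh.
Qed.

Lemma bmeas_psi (R : realType) d (T : measurableType d) (eta : R) (v : T -> R) :
  bmeas v -> bmeas (fun x => psi eta (v x)).
Proof.
move=> bv; have b0 := bmeas_cst T (0 : R); apply: bmeasD.
  by apply/bmeas_expR/bmeasN/bmeasZ/bmeas_max.
by apply/bmeasZ/bmeas_max => //; exact: bmeasN.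
Qed.

(* A linearisation of the Renyi objective at the empirical values of its two
   logarithms, exact in the limit of a vanishing slice width. *)
Lemma local_linearization (R : realType) (eta al b lA lB lam j Ephi ephi Ew dev dY : R) :
  let k := al / eta in let c := lB - lA in
  0 < eta -> 0 < al -> al + eta = 1 -> 0 < lam -> j <= c -> c <= j + 1 ->
  - (eta * b) <= lA -> - (al * b) <= lB ->
  (1 + k) * expR (- (eta * c)) * lam <= k * (expR (- (eta * j)) * Ephi) + expR (- c) * Ew ->
  ephi <= expR (eta * j) * expR lA ->
  Ephi <= ephi + dev -> Ew <= expR lB + dY -> 0 <= dev -> 0 <= dY ->
  - k * lA - lB + eta^-1 * ln lam <= k * expR (1 + 2 * al * eta * b) * dev + expR (al * b) * dY.
Proof.
move=> k c e0 al0 ale lam0 jc cj lAb lBb H1 H2 H3 H4 dev0 dY0.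
have k0 : 0 < k by rewrite divr_gt0.
have e1 : eta <= 1 by lra.
(* P and exp(- lB) normalise the two terms on the right of the slice inequality to at most k and 1
   up to the deviations; U is the exponent for which (1 + k) U is the excess to be bounded, so U <=
   exp U - 1 finishes. *)
pose P := expR (- (eta * j) - lA).
pose U := - (eta * c) - lA + ln lam.
have P0 : 0 <= P by exact: expR_ge0.
(* Since - eta j <= - eta c + eta, the exponent is at most eta - eta lB - al lA: the 1 is the width
   of a slice, and each logarithm contributes al eta b. *)
have PB : P <= expR (1 + 2 * al * eta * b).
  rewrite ler_expR; have -> : al = 1 - eta by lra.
  have h1 := ler_wpM2l (ltW e0) cj; have h2 := ler_wpM2l (ltW e0) lBb.
  have h3 := ler_wpM2l (ltW al0) lAb; rewrite /c in h1; have alE : al = 1 - eta by lra.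
  rewrite alE in h2 h3; lra.
have BB : expR (- lB) <= expR (al * b) by rewrite ler_expR; lra.
have Pe : P * ephi <= 1.
  apply: le_trans (ler_wpM2l P0 H2) _.
  by rewrite /P -!expRD (_ : _ - _ + _ = 0) ?expR0//; ring.
have UH : (1 + k) * expR U <= k * (P * Ephi) + expR (- lB) * Ew.
  have := ler_wpM2r (expR_ge0 (- lA)) H1; congr (_ <= _).
    by rewrite /U !expRD lnK ?posrE//; ring.
  rewrite /P expRD; have -> : expR (- lB) = expR (- c) * expR (- lA).
    by rewrite -expRD; congr expR; rewrite /c; ring.
  by ring.
have U1 : U <= expR U - 1 by have := expR_ge1Dx U; lra.
have h1 := ler_wpM2l (ltW k0) (ler_wpM2l P0 H3).
have h2 := ler_wpM2l (expR_ge0 (- lB)) H4.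
have h3 : expR (- lB) * expR lB = 1 by rewrite -expRD addNr expR0.
have h4 := ler_wpM2l (ltW k0) Pe.
have k1 : 0 <= 1 + k by rewrite addr_ge0// ltW.
have h5 := ler_wpM2l k1 U1.
have h6 : k * (P * dev) <= k * expR (1 + 2 * al * eta * b) * dev.
  by rewrite -mulrA ler_wpM2l ?(ltW k0)// ler_wpM2r.
have h7 : expR (- lB) * dY <= expR (al * b) * dY by rewrite ler_wpM2r.
have -> : - k * lA - lB + eta^-1 * ln lam = (1 + k) * U.
  rewrite /k /U /c; have -> : al = 1 - eta by lra.
  by field; rewrite gt_eqF.
rewrite mulrDr in h1; rewrite mulrDr in h1; rewrite mulrDr h3 in h2.
apply: le_trans h5 _; rewrite mulrBr mulr1.
move: UH h1 h2 h4 h6 h7; move: (expR U) (expR _ * Ew) (expR (- lB) * dY) => u w y.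
move: (k * (P * Ephi)) (k * (P * ephi)) (k * (P * dev)) (k * _ * dev) (expR _ * dY).
by move=> *; lra.
Qed.

(** * Upper deviation of the Renyi estimator *)

Section renyi_upper.
Context (R : realType) d (T : measurableType d).
Variables (mu nu : probability T R) (f : T -> R) (M alpha : R) (n m : nat).
Hypothesis fM : density_ratio mu nu f M.
Hypotheses (alpha_gt0 : 0 < alpha) (alpha_neq1 : alpha != 1) (n_gt0 : (0 < n)%N).
Variables (g : 'I_m.+1 -> T -> R) (chat a : R).
Local Notation b := (ln M).
Hypotheses (bg : forall k, bmeas (g k)) (gb : forall k x, `|g k x| <= b).
Hypotheses (ent : entropy_bound g chat b a) (chat_ge0 : 0 <= chat) (a01 : 0 < a < 1).
Local Notation e := (`|alpha - 1|).
Local Notation P := (prodm (sample_law mu nu n) (n + n)).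
Local Notation eX := (emp (@lshift n n)).
Local Notation eY := (emp (@rshift n n)).
Local Notation obj := (@renyi_objective R d T alpha n).
Local Notation D := (renyi_divergence nu f alpha).
Let kap := alpha / e.
Let K := expR (e * b).
Let K' := expR (alpha * b).
Let B := Num.max 1 (Num.sqrt chat / (1 - a)).
Let s := Num.sqrt n%:R : R.

Let e_gt0 : 0 < e. Proof. by rewrite normr_gt0 subr_eq0. Qed.
Let b_ge0 : 0 <= b := ratio_b_ge0 fM.
Let a_lt1 : a < 1. Proof. by case/andP: a01. Qed.
Let kap_gt0 : 0 < kap. Proof. exact: divr_gt0. Qed.
Let K_gt0 : 0 < K. Proof. exact: expR_gt0. Qed.
Let K'_gt0 : 0 < K'. Proof. exact: expR_gt0. Qed.
Let B_ge1 : 1 <= B. Proof. by rewrite le_max lexx. Qed.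
Let B_ge0 : 0 <= B := le_trans ler01 B_ge1.
Let s_ge0 : 0 <= s. Proof. exact: sqrtr_ge0. Qed.
Let bobj k : bmeas (obj (g k)).
Proof. exact: bmeas_renyi_objective. Qed.

Lemma bmeas_deviation (iota : 'I_n -> 'I_(n + n)) (p : probability T R)
    (phi : 'I_m.+1 -> T -> R) : (forall k, bmeas (phi k)) ->
  bmeas (fun t => maxabs (fun k => emp iota (phi k) t - \int[p]_x phi k x)).
Proof.
move=> bphi; apply: (@bmeas_maxabs _ _ _ _ (fun k t =>
  emp iota (phi k) t - \int[p]_x phi k x)) => k.
by apply: bmeasB; [exact: bmeas_emp | exact: bmeas_cst].
Qed.

(** Lipschitz constant |c| N against envelope N gives L = |c| b, hence the a-th power of |c| b. Each
    sample is isolated by a zero integrand on the other. *)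
Lemma exp_class_deviation (c : R) : c != 0 ->
  let phi k x := expR (c * g k x) in
  let U := 600 * (expR (`|c| * b) * (B * (1 + (`|c| * b) `^ a))) / s in
  \int[P]_t maxabs (fun k => eX (phi k) t - \int[mu]_x phi k x) <= U /\
  \int[P]_t maxabs (fun k => eY (phi k) t - \int[nu]_x phi k x) <= U.
Proof.
move=> c0 phi U; set N := expR (`|c| * b) in U *.
have N0 : 0 < N by exact: expR_gt0.
have v2 : \int[mu]_(x in setT) (N ^+ 2) + \int[nu]_(x in setT) (N ^+ 2) <= (2 * N) ^+ 2.
  by rewrite !mean_cst; exact: sqr_double_le.
have nc0 : 0 < `|c| by rewrite normr_gt0.
have cb0 : 0 <= `|c| * b by rewrite mulr_ge0.
have bphi k : bmeas (phi k) by apply/bmeas_expR/bmeasZ.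
have b0 := bmeas_cst T (0 : R).
have bN := bmeas_cst T N.
have cg k x : c * g k x <= `|c| * b.
  by apply: le_trans (ler_norm _) _; rewrite normrM ler_wpM2l// ltW.
have phiN k x : `|phi k x| <= N by rewrite ger0_norm ?expR_ge0// ler_expR.
have phil k l x : `|phi k x - phi l x| <= `|c| * N * `|g k x - g l x|.
  apply: le_trans (expR_lipschitz (cg k x) (cg l x)) _.
  by rewrite -mulrBr normrM -/N mulrCA mulrA.
have zN (k : 'I_m.+1) (x : T) : `|0 : R| <= N by rewrite normr0 ltW.
have zl k l x : `|0 - 0 : R| <= `|c| * N * `|g k x - g l x|.
  by rewrite subrr normr0 !mulr_ge0// ltW.
have q0 (x : T) : 0 < `|c| * N by rewrite mulr_gt0.
have qb (x : T) : `|c| * N * b <= N * (`|c| * b).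
  by rewrite mulrCA mulrA.
have N20 : 0 < 2 * N by rewrite mulr_gt0.
have UE : 300 * (2 * N) * (1 + Num.sqrt chat * (`|c| * b) `^ a / (1 - a)) / s <= U.
  rewrite /U ler_wpM2r ?invr_ge0//.
  have h := entropy_factor chat_ge0 a_lt1 (powR_ge0 (`|c| * b) a).
  have -> : 600 * (N * (B * (1 + (`|c| * b) `^ a))) =
    300 * (2 * N) * (B * (1 + (`|c| * b) `^ a)) by ring.
  exact: (ler_wpM2l (mulr_ge0 (ler0n _ 300) (ltW N20)) h).
have emp0 (iota : 'I_n -> 'I_(n + n)) t : emp iota (fun _ : T => 0 : R) t = 0.
  by rewrite /emp big1 ?mulr0.
split; apply: le_trans UE.
- rewrite (@eq_mean _ _ _ _ _ (fun t => maxabs (fun k =>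
      (eX (phi k) t - \int[mu]_x phi k x) +
      (eY (fun _ : T => 0) t - \int[nu]_(x in setT) 0)))); last first.
    by move=> t; congr maxabs; apply: funext => k; rewrite emp0 mean_cst subrr addr0.
  exact: (two_sample_deviation (phiY := fun _ _ => 0) n_gt0 ord0 ent chat_ge0 b_ge0
    a01 N20 cb0 bphi (fun=> b0) bN bN q0 q0 phiN zN phil zl qb qb v2).
- rewrite (@eq_mean _ _ _ _ _ (fun t => maxabs (fun k =>
      (eX (fun _ : T => 0) t - \int[mu]_(x in setT) 0) +
      (eY (phi k) t - \int[nu]_x phi k x)))); last first.
    by move=> t; congr maxabs; apply: funext => k; rewrite emp0 mean_cst subrr add0r.
  exact: (two_sample_deviation (phiX := fun _ _ => 0) n_gt0 ord0 ent chat_ge0 b_ge0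
    a01 N20 cb0 (fun=> b0) bphi bN bN q0 q0 zN phiN zl phil qb qb v2).
Qed.

Let devX t := maxabs (fun k => eX (renyi_h alpha (g k)) t - \int[mu]_x renyi_h alpha (g k) x).
Let devY t := maxabs (fun k => eY (renyi_w alpha (g k)) t - \int[nu]_x renyi_w alpha (g k) x).

Let bdevX : bmeas devX.
Proof. by apply: bmeas_deviation => k; exact: bmeas_renyi_h. Qed.

Let bdevY : bmeas devY.
Proof. by apply: bmeas_deviation => k; exact: bmeas_renyi_w. Qed.

Let mean_devX : \int[P]_t devX t <= 600 * (K * (B * (1 + (e * b) `^ a))) / s.
Proof.
by have [] := @exp_class_deviation (alpha - 1); first by rewrite subr_eq0.
Qed.

Let mean_devY : \int[P]_t devY t <= 600 * (K' * (B * (1 + (alpha * b) `^ a))) / s.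
Proof.
have [] := @exp_class_deviation alpha; first by rewrite gt_eqF.
by rewrite (gtr0_norm alpha_gt0).
Qed.

Let V := kap * K ^+ 2 * (1 + (e * b) `^ (a / 2)) + K' ^+ 2 * (1 + (alpha * b) `^ a).

Lemma renyi_weight_le : renyi_weight M alpha <= V.
Proof.
apply: lerD.
  by rewrite ler_peMr ?lerDl ?powR_ge0// mulr_ge0 ?(ltW kap_gt0) ?sqr_ge0.
by rewrite ler_peMr ?sqr_ge0// lerDl powR_ge0.
Qed.

Let V_ge0 : 0 <= V.
Proof. exact: le_trans (ltW (renyi_weight_gt0 _ alpha_gt0 alpha_neq1)) renyi_weight_le. Qed.

(** The logarithms are Lipschitz on the range of the means, so the objective exceeds its population
    value, itself at most D, by at most two weighted deviations. [crude_absorption] then turns the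
    power a of |alpha - 1| b into a / 2. *)
Lemma renyi_mean_crude : 3 / 4 <= alpha ->
  \int[P]_t supk (fun k => obj (g k) t) <= D + 10 ^+ 7 * (B * V) / s.
Proof.
move=> al34.
apply: (@le_trans _ _ (\int[P]_t (D + (kap * K * devX t + K' * devY t)))).
  apply: le_mean.
  - exact: (bmeas_supk (F := fun k => obj (g k))).
  - by apply: bmeasD; [exact: bmeas_cst | apply: bmeasD; exact: bmeasZ].
  move=> t; apply: supk_le => k.
  have /andP[A1 _] := emp_h_bounds alpha n_gt0 t (gb k).
  have /andP[B1 _] := emp_w_bounds alpha_gt0 n_gt0 t (gb k).
  have /andP[A2 _] := mean_h_bounds mu alpha (bg k) (gb k).
  have /andP[B2 _] := mean_w_bounds nu alpha_gt0 (bg k) (gb k).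
  have lip := renyi_log_lipschitz alpha_gt0 alpha_neq1 A1 A2 B1 B2.
  have var := renyi_variational fM alpha_gt0 alpha_neq1 (bg k) (gb k).
  have hX := le_maxabs (fun k => eX (renyi_h alpha (g k)) t -
    \int[mu]_x renyi_h alpha (g k) x) k.
  have hY := le_maxabs (fun k => eY (renyi_w alpha (g k)) t -
    \int[nu]_x renyi_w alpha (g k) x) k.
  rewrite -lerBlDl; apply: (@le_trans _ _ _ _ _ _ (lerD (ler_wpM2l
    (mulr_ge0 (ltW kap_gt0) (ltW K_gt0)) hX) (ler_wpM2l (ltW K'_gt0) hY))).
  apply: le_trans _ lip; apply: le_trans (ler_norm _).
  by rewrite lerD2l lerN2.
rewrite meanD; [|exact: bmeas_cst|by apply: bmeasD; exact: bmeasZ].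
rewrite mean_cst lerD2l meanD; [|exact: bmeasZ|exact: bmeasZ].
rewrite !meanZ//.
have h1 := ler_wpM2l (mulr_ge0 (ltW kap_gt0) (ltW K_gt0)) mean_devX.
have h2 := ler_wpM2l (ltW K'_gt0) mean_devY.
apply: le_trans (lerD h1 h2) _.
have -> : kap * K * (600 * (K * (B * (1 + (e * b) `^ a))) / s) +
    K' * (600 * (K' * (B * (1 + (alpha * b) `^ a))) / s) =
    600 * (B * (kap * K ^+ 2 * (1 + (e * b) `^ a) +
      K' ^+ 2 * (1 + (alpha * b) `^ a))) / s by ring.
rewrite ler_wpM2r ?invr_ge0//.
have h := crude_absorption al34 alpha_neq1 a01 b_ge0.
apply: le_trans (ler_wpM2l (ler0n _ 600) (ler_wpM2l B_ge0 h)) _.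
rewrite -/kap -/K -/K' -/V.
have -> : 600 * (B * (4 * V)) = 2400 * (B * V) by ring.
by rewrite ler_wpM2r ?mulr_ge0 ?constant_2400.
Qed.

Lemma renyi_mean_local : alpha < 3 / 4 ->
  \int[P]_t supk (fun k => obj (g k) t) <= D + 10 ^+ 7 * (B * V) / s.
Proof.
move=> al34; pose eta := 1 - alpha.
have hb : 0 <= b by exact: b_ge0.
have eta0 : 0 < eta by rewrite /eta; lra.
have eta1 : eta <= 1 by rewrite /eta; have := ltW alpha_gt0; lra.
have ale : alpha + eta = 1 by rewrite /eta; ring.
have eE : e = eta by rewrite ler0_norm /eta; [ring | lra].
pose lf x := ln (f x).
have blf : bmeas lf := bmeas_ln_ratio fM.
have lfb x : `|lf x| <= b := ratio_ln_bound fM x.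
pose hs x := expR (- (eta * lf x)).
have hs0 x : 0 < hs x by exact: expR_gt0.
have bhs : bmeas hs by apply/bmeas_expR/bmeasN/bmeasZ.
pose j i : R := - b + i%:R.
(* The slices from -b + i to -b + i + 1, for i <= N, cover [-b, b], and there are at most 1 + 2 b of
   them. *)
pose N := Num.truncn (2 * b).
have NB : N.+1%:R <= 1 + 2 * b.
  have := truncn_itv (mulr_ge0 (ler0n R 2) b_ge0) => /andP[h _].
  by rewrite -natr1 -/N addrC lerD2l.
have jb (i : 'I_N.+1) : `|j i| <= b.
  have i0 : 0 <= i%:R :> R by exact: ler0n.
  have i2 : i%:R + 1 <= N.+1%:R :> R by rewrite natr1 ler_nat ltn_ord.
  by rewrite ler_norml /j; apply/andP; split; lra.
pose phi i k x := hs x * psi eta (g k x - lf x - j i).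
have bphi i k : bmeas (phi i k).
  apply: bmeasM => //; apply: bmeas_psi; apply: bmeasB; first exact: bmeasB.
  exact: bmeas_cst.
pose E := expR (`|2 * alpha - 1| * b / 2).
have E1 : 1 <= E by rewrite -[leLHS]expR0 ler_expR divr_ge0 ?mulr_ge0.
pose dev (i : 'I_N.+1) t := maxabs (fun k => eX (phi i k) t - \int[mu]_x phi i k x).
have bdev i : bmeas (dev i) by exact: bmeas_deviation.
have c13 : 0 < 1 + 3 * b by lra.
have mean_dev i : \int[P]_t dev i t <= 1200 * ((1 + 3 * b) * E * B) / s.
  have hs2 : \int[mu]_x ((1 + 3 * b) * hs x) ^+ 2 +
      \int[nu]_(x in setT) ((1 + 3 * b) ^+ 2) <= (2 * ((1 + 3 * b) * E)) ^+ 2.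
    have EE : E ^+ 2 = expR (`|2 * alpha - 1| * b).
      by rewrite -expRM_natl; congr expR; field.
    have bhs2 : bmeas (fun x => hs x ^+ 2).
      by under [X in bmeas X]funext do rewrite expr2; exact: bmeasM.
    (* [hs] is f^(alpha-1). Its square under mu integrates like f^(2 alpha - 1) under nu, which
       gives exp(|2 alpha - 1| b) where a bound by the supremum would give exp(2 eta b). *)
    have h1 : \int[mu]_x (hs x ^+ 2) <= E ^+ 2.
      rewrite (ratio_mean fM bhs2) EE; apply: mean_le_cst.
        by apply: bmeasM => //; exact: ratio_bmeas fM.
      move=> x; rewrite -{1}[f x]lnK ?posrE ?(ratio_gt0 fM)//.
      rewrite -expRM_natl -expRD ler_expR -/(lf x).
      have -> : lf x + 2%:R * - (eta * lf x) = (2 * alpha - 1) * lf x by rewrite /eta; ring.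
      by apply: le_trans (ler_norm _) _; rewrite normrM ler_wpM2l.
    have -> : \int[mu]_x ((1 + 3 * b) * hs x) ^+ 2 = (1 + 3 * b) ^+ 2 * \int[mu]_x (hs x ^+ 2).
      by rewrite -meanZ//; apply: eq_mean => x; rewrite exprMn.
    rewrite mean_cst exprMn exprMn.
    have E21 : 1 <= E ^+ 2 by exact: exprn_ege1.
    move: h1 E21 (sqr_ge0 (1 + 3 * b)).
    move: (\int[mu]_x (hs x ^+ 2)) (E ^+ 2) ((1 + 3 * b) ^+ 2) => u v w uv v1 w0.
    have := ler_wpM2l w0 uv; have := ler_wpM2l w0 v1; rewrite mulr1; lra.
  have b0 := bmeas_cst T (0 : R).
  have emp0 t : eY (fun _ : T => 0 : R) t = 0 by rewrite /emp big1 ?mulr0.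
  rewrite (@eq_mean _ _ _ _ _ (fun t => maxabs (fun k =>
      (eX (phi i k) t - \int[mu]_x phi i k x) +
      (eY (fun _ : T => 0) t - \int[nu]_(x in setT) 0)))); last first.
    by move=> t; congr maxabs; apply: funext => k; rewrite emp0 mean_cst subrr addr0.
  have bound x k : `|g k x - lf x - j i| <= 3 * b.
    apply: le_trans (ler_normB _ _) _.
    have := ler_normB (g k x) (lf x); have := gb k x; have := lfb x; have := jb i.
    by move: `|g k x - lf x| `|g k x| `|lf x| `|j i| => x1 x2 x3 x4; lra.
  (* The Lipschitz constant is 2 hs and the envelope (1 + 3 b) hs, so L = 1. The envelope for the
     zero integrand on the second sample is chosen to satisfy the same constraint; it adds (1 + 3
     b)^2 to the moments, which v covers because E >= 1. *)
  apply: le_trans (two_sample_deviation (phiY := fun _ _ => 0)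
    (rX := fun x => (1 + 3 * b) * hs x) (rY := fun=> 1 + 3 * b)
    (qX := fun x => 2 * hs x) (qY := fun=> 2) n_gt0 ord0 ent chat_ge0 b_ge0
    a01 (v := 2 * ((1 + 3 * b) * E)) (L := 1) _ _ _ _ _ _ _ _ _ _ _ _ _ _ hs2) _.
  - by rewrite mulr_gt0// mulr_gt0// (lt_le_trans ltr01 E1).
  - exact: ler01.
  - by [].
  - by [].
  - exact: bmeasZ.
  - exact: bmeas_cst.
  - by move=> x; rewrite mulr_gt0.
  - by move=> x; rewrite ltr0n.
  - move=> k x; rewrite /phi normrM (gtr0_norm (hs0 x)) mulrC ler_wpM2r ?(ltW (hs0 x))//.
    rewrite ger0_norm ?psi_ge0 ?(ltW eta0)//.
    apply: le_trans (psi_le _ (ltW eta0)) _; rewrite lerD2l.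
    by rewrite -[leRHS]mul1r; apply: ler_pM => //; exact: ltW.
  - by move=> k x; rewrite normr0 ltW.
  - move=> k l x; rewrite /phi -mulrBr normrM (gtr0_norm (hs0 x)) [2 * _]mulrC -mulrA.
    rewrite ler_wpM2l ?(ltW (hs0 x))//.
    apply: le_trans (psi_lipschitz _ _ (ltW eta0)) _.
    have -> : g k x - lf x - j i - (g l x - lf x - j i) = g k x - g l x by ring.
    rewrite ler_wpM2r// -[leRHS]mulr1 ler_wpM2l//.
  - by move=> k l x; rewrite subrr normr0 mulr_ge0.
  - by move=> x; rewrite mulr1 mulrAC ler_wpM2r ?(ltW (hs0 x))//; lra.
  - by move=> x; rewrite mulr1; lra.
  rewrite ler_wpM2r ?invr_ge0// powR1.
  have h := entropy_factor chat_ge0 a_lt1 (ler01 : 0 <= 1).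
  have p0 : 0 <= 300 * (2 * ((1 + 3 * b) * E)).
    by rewrite mulr_ge0 ?ler0n// mulr_ge0 ?ler0n// mulr_ge0 ?expR_ge0// ltW.
  apply: le_trans (ler_wpM2l p0 h) _; rewrite -/B.
  by rewrite le_eqVlt; apply/orP; left; apply/eqP; ring.
pose Q := kap * expR (1 + 2 * alpha * eta * b).
have Q0 : 0 <= Q by rewrite mulr_ge0 ?expR_ge0 ?(ltW kap_gt0).
have dev_ge0 i t : 0 <= dev i t by exact: maxabs_ge0.
have bsum : bmeas (fun t => \sum_(i < N.+1) dev i t) by exact: bmeas_sum.
(* The slice in use depends on the sample and on k, so the nonnegative deviations of all slices are
   summed. *)
apply: (@le_trans _ _ (\int[P]_t (D + (Q * (\sum_(i < N.+1) dev i t) + K' * devY t)))).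
  apply: le_mean.
  - exact: (bmeas_supk (F := fun k => obj (g k))).
  - by apply: bmeasD; [exact: bmeas_cst | apply: bmeasD; exact: bmeasZ].
  move=> t; apply: supk_le => k.
  have /andP[A1 A2] := emp_h_bounds alpha n_gt0 t (gb k).
  have /andP[B1 B2] := emp_w_bounds alpha_gt0 n_gt0 t (gb k).
  set A := eX (renyi_h alpha (g k)) t in A1 A2.
  set Bq := eY (renyi_w alpha (g k)) t in B1 B2.
  have A0 : 0 < A by apply: lt_le_trans A1; rewrite invr_gt0.
  have B0 : 0 < Bq by apply: lt_le_trans B1; rewrite invr_gt0.
  have lA1 : - (eta * b) <= ln A by rewrite -ler_expR expRN lnK ?posrE// -eE.
  have lA2 : ln A <= eta * b by rewrite -ler_expR lnK ?posrE// -eE.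
  have lB1 : - (alpha * b) <= ln Bq by rewrite -ler_expR expRN lnK ?posrE.
  have lB2 : ln Bq <= alpha * b by rewrite -ler_expR lnK ?posrE.
  pose c := ln Bq - ln A.
  have bb : alpha * b + eta * b = b by rewrite -mulrDl ale mul1r.
  have cb0 : 0 <= c + b by rewrite /c; lra.
  have cb2 : c + b <= 2 * b by rewrite /c; lra.
  (* c is in [-b, b] because |ln A| <= eta b, |ln Bq| <= alpha b and alpha + eta = 1. *)
  have iN : (Num.truncn (c + b) < N.+1)%N by rewrite ltnS le_truncn.
  pose i := Ordinal iN.
  have /andP[ji ij] := truncn_itv cb0.
  have jc : j i <= c by rewrite /j /= addrC lerBlDr.
  have cj : c <= j i + 1.
    by rewrite /j /= -addrA natr1 addrC -lerBlDr opprK ltW.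
  have lam0 := hellinger_gt0 alpha fM.
  have H1 : (1 + alpha / eta) * expR (- (eta * c)) * hellinger nu f alpha <=
      alpha / eta * (expR (- (eta * j i)) * \int[mu]_x phi i k x) +
      expR (- c) * \int[nu]_x renyi_w alpha (g k) x.
    have bw := bmeas_renyi_w alpha (bg k).
    have bfw : bmeas (fun x => expR (- lf x) * expR (alpha * g k x)).
      by apply: bmeasM => //; apply/bmeas_expR/bmeasN.
    have -> : \int[nu]_x renyi_w alpha (g k) x =
        \int[mu]_x (expR (- lf x) * expR (alpha * g k x)).
      rewrite (ratio_mean fM)//; apply: eq_mean => x.
      rewrite mulrA expRN lnK ?posrE ?(ratio_gt0 fM)// mulfV ?mul1r//.
      by rewrite gt_eqF ?(ratio_gt0 fM).
    have -> : hellinger nu f alpha = \int[mu]_x hs x.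
      rewrite (hellinger_mu alpha fM); apply: eq_mean => x.
      by rewrite /renyi_h /hs /eta; congr expR; rewrite /lf; ring.
    rewrite -!meanZ//; last exact: bmeasZ.
    rewrite -meanD; [|do 2 apply: bmeasZ => //|exact: bmeasZ].
    apply: le_mean; first exact: bmeasZ.
      by apply: bmeasD; [do 2 apply: bmeasZ => //|exact: bmeasZ].
    move=> x; exact: psi_local_inequality.
  (* Putting the exponential back for [psi] cancels the powers of f: the result is exp(eta j) times
     the integrand whose empirical mean is A. *)
  have H2 : eX (phi i k) t <= expR (eta * j i) * expR (ln A).
    rewrite lnK ?posrE//; apply: emp_le_scale => x.
    apply: (@le_trans _ _ (hs x * expR (- (eta * (g k x - lf x - j i))))).
      by rewrite ler_wpM2l ?(ltW (hs0 x))// psi_le_expR.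
    rewrite le_eqVlt; apply/orP; left; apply/eqP.
    by rewrite /hs /renyi_h -!expRD; congr expR; rewrite /eta; ring.
  have H3 : \int[mu]_x phi i k x <= eX (phi i k) t + dev i t.
    have := le_maxabs (fun k => eX (phi i k) t - \int[mu]_x phi i k x) k.
    by rewrite -/(dev i t) ler_norml => /andP[+ _]; rewrite lerBrDl lerBlDr addrC.
  have H4 : \int[nu]_x renyi_w alpha (g k) x <= expR (ln Bq) + devY t.
    rewrite lnK ?posrE//.
    have := le_maxabs (fun k => eY (renyi_w alpha (g k)) t -
      \int[nu]_x renyi_w alpha (g k) x) k.
    by rewrite -/(devY t) ler_norml => /andP[+ _]; rewrite lerBrDl lerBlDr addrC.
  have H := local_linearization eta0 alpha_gt0 ale lam0 jc cj lA1 lB1 H1 H2 H3 H4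
    (dev_ge0 i t) (maxabs_ge0 _).
  have kE : kap = alpha / eta by rewrite /kap eE.
  rewrite -lerBlDl.
  have -> : obj (g k) t - D = - (alpha / eta) * ln A - ln Bq +
      eta^-1 * ln (hellinger nu f alpha).
    rewrite /renyi_objective /renyi_divergence -/A -/Bq.
    have -> : alpha - 1 = - eta by rewrite /eta; ring.
    by rewrite invrN; ring.
  apply: le_trans H _; rewrite lerD2r -kE -/Q ler_wpM2l//.
  rewrite (bigD1 i)//= lerDl; apply: sumr_ge0 => l _; exact: dev_ge0.
rewrite meanD; [|exact: bmeas_cst|by apply: bmeasD; exact: bmeasZ].
rewrite mean_cst lerD2l meanD; [|exact: bmeasZ|exact: bmeasZ].
rewrite !meanZ// mean_sum//.
have h1 : Q * (\sum_(i < N.+1) \int[P]_t dev i t) <=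
    1200 * 1152 * (B * V) / s.
  apply: (@le_trans _ _ (Q * ((1 + 2 * b) * (1200 * ((1 + 3 * b) * E * B) / s)))).
    rewrite ler_wpM2l//; apply: (@le_trans _ _ (\sum_(i < N.+1)
        (1200 * ((1 + 3 * b) * E * B) / s))); first by apply: ler_sum.
    rewrite sum_ord_cst; apply: (ler_wpM2r _ NB).
    exact: (divr_ge0 (mulr_ge0 (ler0n _ 1200) (mulr_ge0 (mulr_ge0 (ltW c13)
      (expR_ge0 _)) B_ge0)) s_ge0).
  have := local_absorption alpha_gt0 al34 b_ge0.
  rewrite -/eta -/E -eE -/kap -/K -/K' => h.
  have h' := le_trans h (ler_wpM2l (ler0n _ 1152) renyi_weight_le).
  have -> : Q * ((1 + 2 * b) * (1200 * ((1 + 3 * b) * E * B) / s)) =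
    1200 * (B * (kap * expR (1 + 2 * alpha * e * b) *
      ((1 + 2 * b) * (1 + 3 * b) * E))) / s by rewrite /Q eE; ring.
  have -> : 1200 * 1152 * (B * V) / s = 1200 * (B * (1152 * V)) / s by ring.
  have s1 : 0 <= s^-1 by rewrite invr_ge0.
  exact: (ler_wpM2r s1 (ler_wpM2l (ler0n _ 1200) (ler_wpM2l B_ge0 h'))).
have h2 : K' * \int[P]_t devY t <= 600 * (B * V) / s.
  apply: le_trans (ler_wpM2l (ltW K'_gt0) mean_devY) _.
  have -> : K' * (600 * (K' * (B * (1 + (alpha * b) `^ a))) / s) =
    600 * (B * (K' ^+ 2 * (1 + (alpha * b) `^ a))) / s by ring.
  have s1 : 0 <= s^-1 by rewrite invr_ge0.
  have hV : K' ^+ 2 * (1 + (alpha * b) `^ a) <= V.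
    by rewrite lerDr mulr_ge0 ?addr_ge0 ?powR_ge0// mulr_ge0 ?sqr_ge0 ?(ltW kap_gt0).
  exact: (ler_wpM2r s1 (ler_wpM2l (ler0n _ 600) (ler_wpM2l B_ge0 hV))).
apply: le_trans (lerD h1 h2) _; rewrite -mulrDl -mulrDl.
by rewrite ler_wpM2r ?invr_ge0// ler_wpM2r ?mulr_ge0 ?constant_1383000.
Qed.

Lemma renyi_upper z : 0 <= z ->
  (P [set t | (D + 10 ^+ 7 * (B * V) * ((Num.sqrt n%:R)^-1 + z) <=
       supk (fun k => obj (g k) t))%R] <=
    (expR (- (n%:R * z ^+ 2)))%:E)%E.
Proof.
move=> z0; apply: (upper_tail_bound n_gt0 (F := fun k => obj (g k))
  (W := renyi_weight M alpha)) => //.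
- exact: renyi_weight_gt0.
- by apply: le_trans renyi_weight_le _; rewrite ler_peMl.
- by apply: (le_trans _ (constant_2400 R)); lra.
- by move=> k; exact: renyi_bounded_differences.
- by have [/renyi_mean_crude|/renyi_mean_local] := leP (3 / 4) alpha.
Qed.

End renyi_upper.

(** * Reduction to countable classes *)

Section deviation_events.
Context (R : realType).

Lemma outer_prob_deviation dO (O : measurableType dO) (P : probability O R)
    dU (U : measurableType dU) (Q : probability U R) (Z : O -> U) (O0 : set O)
    (F : nat -> U -> R) (Dhat : O -> \bar R) (D t tu tl r : R) :
  measurable_fun setT Z -> (forall A, measurable A -> P (Z @^-1` A) = Q A) ->
  measurable O0 -> P (~` O0) = 0%E -> (forall k, bmeas (F k)) ->
  (forall m, Q [set u | (D + tu <= supk (fun k : 'I_m.+1 => F k u))%R] <= r%:E)%E ->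
  (Q [set u | (F 0%N u <= D - tl)%R] <= r%:E)%E ->
  tu < t -> tl < t ->
  (forall o, O0 o -> forall c : R, (forall k, F k (Z o) <= c) -> (Dhat o <= c%:E)%E) ->
  (forall o, O0 o -> ((F 0%N (Z o))%:E <= Dhat o)%E) ->
  (outer_prob P [set o | (t%:E <= `|Dhat o - D%:E|)%E] <= (2 * r)%:E)%E.
Proof.
move=> mZ lawZ mO0 PO0 bF up low tut tlt Dle Dge.
pose A1 m := [set u | D + tu <= supk (fun k : 'I_m.+1 => F k u)].
pose A2 := [set u | F 0%N u <= D - tl].
have mge (h : U -> R) x : bmeas h -> measurable [set u | x <= h u].
  move=> bh; rewrite (_ : [set _ | _] = h @^-1` `[x, +oo[); last first.
    by apply/seteqP; split => u /=; rewrite in_itv/= andbT.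
  by rewrite -[X in measurable X]setTI; apply: bh.1.
have mA1 m : measurable (A1 m).
  by apply: mge; exact: (bmeas_supk (F := fun k : 'I_m.+1 => F k)).
have mA2 : measurable A2.
  rewrite (_ : A2 = [set u | tl - D <= - F 0%N u]); last first.
    by apply/seteqP; split => u /=; rewrite lerNr opprB.
  by apply: mge; exact: bmeasN.
have QU : (Q (\bigcup_m A1 m) <= r%:E)%E.
  have mU : measurable (\bigcup_m A1 m) by exact: bigcupT_measurable.
  have cv := @nondecreasing_cvg_mu _ _ _ Q A1 mA1 mU.
  rewrite -(cvg_lim _ (cv _))//; last first.
    apply/nondecreasing_seqP => m; rewrite subsetEset => u /=.
    move/le_trans; apply; apply: supk_le => k.
    exact: (le_supk (fun k : 'I_m.+2 => F k u) (widen_ord (leqnSn _) k)).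
  apply: lime_le.
    apply/cvg_ex; eexists; apply: cv.
    apply/nondecreasing_seqP => m; rewrite subsetEset => u /=.
    move/le_trans; apply; apply: supk_le => k.
    exact: (le_supk (fun k : 'I_m.+2 => F k u) (widen_ord (leqnSn _) k)).
  by apply: nearW => m /=; exact: up.
pose B := (\bigcup_m A1 m) `|` A2.
have mB : measurable B by apply: measurableU => //; exact: bigcupT_measurable.
have QB : (Q B <= (2 * r)%:E)%E.
  apply: le_trans (measureU2 _ _ _) _ => //; first exact: bigcupT_measurable.
  by rewrite mulrDl mul1r EFinD; exact: leeD.
have mZB : measurable (Z @^-1` B) by rewrite -[X in measurable X]setTI; apply: mZ.
apply: (@le_trans _ _ (P (~` O0 `|` Z @^-1` B))); last first.
  apply: le_trans (measureU2 _ _ _) _ => //; first exact: measurableC.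
  have e1 : (P (~` O0) <= 0)%E by rewrite PO0.
  have e2 : (P (Z @^-1` B) <= Q B)%E by rewrite lawZ.
  by apply: le_trans (leeD e1 e2) _; rewrite add0e.
apply: ereal_inf_lbound; exists (~` O0 `|` Z @^-1` B) => //; split.
  by apply: measurableU => //; exact: measurableC.
move=> o /= tD; have [h0|] := pselect (O0 o); last by left.
right; apply: contrapT => nB.
have lt1 k : F k (Z o) < D + tu.
  rewrite ltNge; apply/negP => h; apply: nB; left; exists k => //=.
  by apply: le_trans h _; exact: (le_supk (fun i : 'I_k.+1 => F i (Z o)) ord_max).
have gt2 : D - tl < F 0%N (Z o).
  by rewrite ltNge; apply/negP => h; apply: nB; right.
have h1 := Dle o h0 _ (fun k => ltW (lt1 k)).
have h2 := Dge o h0.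
move: tD h1 h2; case: (Dhat o) => [x| |] //=.
rewrite !lee_fin => tx xD Fx; move: tx; apply/negP; rewrite -ltNge ltr_norml.
by apply/andP; split; lra.
Qed.

End deviation_events.

Lemma rat_approx (R : realType) (x w : R) : 0 < w ->
  exists q : rat, `|x - ratr q| < w.
Proof.
move=> w0; have xw : x - w < x + w by lra.
have [q] := rat_in_itvoo xw.
by rewrite in_itv/= => /andP[h1 h2]; exists q; rewrite ltr_norml; apply/andP; split; lra.
Qed.

Lemma dist_lt_double (R : realType) (x y q w e : R) : 2 * w < e ->
  `|y - q| < w -> `|x - q| < w -> `|y - x| < e.
Proof. by rewrite !ltr_norml => we /andP[? ?] /andP[? ?]; apply/andP; split; lra. Qed.

(** * The support of a measure on R^d *)

Section support.
Context (R : realType) (d : nat) (rho : {measure set (d.-tuple R) -> \bar R}).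

Definition box (c : d.-tuple R) (r : R) :=
  [set y : d.-tuple R | forall i : 'I_d, `|tnth y i - tnth c i| < r].

Lemma measurable_box c r : measurable (box c r).
Proof.
have -> : box c r = \bigcap_(i in [set: 'I_d])
    ((fun y : d.-tuple R => `|tnth y i - tnth c i|) @^-1` `]-oo, r[).
  apply/seteqP; split => y /= H i; first by move=> _ /=; rewrite in_itv/=; exact: H.
  by have := H i I; rewrite /= in_itv.
apply: fin_bigcap_measurable => // i _; rewrite -[X in measurable X]setTI.
have mf : measurable_fun setT (fun y : d.-tuple R => `|tnth y i - tnth c i|).
  apply: measurableT_comp => //; apply: measurable_funB => //.
  exact: measurable_tnth.
exact: mf.
Qed.

(* The support has full measure: its complement is covered by the null boxes
   with rational centres and radii 1 / (k + 1). *)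
Lemma spt_full_measure : exists S : set (d.-tuple R),
  [/\ measurable S, rho (~` S) = 0%E & S `<=` spt rho].
Proof.
pose bx (ck : d.-tuple rat * nat) := box (map_tuple ratr ck.1) (ck.2.+1%:R^-1 : R).
pose F k := if @unpickle (d.-tuple rat * nat)%type k is Some ck then
  (if rho (bx ck) == 0%E then bx ck else set0) else set0.
have mF k : measurable (F k).
  by rewrite /F; case: unpickle => // ck; case: ifP => // _; exact: measurable_box.
have F0 k : rho (F k) = 0%E.
  rewrite /F; case: unpickle => [ck|]; last by rewrite measure0.
  by case: ifP => [/eqP//|_]; rewrite measure0.
have mU : measurable (\bigcup_k F k) by exact: bigcupT_measurable.
exists (~` (\bigcup_k F k)); split.
- exact: measurableC.
- rewrite setCK; apply/negligibleP => //; apply: negligible_bigcup => k.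
  by apply/negligibleP; [exact: mF | exact: F0].
move=> x nFx e e0; rewrite lt0e measure_ge0 andbT; apply/eqP => rho0; apply: nFx.
(* A box of radius 1 / (k + 1) that contains x has to stay within e of x, which asks for 2 / (k + 1)
   < e. *)
pose k := Num.truncn (2 / e).
have k0 : 0 < k.+1%:R :> R by rewrite ltr0n.
have ke : 2 * k.+1%:R^-1 < e.
  have /andP[_ h] := truncn_itv (ltW (divr_gt0 (ltr0n R 2) e0)).
  by rewrite ltr_pdivrMr// mulrC -ltr_pdivrMr.
have kinv : 0 < k.+1%:R^-1 :> R by rewrite invr_gt0.
have approx (i : 'I_d) : exists q : rat, `|tnth x i - ratr q| < k.+1%:R^-1.
  exact: rat_approx.
have /choice[q qP] := approx.
pose ck : d.-tuple rat * nat := ([tuple q i | i < d], k).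
have ckE i : tnth (map_tuple ratr ck.1) i = ratr (q i) :> R.
  by rewrite tnth_map tnth_mktuple.
have sub : bx ck `<=` [set y | forall i : 'I_d, `|tnth y i - tnth x i| < e].
  by move=> y yb i; have := yb i; rewrite ckE /= => h; exact: dist_lt_double ke h (qP i).
have rb0 : rho (bx ck) = 0%E.
  apply/eqP; rewrite eq_le measure_ge0 andbT -rho0.
  by apply: le_measure => //; rewrite inE; exact: measurable_box.
exists (pickle ck) => //; rewrite /F pickleK rb0 eqxx => i.
by rewrite ckE; exact: qP.
Qed.

End support.

(** * Almost-everywhere bounds on densities *)

Section densities.
Context (R : realType) dT (T : measurableType dT).

Lemma positive_integral_null (nu : {measure set T -> \bar R}) (U : set T) (h : T -> R) :
  measurable U -> measurable_fun setT h -> (forall x, U x -> 0 < h x) ->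
  (\int[nu]_(x in U) (h x)%:E <= 0)%E -> nu U = 0%E.
Proof.
move=> mU mh h0 hle.
have mhU : measurable_fun U (EFin \o h).
  by apply: measurable_funTS; exact/measurable_EFinP.
have abs0 : (\int[nu]_(x in U) `|(EFin \o h) x|)%E = 0%E.
  apply/eqP; rewrite eq_le; apply/andP; split; last by apply: integral_ge0.
  apply: le_trans hle; rewrite le_eqVlt; apply/orP; left; apply/eqP.
  apply: eq_integral => x /set_mem Ux /=.
  by rewrite ger0_norm// ltW// h0.
have [N [mN N0 hN]] := (ae_eq_integral_abs nu mU mhU).1 abs0.
apply/eqP; rewrite eq_le measure_ge0 andbT -N0; apply: le_measure; rewrite ?inE//.
move=> x Ux; apply: hN => /= /(_ Ux) [hx].
by have := h0 x Ux; rewrite hx ltxx.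
Qed.

(** Where [pnu] vanishes the quotient is 0 by convention and bounds nothing. That set is nu-null,
    hence mu-null by absolute continuity, and is removed before integrating. *)
Lemma density_domination (rho : {measure set T -> \bar R}) (mu nu : probability T R)
    (pmu pnu : T -> R) (M : R) : 0 <= M ->
  is_density rho mu pmu -> is_density rho nu pnu -> mu `<< nu ->
  (ess_sup rho (fun x => (pmu x / pnu x)%:E) <= M%:E)%E ->
  forall A, measurable A -> (mu A <= M%:E * nu A)%E.
Proof.
move=> M0 [mpmu [pmu0 muE]] [mpnu [pnu0 nuE]] munu /ess_supP ratio A mA.
pose Z := pnu @^-1` [set 0].
have mZ : measurable Z by rewrite -[X in measurable X]setTI; apply: mpnu.
have nuZ : nu Z = 0%E.
  by rewrite nuE//; apply: integral0_eq => x /= ->.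
have muZ : mu Z = 0%E.
  have nullZ : nu.-null_set Z by apply/measure0_null_setP.
  by apply/measure0_null_setP => //; exact: munu.
have mAZ : measurable (A `\` Z) by exact: measurableD.
have h1 : (mu A <= mu (A `\` Z))%E.
  apply: (@le_trans _ _ (mu (A `\` Z `|` Z))).
    apply: le_measure; rewrite ?inE//; first exact: measurableU.
    by move=> x Ax; have [Zx|nZx] := pselect (Z x); [right | left].
  by apply: le_trans (measureU2 _ mAZ mZ) _; rewrite [X in (_ + X)%E]muZ adde0.
apply: le_trans h1 _.
have h2 : (mu (A `\` Z) <= \int[rho]_(x in A `\` Z) (M%:E * (pnu x)%:E))%E.
  rewrite muE//; apply: ae_ge0_le_integral => //.
  - by move=> x _; rewrite lee_fin.
  - by apply: measurable_funTS; exact/measurable_EFinP.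
  - by move=> x _; rewrite -EFinM lee_fin mulr_ge0.
  - apply: measurable_funTS; under eq_fun do rewrite -EFinM.
    by apply/measurable_EFinP; exact: measurable_funM.
  apply: filterS ratio => x; rewrite !lee_fin => h [_ nZ]; rewrite -ler_pdivrMr//.
  by rewrite lt_neqAle pnu0 andbT eq_sym; apply/eqP.
apply: le_trans h2 _; rewrite ge0_integralZl_EFin//; last 2 first.
- by move=> x _; rewrite lee_fin.
- by apply: measurable_funTS; exact/measurable_EFinP.
rewrite -nuE// lee_wpmul2l ?lee_fin//.
by apply: le_measure; rewrite ?inE// => x [].
Qed.

Lemma density_upper_bound (mu nu : probability T R) (f : T -> R) (M : R) : 0 <= M ->
  is_density nu mu f -> (forall A, measurable A -> (mu A <= M%:E * nu A)%E) ->
  nu [set x | M < f x] = 0%E.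
Proof.
move=> M0 [mf [f0 muE]] dom; set U := [set x | _].
have mU : measurable U.
  rewrite (_ : U = f @^-1` `]M, +oo[); last first.
    by apply/seteqP; split => x /=; rewrite in_itv/= andbT.
  by rewrite -[X in measurable X]setTI; apply: mf.
have mfM : measurable_fun setT (fun x => f x - M) by exact: measurable_funB.
apply: (positive_integral_null mU mfM) => [x /=|]; first by rewrite subr_gt0.
have split : mu U = (\int[nu]_(x in U) (f x - M)%:E + M%:E * nu U)%E.
  rewrite muE// -integral_cst// -ge0_integralD//.
  - by apply: eq_integral => x _; rewrite -EFinD subrK.
  - by move=> x /= Ux; rewrite lee_fin subr_ge0 ltW.
  - by apply: measurable_funTS; exact/measurable_EFinP.
have fin : (M%:E * nu U)%E \is a fin_num by rewrite fin_numM// fin_num_measure.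
have := dom U mU; rewrite split -[X in (_ <= X)%E]add0e leeD2rE//.
Qed.

Lemma density_lower_bound (mu nu : probability T R) (f : T -> R) (M : R) : 0 < M ->
  is_density nu mu f -> (forall A, measurable A -> (nu A <= M%:E * mu A)%E) ->
  nu [set x | f x < M^-1] = 0%E.
Proof.
move=> M0 [mf [f0 muE]] dom; set U := [set x | _].
have mU : measurable U.
  rewrite (_ : U = f @^-1` `]-oo, M^-1[); last first.
    by apply/seteqP; split => x /=; rewrite in_itv.
  by rewrite -[X in measurable X]setTI; apply: mf.
have mMf : measurable_fun setT (fun x => M * f x) by exact: measurable_funM.
have mfM : measurable_fun setT (fun x => 1 - M * f x) by exact: measurable_funB.
have pos x : U x -> 0 < 1 - M * f x.
  by move=> /= Ux; rewrite subr_gt0 mulrC -ltr_pdivlMr// div1r.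
apply: (positive_integral_null mU mfM pos).
have split : nu U = (\int[nu]_(x in U) (1 - M * f x)%:E + M%:E * mu U)%E.
  rewrite muE// -ge0_integralZl_EFin//; last 3 first.
  - by move=> x _; rewrite lee_fin.
  - by apply: measurable_funTS; exact/measurable_EFinP.
  - exact: ltW.
  rewrite -ge0_integralD//.
  - under eq_integral do rewrite -EFinM -EFinD subrK.
    by rewrite integral_cst// mul1e.
  - by move=> x Ux; rewrite lee_fin ltW// pos.
  - by apply: measurable_funTS; exact/measurable_EFinP.
  - by move=> x _; rewrite -EFinM lee_fin mulr_ge0// ltW.
  - by apply: measurable_funTS; exact/measurable_EFinP.
have fin : (M%:E * mu U)%E \is a fin_num by rewrite fin_numM// fin_num_measure.
have := dom U mU; rewrite {1}split -[X in (_ <= X)%E]add0e leeD2rE//.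
Qed.

Local Open Scope charge_scope.

(** [is_density] speaks of sets only; identifying the density with the Radon-Nikodym derivative
    carries it over to bounded functions. *)
Lemma mean_density (mu nu : probability T R) (f f' : T -> R) : mu `<< nu ->
  is_density nu mu f -> bmeas f' -> ae_eq nu setT f f' ->
  forall h, bmeas h -> (\int[mu]_x h x = \int[nu]_x (f' x * h x))%R.
Proof.
move=> munu [mf [f0 muE]] bf' ff' h bh.
have eqD : ae_eq nu setT (EFin \o f') ('d (charge_of_finite_measure mu) '/d nu).
  apply: integral_ae_eq => //.
  - exact: bmeas_integrable.
  move=> E _ mE; rewrite -Radon_Nikodym_integral// [RHS]muE//.
  apply: ae_eq_integral => //.
  - by apply: measurable_funTS; exact/measurable_EFinP/(bf'.1).
  - by apply: measurable_funTS; exact/measurable_EFinP.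
  - by apply: filterS ff' => x /= H _; rewrite H.
congr fine; rewrite -(Radon_Nikodym_change_of_variables munu measurableT); last first.
  exact: bmeas_integrable.
apply: ae_eq_integral => //.
- apply: emeasurable_funM; first exact/measurable_EFinP/(bh.1).
  by apply: measurable_int; exact: Radon_Nikodym_integrable.
- by apply/measurable_EFinP; exact: (bmeasM bf' bh).1.
- apply: filterS eqD => x /= H _; rewrite -H// -EFinM mulrC//.
Qed.

End densities.

(** * From covering numbers to entropy bounds *)

Section covering.
Context (R : realType) (T : Type).

(** Moving the atoms by [r] places them in the set where the covering hypothesis applies, while the
    weights are unchanged. Two members of the class near the same centre are within twice the radius
    of each other, so a member can stand for each centre in use. *)
Lemma covering_entropy (G : set (T -> R)) (S : set T) (chat b a q : R) (m : nat)
    (gs : 'I_m.+1 -> T -> R) (r : T -> T) :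
  (forall (l : nat) (w : 'I_l -> R) (xs : 'I_l -> T),
     (forall i, 0 <= w i) -> \sum_(i < l) w i = 1 ->
     (forall i, 0 < w i -> S (xs i)) ->
     forall eps : R, 0 < eps ->
       (covering_number w xs eps G <= (expR (chat * (b / eps) `^ q))%:E)%E) ->
  q = 2 * a -> (forall x, S (r x)) -> (forall k, G (gs k)) ->
  entropy_bound (fun k x => gs k (r x)) chat b a.
Proof.
move=> cov qa Sr Gg l w xs w0 w1 eps eps0.
have := cov l w (fun i => r (xs i)) w0 w1 (fun i _ => Sr _) eps eps0.
rewrite qa; set E := expR _ => covE.
have E0 : 0 < E by exact: expR_gt0.
(* A strict bound on the infimum yields an actual cover; its factor 2 becomes the [+ 1] in the
   exponent of [entropy_bound]. *)
have : (covering_number w (fun i => r (xs i)) eps G < (2 * E)%:E)%E.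
  by apply: le_lt_trans covE _; rewrite lte_fin; lra.
move/ereal_inf_lt => [_ [N [h hP] <-]]; rewrite lte_fin => NE.
have /choice[c cP] k := hP (gs k) (Gg k).
(* A canonical choice among the indices served by the same centre, so that [pi] takes no more values
   than there are centres. *)
pose pi k := odflt k [pick k' | c k' == c k].
have piP k : c (pi k) = c k.
  by rewrite /pi; case: pickP => [k' /eqP//|/(_ k)]; rewrite eqxx.
have pi_c k k' : c k = c k' -> pi k = pi k'.
  rewrite /pi => ckk'; rewrite (eq_pick (Q := fun x => c x == c k')); last first.
    by move=> x; rewrite /= ckk'.
  by case: pickP => // /(_ k'); rewrite eqxx.
exists pi; split.
  move=> k; have h1 := cP k; have h2 := cP (pi k); rewrite piP in h2.
  have sq (u : T -> R) : L2fin w (fun i => r (xs i)) u <= eps ->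
      \sum_i w i * u (r (xs i)) ^+ 2 <= eps ^+ 2.
    rewrite /L2fin; set W := \sum_i _ => hW.
    have W0 : 0 <= W by apply: sumr_ge0 => i _; rewrite mulr_ge0 ?sqr_ge0.
    by rewrite -[W]sqr_sqrtr// ler_pXn2r ?nnegrE ?sqrtr_ge0// ltW.
  have {h1} h1 := sq _ h1; have {h2} h2 := sq _ h2.
  have e2 : 0 <= 2 * eps by rewrite mulr_ge0// ltW.
  rewrite /L2fin -[leRHS]ger0_norm// -sqrtr_sqr ler_wsqrtr//.
  apply: (@le_trans _ _ (2 * eps ^+ 2 + 2 * eps ^+ 2)); last first.
    by rewrite exprMn; lra.
  apply: le_trans (lerD (ler_wpM2l (ler0n R 2) h1) (ler_wpM2l (ler0n R 2) h2)).
  rewrite !mulr_sumr -big_split/=; apply: ler_sum => i _ /=.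
  set x := gs k _; set y := gs (pi k) _; set z := h _ _.
  have -> : 2 * (w i * (x - z) ^+ 2) + 2 * (w i * (y - z) ^+ 2) =
    w i * (2 * (x - z) ^+ 2 + 2 * (y - z) ^+ 2) by ring.
  rewrite ler_wpM2l//; have := sqr_ge0 ((x - z) + (y - z)).
  have -> : (x - y) ^+ 2 = ((x - z) - (y - z)) ^+ 2 by congr (_ ^+ 2); ring.
  by rewrite sqrrD sqrrB; lra.
apply: (@le_trans _ _ N%:R).
  rewrite ler_nat; have <- : #|[set: 'I_N]%SET| = N by rewrite cardsT card_ord.
  pose s j := odflt ord0 [pick k | c k == j].
  apply: (@leq_trans #|[set pi (s j) | j in [set: 'I_N]%SET]%SET|); last exact: leq_imset_card.
  apply: subset_leq_card; apply/fintype.subsetP => _ /imsetP[k _ ->].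
  apply/imsetP; exists (c k) => //; apply: pi_c; rewrite /s.
  by case: pickP => [k' /eqP->//|/(_ k)]; rewrite eqxx.
apply: (@le_trans _ _ (2 * E)); first exact: ltW.
rewrite expRD mulrC; apply: ler_pM => //; first exact: ltW.
by apply: le_trans (expR_ge1Dx 1); lra.
Qed.

End covering.

(** * The law of the pooled sample *)

Section joint_law.
Context (R : realType) dT (T : measurableType dT) dO (O : measurableType dO).
Variables (P : probability O R) (mu nu : probability T R) (n : nat).
Variables (X Y : 'I_n -> O -> T).

Definition joint_sample (o : O) : (n + n).-tuple T :=
  [tuple match fintype.split i with inl j => X j o | inr j => Y j o end | i < n + n].

Lemma joint_sample_l o j : tnth (joint_sample o) (lshift n j) = X j o.
Proof.
rewrite tnth_mktuple; case: split_ordP => k /eqP; first by rewrite eq_lshift => /eqP->.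
by rewrite eq_lrshift.
Qed.

Lemma joint_sample_r o j : tnth (joint_sample o) (rshift n j) = Y j o.
Proof.
rewrite tnth_mktuple; case: split_ordP => k /eqP; last by rewrite eq_rshift => /eqP->.
by rewrite eq_rlshift.
Qed.

Hypothesis indep : mutually_independent P
  (fun i : 'I_n + 'I_n => match i with inl j => X j | inr j => Y j end).
Hypothesis lawX : forall i A, measurable A -> P (X i @^-1` A) = mu A.
Hypothesis lawY : forall i A, measurable A -> P (Y i @^-1` A) = nu A.

Lemma measurable_joint_sample : measurable_fun setT joint_sample.
Proof.
apply/measurable_fun_tnthP => i.
case: (split_ordP i) => j ->.
  rewrite (_ : _ \o _ = X j); first exact: (indep.1 (inl j)).
  by apply: funext => o /=; rewrite joint_sample_l.
rewrite (_ : _ \o _ = Y j); first exact: (indep.1 (inr j)).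
by apply: funext => o /=; rewrite joint_sample_r.
Qed.

Lemma joint_sample_law A : measurable A ->
  P (joint_sample @^-1` A) = prodm (sample_law mu nu n) (n + n) A.
Proof.
pose Zm : {mfun O >-> (n + n).-tuple T} :=
  MeasurableFun.Pack (MeasurableFun.Class
    (isMeasurableFun.Build _ _ _ _ _ measurable_joint_sample)).
suff H : forall B, measurable B ->
    distribution P Zm B = prodm (sample_law mu nu n) (n + n) B by exact: H.
apply: prodm_unique => {}A mA.
pose A' (i : 'I_n + 'I_n) := match i with
  | inl j => A (lshift n j) | inr j => A (rshift n j) end.
have mA' i : measurable (A' i) by case: i => j; exact: mA.
have preim : joint_sample @^-1` [set t | forall i, A i (tnth t i)] =
    \bigcap_(i in [set: 'I_n + 'I_n])
      ((match i with inl j => X j | inr j => Y j end) @^-1` A' i).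
  apply/seteqP; split => o /= H.
    move=> [j|j] _ /=; first by rewrite -joint_sample_l; exact: H.
    by rewrite -joint_sample_r; exact: H.
  move=> i; case: (split_ordP i) => j ->.
    by rewrite joint_sample_l; exact: (H (inl j)).
  by rewrite joint_sample_r; exact: (H (inr j)).
have := indep.2 A' mA'; rewrite -preim => H.
apply: (eq_trans H); rewrite big_sumType big_split_ord/=; congr (_ * _)%E.
  by apply: eq_bigr => j _; rewrite lawX// /sample_law /= ltn_ord.
by apply: eq_bigr => j _; rewrite lawY// /sample_law /= ltnNge leq_addr.
Qed.

End joint_law.

(** * A countable dense subclass and a good set of full measure *)

Section reduction.
Context (R : realType) (d : nat).
Local Notation T := (d.-tuple R).

Lemma emp_joint_l n (dO : measure_display) (O : measurableType dO)
    (X Y : 'I_n -> O -> T) (h : T -> R) o :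
  emp (@lshift n n) h (joint_sample X Y o) = emp_mean X h o.
Proof. by congr (_ * _); apply: eq_bigr => i _; rewrite joint_sample_l. Qed.

Lemma emp_joint_r n (dO : measure_display) (O : measurableType dO)
    (X Y : 'I_n -> O -> T) (h : T -> R) o :
  emp (@rshift n n) h (joint_sample X Y o) = emp_mean Y h o.
Proof. by congr (_ * _); apply: eq_bigr => i _; rewrite joint_sample_r. Qed.

Lemma emp_mean_cvg n (O : Type) (X : 'I_n -> O -> T) (o : O) (phi : R -> R)
    (u : nat -> T -> R) (g : T -> R) : continuous phi ->
  (forall i, (fun k => u k (X i o)) @ \oo --> g (X i o)) ->
  (fun k => emp_mean X (fun x => phi (u k x)) o) @ \oo -->
    emp_mean X (fun x => phi (g x)) o.
Proof.
move=> cphi cu; apply: cvgM; first exact: cvg_cst.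
elim: (index_enum _) => [|i s IH].
  by rewrite big_nil; under eq_fun do rewrite big_nil; exact: cvg_cst.
rewrite big_cons; under eq_fun do rewrite big_cons.
by apply: cvgD IH; apply: continuous_cvg; [exact: cphi | exact: cu].
Qed.

Lemma countable_enumeration (I : Type) (A : set I) (x0 : I) : countable A -> A x0 ->
  exists e : nat -> I, (forall k, A (e k)) /\ forall x, A x -> exists k, e k = x.
Proof.
move=> /countable_injP[h hinj] Ax0.
have ex k : exists x, A x /\ ((exists2 y, A y & h y = k) -> h x = k).
  have [[y Ay hy]|n] := pselect (exists2 y, A y & h y = k); first by exists y.
  by exists x0; split.
have /choice[e eP] := ex.
exists e; split=> [k|x Ax]; first by case: (eP k).
exists (h x); have [Ae hk] := eP (h x).
by apply: hinj; rewrite ?inE//; apply: hk; exists x.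
Qed.

Lemma negligible_of_ae (rho : {measure set T -> \bar R}) (nu : probability T R)
    (A : set T) : measurable A -> nu `<< rho -> {ae rho, forall x, A x} ->
  nu.-negligible (~` A).
Proof.
move=> mA nurho aeA; have mC := measurableC mA.
apply/negligibleP => //; apply/measure0_null_setP => //.
by apply: nurho; exact: negligible_null_set.
Qed.

(** The sup bounds hold almost everywhere for each member separately; only for countably many
    members can the exceptional sets be merged into one null set. Other members are reached by
    pointwise limits, for which S has to lie in the support. *)
Lemma good_set (rho : {measure set T -> \bar R}) (G : set (T -> R)) (M delta : R)
    (mu nu : probability T R) (pmu pnu f : T -> R) :
  1 <= M -> (forall g, G g -> measurable_fun setT g) ->
  pointwise_separable (spt rho) G ->
  (forall g, G g -> (ess_sup rho (fun x => (`|g x|)%:E) <= (ln M)%:E)%E) ->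
  mu `<< nu -> nu `<< mu -> nu `<< rho ->
  is_density rho mu pmu -> is_density rho nu pnu ->
  (ess_sup rho (fun x => (pmu x / pnu x)%:E) <= M%:E)%E ->
  (ess_sup rho (fun x => (pnu x / pmu x)%:E) <= M%:E)%E ->
  is_density nu mu f ->
  (exists g, G g /\
     (ess_sup rho (fun x => (`|ln (f x) - g x|)%:E) <= delta%:E)%E) ->
  exists (S : set T) (gs : nat -> T -> R),
  [/\ [/\ measurable S, nu (~` S) = 0%E, mu (~` S) = 0%E & S `<=` spt rho],
      (forall k, G (gs k)) /\ (forall k x, S x -> `|gs k x| <= ln M),
      forall x, S x -> M^-1 <= f x <= M,
      forall x, S x -> `|ln (f x) - gs 0%N x| <= delta &
      forall g, G g -> exists v : nat -> nat, forall x, S x ->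
        (fun k => gs (v k) x) @ \oo --> g x].
Proof.
move=> M1 mG [G0 [G0G [cG0 sepG]]] bG munu numu nurho dmu dnu rat1 rat2 df [g0 [Gg0 g0f]].
have M0 : 0 < M by exact: lt_le_trans M1.
have [u0 [Gu0 _]] := sepG g0 Gg0.
have [e [Ge eG]] := countable_enumeration cG0 (Gu0 0%N).
(* Index 0 is reserved for the member close to ln f, which need not belong to the dense part. *)
pose gs k := if k is k'.+1 then e k' else g0.
have Ggs k : G (gs k) by case: k => [//|k]; exact: G0G (Ge k).
have mgs k := mG _ (Ggs k).
have [S0 [mS0 rhoS0 S0spt]] := spt_full_measure rho.
have dom1 := density_domination (ltW M0) dmu dnu munu rat1.
have dom2 := density_domination (ltW M0) dnu dmu numu rat2.
have f1 := density_upper_bound (ltW M0) df dom1.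
have f2 := density_lower_bound M0 df dom2.
have mf := df.1.
have mlevel (h : T -> R) c : measurable_fun setT h -> measurable [set x | `|h x| <= c].
  move=> mh; rewrite (_ : [set _ | _] = (fun x => `|h x|) @^-1` `]-oo, c]); last first.
    by apply/seteqP; split => x /=; rewrite in_itv.
  rewrite -[X in measurable X]setTI.
  have mn : measurable_fun setT (fun x => `|h x|) by apply: measurableT_comp.
  exact: mn.
pose E k := [set x | `|gs k x| <= ln M].
have mE k : measurable (E k) by exact: mlevel.
pose L := [set x | `|ln (f x) - g0 x| <= delta].
have mL : measurable L.
  apply: mlevel; apply: measurable_funB; last exact: mG.
  by apply: measurableT_comp mf; exact: measurable_ln.
pose U1 := [set x | M < f x]; pose U2 := [set x | f x < M^-1].
have mU1 : measurable U1.
  rewrite (_ : U1 = f @^-1` `]M, +oo[); last first.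
    by apply/seteqP; split => x /=; rewrite in_itv/= andbT.
  by rewrite -[X in measurable X]setTI; apply: mf.
have mU2 : measurable U2.
  rewrite (_ : U2 = f @^-1` `]-oo, M^-1[); last first.
    by apply/seteqP; split => x /=; rewrite in_itv.
  by rewrite -[X in measurable X]setTI; apply: mf.
pose N := ~` S0 `|` (\bigcup_k ~` E k) `|` ~` L `|` (U1 `|` U2).
have mN : measurable N.
  apply: measurableU; last exact: measurableU.
  apply: measurableU; last exact: measurableC.
  apply: measurableU; first exact: measurableC.
  by apply: bigcupT_measurable => k; exact: measurableC.
have nuN : nu N = 0%E.
  apply/negligibleP => //; apply: negligibleU; last first.
    by apply: negligibleU; exact/negligibleP.
  apply: negligibleU; last first.
    apply: (negligible_of_ae mL nurho); move/ess_supP : g0f.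
    by apply: filterS => x; rewrite lee_fin.
  apply: negligibleU.
    apply/negligibleP; first exact: measurableC.
    apply/measure0_null_setP; first exact: measurableC.
    by apply: nurho; apply/measure0_null_setP => //; exact: measurableC.
  apply: negligible_bigcup => k; apply: (negligible_of_ae (mE k) nurho).
  have /ess_supP := bG _ (Ggs k).
  by apply: filterS => x; rewrite lee_fin.
have muN : mu N = 0%E.
  by apply/measure0_null_setP => //; apply: munu; exact/measure0_null_setP.
exists (~` N), gs; split.
- split; rewrite ?setCK//; first exact: measurableC.
  move=> x nN; apply: S0spt; apply: contrapT => nS0; apply: nN.
  by do 3 left.
- split=> // k x nN; apply: contrapT => nE; apply: nN.
  by left; left; right; exists k.
- move=> x nN; apply/andP; split; rewrite leNgt; apply/negP => h; apply: nN.
    by right; right.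
  by right; left.
- move=> x nN; apply: contrapT => nL; apply: nN.
  by left; right.
move=> g Gg; have [u [G0u ug]] := sepG g Gg.
have /choice[v vP] k := eG _ (G0u k).
exists (fun k => (v k).+1) => x nN /=.
rewrite (_ : (fun k => e (v k) x) = (fun k => u k x)); last first.
  by apply: funext => k; rewrite vP.
apply: ug; apply: S0spt; apply: contrapT => nS0; apply: nN.
by do 3 left.
Qed.

(** Composition with this map turns bounds valid on S into bounds valid everywhere; no integral
    changes when S has full measure. *)
Lemma measurable_retraction (S : set T) (x0 : T) : measurable S -> S x0 ->
  exists r : T -> T, [/\ measurable_fun setT r, forall x, S (r x) &
    forall x, S x -> r x = x].
Proof.
move=> mS Sx0; exists (fun x => if x \in S then x else x0); split.
- move=> _ B mB; rewrite setTI.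
  have [Bx0|nBx0] := pselect (B x0).
    rewrite (_ : _ @^-1` B = (S `&` B) `|` ~` S).
      by apply: measurableU; [exact: measurableI | exact: measurableC].
    apply/seteqP; split => x /=; case: (boolP (x \in S)) => [/set_mem Sx|nS].
    + by left.
    + by right => Sx; move: nS; rewrite mem_set.
    + by case=> [[]|].
    + by [].
  rewrite (_ : _ @^-1` B = S `&` B); first exact: measurableI.
  apply/seteqP; split => x /=; case: (boolP (x \in S)) => [/set_mem Sx|nS] //.
    by case.
  by case=> Sx; move: nS; rewrite mem_set.
- by move=> x; case: ifP => // /set_mem.
- by move=> x Sx; rewrite mem_set.
Qed.

End reduction.

(** * Deviation of the two estimators *)

Section deviation.
Context (R : realType) (d : nat).
Local Notation T := (d.-tuple R).
Variables (mu nu : probability T R) (f : T -> R) (M chat a delta z : R).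
Variables (G : set (T -> R)) (S : set T) (gs : nat -> T -> R) (r : T -> T).
Hypotheses (mS : measurable S) (nuS : nu (~` S) = 0%E) (muS : mu (~` S) = 0%E).
Hypothesis mf : measurable_fun setT f.
Hypotheses (mr : measurable_fun setT r) (Sr : forall x, S (r x)).
Hypothesis rid : forall x, S x -> r x = x.
Hypotheses (Ggs : forall k, G (gs k)) (mgs : forall k, measurable_fun setT (gs k)).
Hypothesis gsM : forall k x, S x -> `|gs k x| <= ln M.
Hypothesis gs_dense : forall g, G g -> exists v : nat -> nat, forall x, S x ->
  (fun k => gs (v k) x) @ \oo --> g x.
Hypothesis fM : density_ratio mu nu (f \o r) M.
Hypothesis approx : forall x, S x -> `|ln (f x) - gs 0%N x| <= delta.
Hypothesis ent : forall m,
  entropy_bound (fun (k : 'I_m.+1) x => gs k (r x)) chat (ln M) a.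
Hypotheses (chat_ge0 : 0 <= chat) (a01 : 0 < a < 1).
Hypotheses (delta_ge0 : 0 <= delta) (z_ge0 : 0 <= z).
Context (dO : measure_display) (O : measurableType dO) (P : probability O R).
Variables (n : nat) (X Y : 'I_n -> O -> T).
Hypothesis n_gt0 : (0 < n)%N.
Hypothesis indep : mutually_independent P
  (fun i : 'I_n + 'I_n => match i with inl j => X j | inr j => Y j end).
Hypothesis lawX : forall i A, measurable A -> P (X i @^-1` A) = mu A.
Hypothesis lawY : forall i A, measurable A -> P (Y i @^-1` A) = nu A.

Local Notation b := (ln M).
Local Notation w := ((Num.sqrt n%:R)^-1 + z).
Local Notation B := (Num.max 1 (Num.sqrt chat / (1 - a))).
Let gr k x := gs k (r x).
Let Z := joint_sample X Y.

Let bgr k : bmeas (gr k).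
Proof.
split; first exact: measurableT_comp mr.
by exists b => x; exact: gsM.
Qed.

Let grM k x : `|gr k x| <= b. Proof. exact: gsM. Qed.

Let grd x : `|ln ((f \o r) x) - gr 0 x| <= delta. Proof. exact: approx. Qed.

Let w_gt0 : 0 < w.
Proof. by rewrite ltr_wpDr// invr_gt0 sqrtr_gt0 ltr0n. Qed.

Let B_ge1 : 1 <= B. Proof. by rewrite le_max lexx. Qed.

Let mX i : measurable_fun setT (X i). Proof. exact: (indep.1 (inl i)). Qed.
Let mY i : measurable_fun setT (Y i). Proof. exact: (indep.1 (inr i)). Qed.

Let O0 := [set o | forall i, S (X i o) /\ S (Y i o)].

Let mO0 : measurable O0.
Proof.
rewrite (_ : O0 = \bigcap_(i in [set: 'I_n]) (X i @^-1` S `&` Y i @^-1` S)); last first.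
  by apply/seteqP; split => o /= H i; [move=> _; exact: H | exact: H].
apply: fin_bigcap_measurable => // i _; apply: measurableI.
  by rewrite -[X in measurable X]setTI; apply: mX.
by rewrite -[X in measurable X]setTI; apply: mY.
Qed.

Let PO0 : P (~` O0) = 0%E.
Proof.
apply/negligibleP; first exact: measurableC.
pose N (i : nat) := if insub i is Some j then X j @^-1` (~` S) `|` Y j @^-1` (~` S)
  else set0.
apply: (@negligibleS _ _ _ _ (\bigcup_i N i)).
  move=> o /= nO; apply: contrapT => nN; apply: nO => i; split; apply: contrapT => nS.
    by apply: nN; exists i => //; rewrite /N valK; left.
  by apply: nN; exists i => //; rewrite /N valK; right.
apply: negligible_bigcup => i; rewrite /N; case: insubP => [j _ _|_]; last first.
  exact: negligible_set0.
have mC := measurableC mS.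
apply: negligibleU; apply/negligibleP; first by rewrite -[X in measurable X]setTI; apply: mX.
- exact: eq_trans (lawX j mC) muS.
- by rewrite -[X in measurable X]setTI; apply: mY.
- exact: eq_trans (lawY j mC) nuS.
Qed.

Let emp_X (phi : R -> R) k o : O0 o ->
  emp (@lshift n n) (fun x => phi (gr k x)) (Z o) = emp_mean X (fun x => phi (gs k x)) o.
Proof.
move=> Oo; rewrite emp_joint_l /emp_mean; congr (_ * _); apply: eq_bigr => i _.
by rewrite /gr rid//; exact: (Oo i).1.
Qed.

Let emp_Y (phi : R -> R) k o : O0 o ->
  emp (@rshift n n) (fun x => phi (gr k x)) (Z o) = emp_mean Y (fun x => phi (gs k x)) o.
Proof.
move=> Oo; rewrite emp_joint_r /emp_mean; congr (_ * _); apply: eq_bigr => i _.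
by rewrite /gr rid//; exact: (Oo i).2.
Qed.

(** Bounded differences give a Gaussian tail for every z, which is at least as strong as the mixed
    tail of the statement. *)
Let tail_le : 2 * expR (- (n%:R * z ^+ 2)) <=
  2 * expR (- Num.min (n%:R * z ^+ 2) (n%:R * z)).
Proof. by rewrite ler_pM2l// ler_expR lerN2 ge_min lexx. Qed.

Let ae_S (p : probability T R) (h h' : T -> R) : p (~` S) = 0%E ->
  (forall x, S x -> h x = h' x) -> ae_eq p setT (EFin \o h) (EFin \o h').
Proof.
move=> pS hh'; exists (~` S); split => //; first exact: measurableC.
by move=> x /= H Sx; apply: H => _; rewrite hh'.
Qed.

Lemma kl_deviation (C : R) : 600 < C ->
  (outer_prob P [set o | (((M + 1) * delta + C * B * M * (1 + b `^ a) * w)%:E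
     <= `|DKL_hat G X Y o - DKL mu f|)%E] <=
   (2 * expR (- Num.min (n%:R * z ^+ 2) (n%:R * z)))%:E)%E.
Proof.
move=> C600; have M0 := ratio_M_gt0 fM.
have DE : DKL mu f = (\int[mu]_x ln ((f \o r) x))%:E.
  rewrite /DKL -bmeas_integralE; last exact: (bmeas_ln_ratio fM).
  apply: ae_eq_integral => //.
  - by apply/measurable_EFinP; exact: measurableT_comp mf.
  - by apply/measurable_EFinP; exact: (bmeas_ln_ratio fM).1.
  - by apply: (ae_S (h := fun x => ln (f x)) (h' := fun x => ln ((f \o r) x)) muS) => x Sx /=; rewrite rid.
rewrite DE; apply: le_trans (_ : _ <= (2 * expR (- (n%:R * z ^+ 2)))%:E)%E _; last first.
  by rewrite lee_fin; exact: tail_le.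
have K0 : 0 < B * (M * (1 + b `^ a)).
  by rewrite !mulr_gt0// ?(lt_le_trans ltr01 B_ge1)// ltr_pwDl// powR_ge0.
have lt1 : 600 * (B * (M * (1 + b `^ a))) * w < C * B * M * (1 + b `^ a) * w.
  have -> : C * B * M * (1 + b `^ a) = C * (B * (M * (1 + b `^ a))) by rewrite !mulrA.
  by rewrite ltr_pM2r// ltr_pM2r.
have Md0 : 0 <= (M + 1) * delta by rewrite mulr_ge0// addr_ge0// ltW.
have objE k o : O0 o -> kl_objective (gr k) (Z o) =
    emp_mean X (gs k) o - emp_mean Y (fun x => expR (gs k x)) o + 1.
  move=> Oo; rewrite /kl_objective.
  by rewrite (emp_X (fun y => y) k Oo) (emp_Y expR k Oo).
have bX : 0 <= b `^ a by exact: powR_ge0.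
apply: (outer_prob_deviation (Q := prodm (sample_law mu nu n) (n + n)) (Z := Z)
  (O0 := O0) (F := fun k => kl_objective (gr k))
  (tu := 600 * (B * (M * (1 + b `^ a))) * w)
  (tl := (M + 1) * delta + 600 * (B * (M * (1 + b `^ a))) * w)) => //.
- exact: measurable_joint_sample indep.
- exact: joint_sample_law indep lawX lawY.
- by move=> k; apply: bmeas_kl_objective.
- move=> m; exact: (kl_upper fM n_gt0 (g := fun (k : 'I_m.+1) => gr k)).
- rewrite opprD addrA; exact: (kl_lower fM n_gt0).
- by apply: lt_le_trans lt1 _; rewrite lerDr.
- by rewrite ltrD2l.
- move=> o Oo c Fc; apply: ge_ereal_sup => _ [g Gg <-]; rewrite lee_fin.
  have [v vP] := gs_dense Gg.
  have cvX := emp_mean_cvg (X := X) (o := o) (phi := fun y => y) (u := fun k => gs (v k)) (g := g).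
  have cvY := emp_mean_cvg (X := Y) (o := o) (phi := expR) (u := fun k => gs (v k)) (g := g).
  have cv : (fun k => emp_mean X (gs (v k)) o -
      emp_mean Y (fun x => expR (gs (v k) x)) o + 1) @ \oo -->
      (emp_mean X g o - emp_mean Y (fun x => expR (g x)) o + 1).
    apply: cvgD; last exact: cvg_cst.
    apply: cvgB.
      by apply: cvX => [y|i]; [exact: cvg_id | apply: vP; exact: (Oo i).1].
    by apply: cvY => [|i]; [exact: continuous_expR | apply: vP; exact: (Oo i).2].
  by apply: (cvgr_to_le cv); apply: nearW => k; rewrite -objE.
- move=> o Oo; rewrite (objE 0%N o Oo); apply: ereal_sup_ubound.
  by exists (gs 0%N).
Qed.

Lemma renyi_deviation (C alpha v : R) : 10 ^+ 7 < C -> 0 < alpha -> alpha != 1 ->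
  v = alpha * M `^ (2 * `|alpha - 1|) / `|alpha - 1|
        * (1 + (`|alpha - 1| * b) `^ (a / 2))
      + M `^ (2 * alpha) * (1 + (alpha * b) `^ a) ->
  (outer_prob P [set o | (((M `^ (2 * alpha) + M `^ (2 * `|alpha - 1|)) * delta +
       C * B * v * w)%:E <= `|Dalpha_hat alpha G X Y o - Dalpha alpha nu f|)%E] <=
   (2 * expR (- Num.min (n%:R * z ^+ 2) (n%:R * z)))%:E)%E.
Proof.
move=> C7 al0 al1 vdef; have M0 := ratio_M_gt0 fM.
have DE : Dalpha alpha nu f = (renyi_divergence nu (f \o r) alpha)%:E.
  rewrite /Dalpha /renyi_divergence /hellinger; congr (_ * ln _)%:E.
  rewrite /Rintegral; congr fine; apply: ae_eq_integral => //.
  - by apply/measurable_EFinP; exact: measurableT_comp (measurable_powR alpha) mf.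
  - apply/measurable_EFinP.
    exact: (bmeas_expR (bmeasZ alpha (bmeas_ln_ratio fM))).1.
  - apply: (ae_S (h := fun x => f x `^ alpha)
      (h' := fun x => expR (alpha * ln ((f \o r) x))) nuS) => x Sx /=.
    have := ratio_gt0 fM x; rewrite /= rid// => fx0.
    by rewrite /powR gt_eqF.
rewrite DE; apply: le_trans (_ : _ <= (2 * expR (- (n%:R * z ^+ 2)))%:E)%E _; last first.
  by rewrite lee_fin; exact: tail_le.
have powE y : M `^ (2 * y) = expR (y * b) ^+ 2.
  by rewrite /powR gt_eqF// expr2 -expRD; congr expR; ring.
have vE : v = alpha / `|alpha - 1| * expR (`|alpha - 1| * b) ^+ 2 *
    (1 + (`|alpha - 1| * b) `^ (a / 2)) +
    expR (alpha * b) ^+ 2 * (1 + (alpha * b) `^ a).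
  by rewrite vdef !powE; congr (_ * _ + _); rewrite mulrAC.
have Wv : renyi_weight M alpha <= v by rewrite vE; exact: renyi_weight_le.
have v0 : 0 < v := lt_le_trans (renyi_weight_gt0 M al0 al1) Wv.
have B0 : 0 < B := lt_le_trans ltr01 B_ge1.
have lt1 : 10 ^+ 7 * (B * v) * w < C * B * v * w.
  have -> : C * B * v = C * (B * v) by rewrite mulrA.
  have Bv : 0 < B * v by exact: mulr_gt0.
  by rewrite ltr_pM2r// ltr_pM2r.
have M1 := ratio_ge1 fM.
(* The bias is 2 delta, and both powers of M are at least 1. *)
have d2 : 2 * delta <= (M `^ (2 * alpha) + M `^ (2 * `|alpha - 1|)) * delta.
  apply: ler_wpM2r => //.
  have p1 y : 0 <= y -> 1 <= M `^ (2 * y).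
    move=> y0; rewrite powE -[leLHS](expr1n _ 2) lerXn2r ?nnegrE ?expR_ge0//.
    by rewrite -expR0 ler_expR mulr_ge0// (ratio_b_ge0 fM).
  have h1 := p1 _ (ltW al0); have h2 := p1 _ (normr_ge0 (alpha - 1)).
  exact: (lerD h1 h2).
have c600 : 600 <= 10 ^+ 7 * B.
  have h := constant_2400 R; have h2 : 10 ^+ 7 <= 10 ^+ 7 * B by rewrite ler_peMr// exprn_ge0.
  by apply: le_trans h2; apply: le_trans h; rewrite ler_nat.
have objE k o : O0 o -> renyi_objective alpha (gr k) (Z o) = alpha / (alpha - 1) *
      ln (emp_mean X (fun x => expR ((alpha - 1) * gs k x)) o) -
    ln (emp_mean Y (fun x => expR (alpha * gs k x)) o).
  move=> Oo; rewrite /renyi_objective.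
  have eX := emp_X (fun y => expR ((alpha - 1) * y)) k Oo.
  have eY := emp_Y (fun y => expR (alpha * y)) k Oo.
  by rewrite -eX -eY.
apply: (outer_prob_deviation (Q := prodm (sample_law mu nu n) (n + n)) (Z := Z)
  (O0 := O0) (F := fun k => renyi_objective alpha (gr k))
  (tu := 10 ^+ 7 * (B * v) * w) (tl := 2 * delta + 10 ^+ 7 * (B * v) * w)) => //.
- exact: measurable_joint_sample indep.
- exact: joint_sample_law indep lawX lawY.
- by move=> k; exact: bmeas_renyi_objective n_gt0 _ (bgr k) (grM k).
- move=> m; rewrite vE.
  exact: (renyi_upper fM al0 al1 n_gt0 (g := fun (k : 'I_m.+1) => gr k)).
- rewrite opprD addrA mulrA.
  exact: (renyi_lower fM al0 al1 n_gt0 (bgr 0%N) (grM 0%N) grd c600 Wv z_ge0).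
- by apply: lt_le_trans lt1 _; rewrite lerDr; apply: le_trans d2; rewrite mulr_ge0.
- exact: ler_ltD.
- move=> o Oo c Fc; apply: ge_ereal_sup => _ [g Gg <-]; rewrite lee_fin.
  have [u uP] := gs_dense Gg.
  have expc (y : R) : continuous (fun x : R => expR (y * x)).
    move=> x; apply: continuous_comp; last exact: continuous_expR.
    by apply: mulrl_continuous.
  have pos (V : 'I_n -> O -> T) (y : R) : 0 < emp_mean V (fun x => expR (y * g x)) o.
    rewrite /emp_mean mulr_gt0 ?invr_gt0 ?ltr0n//.
    rewrite (bigD1 (Ordinal n_gt0))//= ltr_pwDl ?expR_gt0//.
    by apply: sumr_ge0 => i _; exact: expR_ge0.
  have cvl (V : 'I_n -> O -> T) (y : R) : (forall i, S (V i o)) ->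
      (fun k => ln (emp_mean V (fun x => expR (y * gs (u k) x)) o)) @ \oo -->
      ln (emp_mean V (fun x => expR (y * g x)) o).
    move=> SV; apply: continuous_cvg; first exact: continuous_ln (pos V y).
    apply: (emp_mean_cvg (phi := fun x => expR (y * x)) (u := fun k => gs (u k))).
      exact: expc.
    by move=> i; apply: uP; exact: SV.
  have cv := cvgB (cvgM (cvg_cst (alpha / (alpha - 1))) (cvl X (alpha - 1) (fun i => (Oo i).1)))
    (cvl Y alpha (fun i => (Oo i).2)).
  by apply: (cvgr_to_le (cv _ _ _)); apply: nearW => k; have := Fc (u k); rewrite objE.
- move=> o Oo; rewrite (objE 0%N o Oo); apply: ereal_sup_ubound.
  by exists (gs 0%N).
Qed.

End deviation.

Theorem theorem4 (R : realType) :
  exists C : R, 1 <= C /\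
  forall (d : nat) (beta M chat : R)
    (rho : {measure set (d.-tuple R) -> \bar R})
    (G : set (d.-tuple R -> R)),
  (1 <= d)%N -> d%:R / 2 < beta -> 1 <= M -> 0 <= chat ->
  sigma_finite setT rho ->
  let a := d%:R / (2 * beta) in
  let b := ln M in
  (forall g, G g -> measurable_fun setT g) ->
  pointwise_separable (spt rho) G ->
  (forall g, G g -> (ess_sup rho (fun x => (`|g x|)%:E) <= b%:E)%E) ->
  (forall (m : nat) (w : 'I_m -> R) (xs : 'I_m -> d.-tuple R),
     (forall i, 0 <= w i) -> \sum_(i < m) w i = 1 ->
     (forall i, 0 < w i -> spt rho (xs i)) ->
     forall eps : R, 0 < eps ->
       (covering_number w xs eps G
          <= (expR (chat * (b / eps) `^ (d%:R / beta)))%:E)%E) ->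
  let c := C * Num.max 1 (Num.sqrt chat / (1 - a)) in
  forall (delta : R) (n : nat) (z : R)
    (mu nu : probability (d.-tuple R) R) (pmu pnu f : d.-tuple R -> R),
  0 <= delta -> (1 <= n)%N -> 0 <= z ->
  (* (mu, nu) in \bar{P}_{M,rho}(G, delta) *)
  mu `<< nu -> nu `<< mu -> nu `<< rho ->
  is_density rho mu pmu -> is_density rho nu pnu ->
  (ess_sup rho (fun x => (pmu x / pnu x)%:E) <= M%:E)%E ->
  (ess_sup rho (fun x => (pnu x / pmu x)%:E) <= M%:E)%E ->
  is_density nu mu f ->
  (exists g, G g /\
     (ess_sup rho (fun x => (`|ln (f x) - g x|)%:E) <= delta%:E)%E) ->
  (* i.i.d. samples X_1..X_n ~ mu, Y_1..Y_n ~ nu, all independent *)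
  forall (dO : measure_display) (O : measurableType dO) (P : probability O R)
    (X Y : 'I_n -> O -> d.-tuple R),
  mutually_independent P
    (fun i : 'I_n + 'I_n => match i with inl j => X j | inr j => Y j end) ->
  (forall i A, measurable A -> P (X i @^-1` A) = mu A) ->
  (forall i A, measurable A -> P (Y i @^-1` A) = nu A) ->
  let r := 2 * expR (- Num.min (n%:R * z ^+ 2) (n%:R * z)) in
  (outer_prob P
     [set omega | ((((M + 1) * delta
                    + c * M * (1 + b `^ a) * ((Num.sqrt n%:R)^-1 + z))%:E)
                   <= `|DKL_hat G X Y omega - DKL mu f|)%E]
     <= r%:E)%E
  /\
  (forall alpha : R, 0 < alpha -> alpha != 1 ->
     let v := alpha * M `^ (2 * `|alpha - 1|) / `|alpha - 1|
                * (1 + (`|alpha - 1| * b) `^ (a / 2))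
              + M `^ (2 * alpha) * (1 + (alpha * b) `^ a) in
     (outer_prob P
        [set omega | ((((M `^ (2 * alpha) + M `^ (2 * `|alpha - 1|)) * delta
                       + c * v * ((Num.sqrt n%:R)^-1 + z))%:E)
                      <= `|Dalpha_hat alpha G X Y omega - Dalpha alpha nu f|)%E]
        <= r%:E)%E).
Proof.
(* The estimates hold with 10^7, and with 600 in the Kullback-Leibler case; the doubling provides
   the strict gaps required by [outer_prob_deviation]. *)
exists (2 * 10 ^+ 7); have C2400 := constant_2400 R.
have C7 : 10 ^+ 7 < 2 * 10 ^+ 7 :> R by rewrite ltr_pMl ?ltr1n// exprn_gt0.
have C600 : 600 < 2 * 10 ^+ 7 :> R.
  by apply: le_lt_trans C7; apply: le_trans C2400; rewrite ler_nat.
split; first by apply: ltW; apply: le_lt_trans C600; rewrite ler1n.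
move=> d beta M chat rho G d1 dbeta M1 chat0 _ a b mG sepG bG cov c.
move=> delta n z mu nu pmu pnu f delta0 n1 z0 munu numu nurho dmu dnu rat1 rat2 df ex.
move=> dO O P X Y indep lawX lawY q.
have M0 : 0 < M := lt_le_trans ltr01 M1.
have d0 : 0 < d%:R :> R by rewrite ltr0n.
have beta0 : 0 < beta by apply: lt_trans dbeta; rewrite divr_gt0.
have a01 : 0 < a < 1.
  rewrite /a divr_gt0 ?mulr_gt0//= ltr_pdivrMr ?mulr_gt0// mul1r.
  by rewrite mulrC -ltr_pdivrMr.
have da : d%:R / beta = 2 * a.
  by rewrite /a; field; rewrite gt_eqF.
have [S [gs [[mS nuS muS Sspt] [Ggs gsM] fS approx dense]]] :=
  good_set M1 mG sepG bG munu numu nurho dmu dnu rat1 rat2 df ex.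
have [x0 Sx0] : S !=set0.
  apply/set0P/eqP => S0; move: nuS; rewrite S0 setC0 => h.
  by have := @prob_setT _ _ _ nu; rewrite h => /esym/eqP; rewrite onee_eq0.
have [r [mr Sr rid]] := measurable_retraction mS Sx0.
have bfr : bmeas (f \o r).
  split; first exact: measurableT_comp df.1 mr.
  exists M => x /=; have /andP[h1 h2] := fS _ (Sr x).
  by rewrite ger0_norm//; exact: df.2.1.
have fM : density_ratio mu nu (f \o r) M.
  split=> // [x|x|]; first by have /andP[] := fS _ (Sr x).
    by have /andP[] := fS _ (Sr x).
  apply: (mean_density munu df bfr); exists (~` S); split => //.
    exact: measurableC.
  by move=> x /= H Sx; apply: H => _ /=; rewrite rid.
have mgs k := mG _ (Ggs k).
have ent m : entropy_bound (fun (k : 'I_m.+1) x => gs k (r x)) chat b a.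
  by apply: (covering_entropy (gs := fun k : 'I_m.+1 => gs k) cov da) => // x; exact: Sspt.
split; first exact: (kl_deviation mS nuS muS df.1 mr Sr rid Ggs mgs gsM dense fM approx ent).
move=> alpha al0 al1.
exact: (renyi_deviation mS nuS muS df.1 mr Sr rid Ggs mgs gsM dense fM approx ent
  chat0 a01 delta0 z0 n1 indep lawX lawY C7 al0 al1 erefl).
Qed.
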